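(* Suppose Assumptions A and B hold and that $\mathbb{E}[|\varphi(Y,Z)|^{2+\delta}]<\infty$ for some $\delta>0$. Let $\gamma_n=\gamma_1n^{-\beta}$, $n\ge1$, with $\gamma_1>0$ and $\beta\in(\frac12,1)$. Then, as $\mathcal H\ni h\downarrow0$, $$h^{-1}\begin{pmatrix}\overline\xi^h_{\lceil h^{-2}\rceil}-\xi^h_\star\\ \chi^h_{\lceil h^{-2}\rceil}-\chi^h_\star\end{pmatrix}\xrightarrow{\ \mathcal L\ }\mathcal N(0,\overline\Sigma),\qquad \overline\Sigma=\begin{pmatrix}\dfrac{\alpha(1-\alpha)}{f_{X_0}(\xi^0_\star)^2} & \dfrac{\alpha}{1-\alpha}\dfrac{\mathbb E[(X_0-\xi^0_\star)^+]}{f_{X_0}(\xi^0_\star)}\\[2mm] \dfrac{\alpha}{1-\alpha}\dfrac{\mathbb E[(X_0-\xi^0_\star)^+]}{f_{X_0}(\xi^0_\star)} & \dfrac{\mathrm{Var}((X_0-\xi^0_\star)^+)}{(1-\alpha)^2}\end{pmatrix}.$$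
   Context: Fix $\alpha\in(0,1)$. Let $Y$ ($\mathbb R^d$-valued) and $Z$ ($\mathbb R^q$-valued) be independent random variables and $\varphi:\mathbb R^d\times\mathbb R^q\to\mathbb R$ measurable with $\varphi(Y,Z)\in L^1$. Set $X_0=\mathbb E[\varphi(Y,Z)\mid Y]$ and $\mathcal H=\{1/K:K\in\mathbb N,K\ge1\}$. For $h=1/K\in\mathcal H$, $X_h=\frac1K\sum_{k=1}^K\varphi(Y,Z^{(k)})$, where $Z^{(1)},\dots,Z^{(K)}$ are i.i.d. copies of $Z$ independent of $Y$. For $h\in\mathcal H\cup\{0\}$, $F_{X_h}$ denotes the cdf and $f_{X_h}$ the pdf of $X_h$, and $V_h(\xi)=\xi+\frac1{1-\alpha}\mathbb E[(X_h-\xi)^+]$, so that $V_h''=f_{X_h}/(1-\alpha)$; under Assumption A, $V_h$ has a unique minimizer $\xi^h_\star$, and $\chi^h_\star:=V_h(\xi^h_\star)=\min V_h$. Let $H_1(\xi,x)=1-\frac1{1-\alpha}\mathbf 1_{x\ge\xi}$ and $H_2(\xi,\chi,x)=\chi-\xi-\frac1{1-\alpha}(x-\xi)^+$. NSA scheme: given positive steps $(\gamma_n)_{n\ge1}$ and $h\in\mathcal H$, let $(X_h^{(n)})_{n\ge1}$ be i.i.d. copies of $X_h$, $\xi^h_0$ a real random variable independent of them, $\chi^h_0=0$, and for $n\ge0$: $\xi^h_{n+1}=\xi^h_n-\gamma_{n+1}H_1(\xi^h_n,X_h^{(n+1)})$, $\chi^h_{n+1}=\chi^h_n-\frac1{n+1}H_2(\xi^h_n,\chi^h_n,X_h^{(n+1)})$.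 The averaged VaR iterate is $\overline\xi^h_n=\frac1n\sum_{k=1}^n\xi^h_k$, $n\ge1$. Assumption A: (i) for each $h\in\mathcal H$, $F_{X_h}(\xi)-F_{X_0}(\xi)=v(\xi)h+w(\xi,h)h$ for all $\xi\in\mathbb R$, for functions $v,w(\cdot,h):\mathbb R\to\mathbb R$ with $\int_{\xi^0_\star}^\infty v(\xi)d\xi<\infty$ and $\lim_{\mathcal H\ni h\downarrow0}w(\xi^0_\star,h)=\lim_{\mathcal H\ni h\downarrow0}\int_{\xi^0_\star}^\infty w(\xi,h)d\xi=0$ for any minimizer $\xi^0_\star$ of $V_0$; (ii) for each $h\in\mathcal H\cup\{0\}$, $X_h$ has a continuous pdf $f_{X_h}$, and $f_{X_h}\to f_{X_0}$ locally uniformly as $\mathcal H\ni h\downarrow0$; (iii) for every $R>0$, $\inf_{h\in\mathcal H\cup\{0\},\,\xi\in B(\xi^0_\star,R)}f_{X_h}(\xi)>0$; (iv) $\sup_{h\in\mathcal H\cup\{0\}}(\|f_{X_h}\|_\infty+[f_{X_h}]_{\rm Lip})<\infty$, where $[\cdot]_{\rm Lip}$ is the Lipschitz constant. Assumption B: with $c_\alpha=1\vee\frac{\alpha}{1-\alpha}$, $\sup_{h\in\mathcal H}\mathbb E\big[|\xi^h_0|^2\exp\big(\frac{4}{1-\alpha}c_\alpha\sup_{h'\in\mathcal H}\|f_{X_{h'}}\|_\infty|\xi^h_0|\big)\big]<\infty$. *)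

(* Defs.v *)
From HB Require Import structures.
From mathcomp Require Import all_boot all_order all_algebra.
From mathcomp Require Import all_classical all_reals all_analysis.
Set Implicit Arguments. Unset Strict Implicit. Unset Printing Implicit Defensive.
Import Order.TTheory GRing.Theory Num.Theory numFieldNormedType.Exports.
Local Open Scope classical_set_scope.
Local Open Scope ring_scope.

Section Defs.
Context {R : realType}.

(* Borel sigma-algebra on R^n = 'rV[R]_n, generated by the coordinate maps *)
Definition rV_gen (n : nat) : set (set 'rV[R]_n) :=
  fun S => exists (i : 'I_n) (B : set R), measurable B /\ S = [set v | B (v ord0 i)].

Definition Rvec (n : nat) := g_sigma_algebraType (@rV_gen n).

Context {d : measure_display} {Omega : measurableType d} (P : probability Omega R).

Definition same_law {dT} {T : measurableType dT} (X1 X2 : Omega -> T) :=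
  forall B, measurable B -> P (X1 @^-1` B) = P (X2 @^-1` B).

Definition indep2 {d1 d2} {T1 : measurableType d1} {T2 : measurableType d2}
  (X1 : Omega -> T1) (X2 : Omega -> T2) :=
  forall A B, measurable A -> measurable B ->
    P (X1 @^-1` A `&` X2 @^-1` B) = (P (X1 @^-1` A) * P (X2 @^-1` B))%E.

Definition indep_family {d1 d2} {T1 : measurableType d1} {T2 : measurableType d2}
  (X1 : Omega -> T1) (Xs : nat -> Omega -> T2) (N : nat) :=
  forall (A : set T1) (B : nat -> set T2), measurable A -> (forall k, measurable (B k)) ->
    fine (P (X1 @^-1` A `&` \bigcap_(k in [set k | (k < N)%N]) (Xs k @^-1` B k)))
    = fine (P (X1 @^-1` A)) * \prod_(k < N) fine (P (Xs k @^-1` B k)).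

Definition cond_exp_of {dT} {T : measurableType dT} (Y : Omega -> T) (U X0 : Omega -> R) :=
  (forall B : set R, measurable B -> exists C : set T, measurable C /\ X0 @^-1` B = Y @^-1` C)
  /\ P.-integrable setT (EFin \o X0)
  /\ (forall C : set T, measurable C ->
        (\int[P]_(w in Y @^-1` C) (X0 w)%:E = \int[P]_(w in Y @^-1` C) (U w)%:E)%E).

Definition cdf_of (X : Omega -> R) (x : R) : R := fine (P (X @^-1` `]-oo, x])).

Definition is_pdf (X : Omega -> R) (f : R -> R) :=
  forall B : set R, measurable B ->
    P (X @^-1` B) = (\int[lebesgue_measure]_(x in B) (f x)%:E)%E.

Definition posp (x : R) : R := Num.max x 0.

Definition Vfun (alpha : R) (X : Omega -> R) (xi : R) : R :=
  xi + (1 - alpha)^-1 * fine ('E_P[fun w => posp (X w - xi)]).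

Definition is_minimizer (g : R -> R) (m : R) := forall x, g m <= g x.

Definition H1 (alpha xi x : R) : R := 1 - (1 - alpha)^-1 * (if xi <= x then 1 else 0).
Definition H2 (alpha xi chi x : R) : R := chi - xi - (1 - alpha)^-1 * posp (x - xi).

(* NSA scheme: Xs n is X^{(n+1)}; returns (xi_n, chi_n) *)
Fixpoint nsa (alpha : R) (gamma : nat -> R) (Xs : nat -> Omega -> R) (xi0 : Omega -> R)
  (n : nat) (w : Omega) : R * R :=
  match n with
  | 0 => (xi0 w, 0)
  | n'.+1 => let p := nsa alpha gamma Xs xi0 n' w in
      (p.1 - gamma n'.+1 * H1 alpha p.1 (Xs n' w),
       p.2 - (n'.+1%:R)^-1 * H2 alpha p.1 p.2 (Xs n' w))
  end.

Definition xibar (alpha : R) (gamma : nat -> R) (Xs : nat -> Omega -> R) (xi0 : Omega -> R)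
  (n : nat) (w : Omega) : R :=
  (n%:R)^-1 * \sum_(1 <= k < n.+1) (nsa alpha gamma Xs xi0 k w).1.

Definition cvg_law (V : nat -> Omega -> R * R) (mu : probability (R * R)%type R) :=
  forall g : R * R -> R, continuous g -> (exists M, forall p, `|g p| <= M) ->
    (fun K => fine ('E_P[g \o V K])) @ \oo --> fine (\int[mu]_p (g p)%:E)%E.

End Defs.

(* mu is the centered Gaussian law N(0, [[s11, s12], [s12, s22]]) on R^2,
   characterized by its characteristic function *)
Definition is_gauss2 {R : realType} (s11 s12 s22 : R) (mu : probability (R * R)%type R) :=
  forall u1 u2 : R,
    (\int[mu]_p (cos (u1 * p.1 + u2 * p.2))%:E
       = (expR (- (u1 ^+ 2 * s11 + 2 * u1 * u2 * s12 + u2 ^+ 2 * s22) / 2))%:E)%E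
    /\ (\int[mu]_p (sin (u1 * p.1 + u2 * p.2))%:E = 0)%E.

(* Main.v *)
(** Fix [h = 1/K] and [n = K^2], let [D] be the mean of [H1 alpha xi X_h] as a function of [xi], and
    let [b = D'(xis) = f_h(xis)/(1 - alpha)].

    An exponential Lyapunov function of [xi_k - xis] contracts under [D], although [D] is bounded,
    and bounds [E (xi_k - xis)^2] by a multiple of [gamma_k], uniformly in [h]. Dividing the
    [k]-th increment of the VaR recursion by its step and summing by parts gives, up to
    [o(sqrt n)] in [L^1], [b * sum_(k<n) (xi_k - xis) = - sum_(k<n) H1 alpha xis X_k]. The ES
    iterate is the mean over [k < n] of [xi_k + (X_k - xi_k)^+/(1 - alpha)]; replacing [xi_k] by
    [xis] changes it by a martingale increment of small variance plus [V(xi_k) - V(xis)], which is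
    quadratic in [xi_k - xis]. Both errors, multiplied by [sqrt n = K], are thus [L^1]-close to
    normalized sums of i.i.d. centered variables whose law depends on [h].

    A Lindeberg central limit theorem for characteristic functions applies to these triangular
    arrays: the [2 + delta] moment makes [X_h^2] uniformly integrable in [h], and together with the
    local uniform convergence of densities this yields the convergence of [xis], of [f_h(xis)] and
    of the covariances, without any coupling of [X_h] with [X_0]. *)
From HB Require Import structures.
From mathcomp Require Import all_boot all_order all_algebra.
From mathcomp Require Import all_classical all_reals all_analysis.
From mathcomp Require Import measurable_realfun ring lra.
Require Import Defs.
Set Implicit Arguments. Unset Strict Implicit. Unset Printing Implicit Defensive.
Import Order.TTheory GRing.Theory Num.Theory numFieldNormedType.Exports.
Local Open Scope classical_set_scope.
Local Open Scope ring_scope.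

(** * Expectations of real random variables *)

(** The square of [xi_k - xis] is no Lyapunov function here: far from the minimizer [D] stays
    bounded, so the drift of the square is only linear in the distance. For [lyap l] the drift is
    proportional to the function itself, at the price of an exponential moment of [xi0], which
    Assumption B supplies. The constants ([A] in [SA_sqr_bound], the truncation levels) are chosen
    before [K], because the horizon [K^2] and the law of [X_h] move together. With a mean-square
    error of order [k^(-beta)], the remainders of the averaged VaR are of orders [n^(beta/2)]
    (boundary and Abel terms), [n^(1/2 - beta/4)] (martingale) and [n^(1 - beta)] (linearization):
    for [1/2 < beta < 1] all are [o(sqrt n)]. Conditional expectations are replaced by a freezing
    lemma, and complex characteristic functions by means of [cos (u x + v y + c)] with a free phase
    [c]. Products of such cosines are sums of such cosines; the algebra they span approximates
    continuous functions on boxes, and a uniform first-moment bound controls what lies outside. *)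

Lemma measurable_posp {R : realType} : measurable_fun setT (@posp R).
Proof. by apply: measurable_maxr; [exact: measurable_id|exact: measurable_cst]. Qed.

Lemma measurable_cos {R : realType} : measurable_fun setT (@cos R).
Proof. by apply: continuous_measurable_fun; exact: continuous_cos. Qed.

Lemma measurable_sin {R : realType} : measurable_fun setT (@sin R).
Proof. by apply: continuous_measurable_fun; exact: continuous_sin. Qed.

(** Recursion on the head symbol of the function body; the leaves are closed by [done], by constants
    or by the identity. *)
Ltac meas :=
  first [ done
  | exact: measurable_cst
  | exact: measurable_id
  | match goal with |- measurable_fun _ ?f => lazymatch f with
    | (fun x => _ + _) => apply: measurable_funD; meas
    | (fun x => - _) => apply: measurable_funN; meas
    | (fun x => _ * _) => apply: measurable_funM; meas
    | (fun x => _ ^+ _) => apply: measurable_funX; meas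
    | (fun x => (_, _)) => apply: measurable_fun_pair; meas
    | (fun x => if _ then _ else _) => apply: measurable_fun_ifT; meas
    | (fun x => (_ <= _)%R) => apply: measurable_fun_ler; meas
    | (fun x => expR _) => apply: (measurableT_comp (@measurable_expR _)); meas
    | (fun x => cos _) => apply: (measurableT_comp measurable_cos); meas
    | (fun x => sin _) => apply: (measurableT_comp measurable_sin); meas
    | (fun x => posp _) => apply: (measurableT_comp measurable_posp); meas
    | (fun x => `|_|) => apply: (measurableT_comp (@normr_measurable _ setT)); meas
    | (fun x => fst _) => apply: (measurableT_comp measurable_fst); meas
    | (fun x => snd _) => apply: (measurableT_comp measurable_snd); meas
    end end
  ].

Section Base.
Context {R : realType} {d : measure_display} {T : measurableType d} (P : probability T R).
Implicit Types (X Y : T -> R) (k c : R).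

Definition L1 (X : T -> R) := P.-integrable setT (EFin \o X).
Definition Ex (X : T -> R) := \int[P]_w X w.

Lemma L1_meas X : L1 X -> measurable_fun setT X.
Proof. by move=> /measurable_int /measurable_EFinP. Qed.

Lemma L1_cst c : L1 (fun _ => c).
Proof. exact: finite_measure_integrable_cst. Qed.

Lemma L1D X Y : L1 X -> L1 Y -> L1 (fun w => X w + Y w).
Proof. by move=> hX hY; exact: (integrableD measurableT hX hY). Qed.

Lemma L1Z k X : L1 X -> L1 (fun w => k * X w).
Proof. by move=> hX; exact: (integrableZl measurableT k hX). Qed.

Lemma L1N X : L1 X -> L1 (fun w => - X w).
Proof. by move=> hX; exact: (integrableN hX). Qed.

Lemma L1B X Y : L1 X -> L1 Y -> L1 (fun w => X w - Y w).
Proof. by move=> hX hY; apply: L1D => //; exact: L1N. Qed.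

Lemma L1_le X Y : measurable_fun setT X -> (forall w, `|X w| <= Y w) -> L1 Y -> L1 X.
Proof.
move=> mX XY hY; apply: le_integrable hY => //; first exact/measurable_EFinP.
by move=> w _ /=; rewrite lee_fin (le_trans (XY w))// ler_norm.
Qed.

Lemma L1_norm X : L1 X -> L1 (fun w => `|X w|).
Proof. by move=> h; exact: integrable_norm. Qed.

Lemma L1_bounded X M : measurable_fun setT X -> (forall w, `|X w| <= M) -> L1 X.
Proof. by move=> mX XM; exact: (L1_le mX XM (L1_cst M)). Qed.

Lemma L1_sum (I : Type) (s : seq I) (F : I -> T -> R) :
  (forall i, L1 (F i)) -> L1 (fun w => \sum_(i <- s) F i w).
Proof.
move=> h; elim: s => [|i s IH].
  by under eq_fun do rewrite big_nil; exact: L1_cst.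
by under eq_fun do rewrite big_cons; exact: L1D.
Qed.

Lemma L1_sqr_le X : measurable_fun setT X -> L1 (fun w => X w ^+ 2) -> L1 X.
Proof.
move=> mX h; apply: (@L1_le _ (fun w => 1 + X w ^+ 2)) => //.
  by move=> w; rewrite -(real_normK (num_real (X w))); have := sqr_ge0 (`|X w| - 1); nra.
by apply: L1D => //; exact: L1_cst.
Qed.

Lemma L1_sqrD X Y : measurable_fun setT X -> measurable_fun setT Y ->
  L1 (fun w => X w ^+ 2) -> L1 (fun w => Y w ^+ 2) -> L1 (fun w => (X w + Y w) ^+ 2).
Proof.
move=> mX mY hX hY.
apply: (@L1_le _ (fun w => 2 * X w ^+ 2 + 2 * Y w ^+ 2)).
- by meas.
- by move=> w; rewrite ger0_norm ?sqr_ge0//; have := sqr_ge0 (X w - Y w); nra.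
- by apply: L1D; exact: L1Z.
Qed.

Lemma L1_sqrZ k X : L1 (fun w => X w ^+ 2) -> L1 (fun w => (k * X w) ^+ 2).
Proof. by move=> hX; under eq_fun do rewrite exprMn; exact: L1Z. Qed.

Lemma ExD X Y : L1 X -> L1 Y -> Ex (fun w => X w + Y w) = Ex X + Ex Y.
Proof. by move=> hX hY; exact: RintegralD. Qed.

Lemma ExB X Y : L1 X -> L1 Y -> Ex (fun w => X w - Y w) = Ex X - Ex Y.
Proof. by move=> hX hY; exact: RintegralB. Qed.

Lemma ExZ k X : L1 X -> Ex (fun w => k * X w) = k * Ex X.
Proof. by move=> hX; exact: RintegralZl. Qed.

Lemma ExN X : L1 X -> Ex (fun w => - X w) = - Ex X.
Proof.
move=> hX; rewrite -mulN1r -ExZ//; congr (Ex _); apply/funext => w.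
by rewrite mulN1r.
Qed.

Lemma Ex_cst c : Ex (fun _ => c) = c.
Proof.
by rewrite /Ex Rintegral_cst//= probability_setT mulr1.
Qed.

Lemma Ex_le X Y : L1 X -> L1 Y -> (forall w, X w <= Y w) -> Ex X <= Ex Y.
Proof. by move=> hX hY XY; apply: le_Rintegral. Qed.

Lemma Ex_ge0 X : (forall w, 0 <= X w) -> 0 <= Ex X.
Proof. by move=> h; apply: Rintegral_ge0. Qed.

Lemma Ex_norm X : L1 X -> `|Ex X| <= Ex (fun w => `|X w|).
Proof. by move=> h; apply: le_normr_Rintegral. Qed.

Lemma Ex_norm_le X Y : L1 X -> L1 Y -> (forall w, `|X w| <= Y w) -> `|Ex X| <= Ex Y.
Proof.
by move=> h hY XY; apply: le_trans (Ex_norm h) _; apply: Ex_le => //; exact: L1_norm.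
Qed.

Lemma Ex_norm_bound X M : measurable_fun setT X -> (forall w, `|X w| <= M) -> `|Ex X| <= M.
Proof.
move=> mX h; rewrite -(Ex_cst M); apply: Ex_norm_le => //; last exact: L1_cst.
exact: L1_bounded h.
Qed.

Lemma Ex_sum (I : Type) (s : seq I) (F : I -> T -> R) :
  (forall i, L1 (F i)) -> Ex (fun w => \sum_(i <- s) F i w) = \sum_(i <- s) Ex (F i).
Proof.
move=> h; elim: s => [|i s IH].
  by rewrite big_nil; under eq_fun do rewrite big_nil; exact: Ex_cst.
rewrite big_cons -IH; under eq_fun do rewrite big_cons.
by rewrite ExD//; exact: L1_sum.
Qed.

Lemma ExE X : L1 X -> ((Ex X)%:E = \int[P]_w (X w)%:E)%E.
Proof. by move=> h; rewrite /Ex /Rintegral fineK// integrable_fin_num. Qed.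

Lemma EfineE X : fine ('E_P[X])%E = Ex X.
Proof. by rewrite unlock. Qed.

Lemma L1_ge0_lty X : measurable_fun setT X -> (forall w, 0 <= X w) ->
  (\int[P]_w (X w)%:E < +oo)%E -> L1 X.
Proof.
move=> mX X0 h; apply/integrableP; split; first exact/measurable_EFinP.
by under eq_integral do rewrite /= ger0_norm//.
Qed.

(* Cauchy-Schwarz against the constant 1, through the variance of |X|. *)
Lemma Ex_norm_sqr X : measurable_fun setT X -> L1 (fun w => X w ^+ 2) ->
  Ex (fun w => `|X w|) ^+ 2 <= Ex (fun w => X w ^+ 2).
Proof.
move=> mX h; set m := Ex _.
have h1 : L1 (fun w => `|X w|) by apply: L1_norm; exact: L1_sqr_le.
have : 0 <= Ex (fun w => (`|X w| - m) ^+ 2) by apply: Ex_ge0 => w; exact: sqr_ge0.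
have -> : (fun w => (`|X w| - m) ^+ 2) = (fun w => X w ^+ 2 - (2 * m) * `|X w| + m ^+ 2).
  apply/funext => w; rewrite -(real_normK (num_real (X w))); ring.
rewrite ExD; [|apply: L1B => //; exact: L1Z|exact: L1_cst].
rewrite ExB//; last exact: L1Z.
by rewrite ExZ// Ex_cst -/m; nra.
Qed.

Lemma Ex_norm_sqrt X C : 0 <= C -> measurable_fun setT X -> L1 (fun w => X w ^+ 2) ->
  Ex (fun w => X w ^+ 2) <= C ^+ 2 -> Ex (fun w => `|X w|) <= C.
Proof.
move=> C0 mX h1 h2; have h := le_trans (Ex_norm_sqr mX h1) h2.
by rewrite -(ler_pXn2r (n := 2)) ?nnegrE// Ex_ge0.
Qed.

End Base.

(** * Independence *)

Section Markov.
Context {R : realType} {d d1 d2 : measure_display} {Om : measurableType d}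
  {T1 : measurableType d1} {T2 : measurableType d2} (P : probability Om R).

(** Rectangles are stable under intersection and generate the product sigma-algebra. The exhausting
    sequence required by the uniqueness theorem is constantly [setT], which is why [m1] must be
    finite. *)
Lemma measure_eq_rect (m1 m2 : {measure set (T1 * T2) -> \bar R}) :
  (m1 setT < +oo)%E ->
  (forall A B, measurable A -> measurable B -> m1 (A `*` B) = m2 (A `*` B)) ->
  forall C, measurable C -> m1 C = m2 C.
Proof.
move=> m1T H C mC.
apply: (measure_unique
  [set C | exists A, measurable A /\ exists B, measurable B /\ C = A `*` B]
  (fun _ => setT)) => //.
- rewrite measurable_prod_measurableType//; congr (<<s _ >>).
  rewrite predeqE; split => [[A mA [B mB <-]]|[A [mA [B [mB ->]]]]].
    by exists A; split => //; exists B.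
  by exists A => //; exists B.
- move=> /= _ _ [X1 [mX1 [X2 [mX2 ->]]]] [Y1 [mY1 [Y2 [mY2 ->]]]].
  rewrite -setXI; exists (X1 `&` Y1); split; first exact: measurableI.
  by exists (X2 `&` Y2); split => //; exact: measurableI.
- by move=> _; exists setT; split => //; exists setT; split => //; rewrite setXTT.
- by rewrite bigcup_const//; exists 0%N.
- by move=> _ [A [mA [B [mB ->]]]]; exact: H.
Qed.

Section pair.
Variables (S : Om -> T1) (X : Om -> T2).
Hypotheses (mS : measurable_fun setT S) (mX : measurable_fun setT X).
Hypothesis SX : indep2 P S X.

Let mS_ : {mfun Om >-> T1} := HB.pack S (isMeasurableFun.Build _ _ _ _ _ mS).
Let mX_ : {mfun Om >-> T2} := HB.pack X (isMeasurableFun.Build _ _ _ _ _ mX).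
Let SXf w := (S w, X w).
Let mSX : measurable_fun setT SXf. Proof. by apply: measurable_fun_pair. Qed.
Let mSX_ : {mfun Om >-> (T1 * T2)%type} := HB.pack SXf (isMeasurableFun.Build _ _ _ _ _ mSX).

Lemma indep2_joint (C : set (T1 * T2)) : measurable C ->
  (distribution P mS_ \x distribution P mX_)%E C = distribution P mSX_ C.
Proof. by apply: product_measure_unique => A B mA mB; rewrite -SX. Qed.

(* Freezing lemma: conditionally on [S], an independent [X] can be integrated out with [S] frozen. *)
Lemma indep2_Ex_le (g : T1 * T2 -> R) (h : T1 -> R) :
  measurable_fun setT g -> measurable_fun setT h ->
  L1 P (fun w => g (S w, X w)) -> L1 P (fun w => h (S w)) ->
  (forall s, L1 P (fun w => g (s, X w))) ->
  (forall s, Ex P (fun w => g (s, X w)) <= h s) ->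
  Ex P (fun w => g (S w, X w)) <= Ex P (fun w => h (S w)).
Proof.
move=> mg mh Lg Lh Ls Hs.
pose mu1 := distribution P mS_; pose mu2 := distribution P mX_.
have mg2 : measurable_fun setT (EFin \o g) by exact/measurable_EFinP.
have Ig : (distribution P mSX_).-integrable setT (EFin \o g).
  exact: (integrable_pushforward (phi := SXf)).
have e1 : (\int[P]_w (g (S w, X w))%:E = \int[(mu1 \x mu2)%E]_z (g z)%:E)%E.
  transitivity (\int[distribution P mSX_]_z (EFin \o g) z)%E.
    by rewrite (integral_pushforward (phi := SXf) mSX (mu := P) (f := EFin \o g)).
  by apply: eq_measure_integral => C mC _; apply/esym/indep2_joint.
have Ig2 : (mu1 \x mu2)%E.-integrable setT (EFin \o g).
  apply/integrableP; split => //.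
  rewrite (eq_measure_integral (distribution P mSX_)).
    by case/integrableP : Ig.
  by move=> C mC _; first [exact: indep2_joint|exact/esym/indep2_joint].
have Fs s : (fubini_F mu2 (EFin \o g) s = (Ex P (fun w => g (s, X w)))%:E).
  rewrite /fubini_F ExE//.
  rewrite /mu2 integral_pushforward//.
    by apply: measurableT_comp => //; apply: measurableT_comp => //; apply: measurable_fun_pair.
  exact: Ls.
have IF := integrable_fubini_F Ig2.
have LF : L1 P (fun w => Ex P (fun w' => g (S w, X w'))).
  have mF : measurable_fun setT (fubini_F mu2 (EFin \o g)).
    exact: measurable_fubini_F Ig2.
  apply/integrableP; split.
    have := measurableT_comp mF mS; apply: eq_measurable_fun => w _ /=; exact: Fs.
  case/integrableP : IF => _.
  rewrite ge0_integral_pushforward//=; last by apply: measurableT_comp.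
  by under eq_integral => w _ do rewrite /= Fs.
apply: (@le_trans _ _ (Ex P (fun w => Ex P (fun w' => g (S w, X w'))))).
  rewrite -lee_fin !ExE// e1 -integral12_prod_meas1//.
  suff -> : (\int[mu1]_x fubini_F mu2 (EFin \o g) x =
    \int[P]_x (Ex P (fun w' => g (S x, X w')))%:E)%E by [].
  rewrite (integral_pushforward (phi := S))//.
  - by apply: eq_integral => w _; rewrite /= Fs.
  - exact: measurable_fubini_F Ig2.
  - by apply: eq_integrable LF => // w _ /=; rewrite Fs.
by apply: Ex_le.
Qed.

Lemma indep2_Ex_eq (g : T1 * T2 -> R) (h : T1 -> R) :
  measurable_fun setT g -> measurable_fun setT h ->
  L1 P (fun w => g (S w, X w)) -> L1 P (fun w => h (S w)) ->
  (forall s, L1 P (fun w => g (s, X w))) ->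
  (forall s, Ex P (fun w => g (s, X w)) = h s) ->
  Ex P (fun w => g (S w, X w)) = Ex P (fun w => h (S w)).
Proof.
move=> mg mh Lg Lh Ls Hs; apply/eqP; rewrite eq_le; apply/andP; split.
  by apply: indep2_Ex_le => // s; rewrite Hs.
rewrite -lerN2 -!ExN//.
apply: (@indep2_Ex_le (fun z => - g z) (fun z => - h z)) => //.
- by apply: measurable_funN.
- by apply: measurable_funN.
- exact: L1N.
- exact: L1N.
- by move=> s; exact: L1N.
- by move=> s; rewrite ExN// Hs.
Qed.

End pair.
End Markov.

(** * Recursions driven by independent inputs *)

Section chain.
Context {R : realType} {d d0 d1 d2 : measure_display} {Om : measurableType d}
  {T0 : measurableType d0} {T1 : measurableType d1} {T2 : measurableType d2}
  (P : probability Om R).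
Variables (X0 : Om -> T0) (X : nat -> Om -> T2) (N : nat).
Variables (psi : T0 -> T1) (Phi : nat -> T1 * T2 -> T1) (S : nat -> Om -> T1).
Hypotheses (mX0 : measurable_fun setT X0) (mX : forall k, measurable_fun setT (X k)).
Hypotheses (mpsi : measurable_fun setT psi) (mPhi : forall k, measurable_fun setT (Phi k)).
Hypotheses (S0E : forall w, S 0%N w = psi (X0 w))
  (SSE : forall k w, S k.+1 w = Phi k (S k w, X k w)).
Hypothesis indX : indep_family P X0 X N.

Lemma recursion_measurable n : measurable_fun setT (S n).
Proof.
elim: n => [|n IH].
  by rewrite (_ : S 0%N = psi \o X0); [exact: measurableT_comp|apply/funext].
rewrite (_ : S n.+1 = Phi n \o (fun w => (S n w, X n w))); last by apply/funext.
by apply: measurableT_comp => //; exact: measurable_fun_pair.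
Qed.

Let tail n (B : nat -> set T2) := \bigcap_(k in [set k | (n <= k < N)%N]) (X k @^-1` B k).

Let mpre {d' d''} {U : measurableType d'} {V : measurableType d''} (f : U -> V) A :
  measurable_fun setT f -> measurable A -> measurable (f @^-1` A).
Proof. by move=> mf mA; rewrite -[_ @^-1` _]setTI; exact: mf. Qed.

Let mtail n B : (forall k, measurable (B k)) -> measurable (tail n B).
Proof. by move=> mB; apply: bigcap_measurableType => k _; exact: mpre. Qed.

Let tailS n B : (n < N)%N -> tail n B = X n @^-1` B n `&` tail n.+1 B.
Proof.
move=> nN; apply/seteqP; split => w.
  move=> h; split; first by apply: h => /=; rewrite leqnn.
  by move=> k /= /andP[nk kN]; apply: h => /=; rewrite (ltnW nk).
move=> [h1 h2] k /= /andP[]; rewrite leq_eqVlt => /orP[/eqP <- //|nk kN].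
by apply: h2 => /=; rewrite nk.
Qed.

Let Pfin A : measurable A -> P A \is a fin_num.
Proof. by move=> mA; rewrite fin_num_measure. Qed.

(** Independence of [S n] and [X n] alone does not propagate along the recursion. Keeping all future
    inputs in the event does: at each step [X n] leaves the tail and joins the state, since [S n.+1]
    is a function of the pair [(S n, X n)]. *)
Let chain_tail n : (n <= N)%N -> forall A B, measurable A -> (forall k, measurable (B k)) ->
  fine (P (S n @^-1` A `&` tail n B)) =
  fine (P (S n @^-1` A)) * \prod_(n <= k < N) fine (P (X k @^-1` B k)).
Proof.
elim: n => [_ A B mA mB|n IH nN A B mA mB].
  rewrite big_mkord (_ : S 0%N @^-1` A = X0 @^-1` (psi @^-1` A)); last first.
    by apply/seteqP; split => w /=; rewrite S0E.
  by rewrite /tail /= indX//; exact: mpre.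
have {}IH := IH (ltnW nN).
pose SX w := (S n w, X n w).
have mSX : measurable_fun setT SX.
  by apply: measurable_fun_pair => //; exact: recursion_measurable.
pose SX_ : {mfun Om >-> (T1 * T2)%type} := HB.pack SX (isMeasurableFun.Build _ _ _ _ _ mSX).
pose r := \prod_(n.+1 <= k < N) fine (P (X k @^-1` B k)).
have r0 : 0 <= r by apply: prodr_ge0 => k _; rewrite fine_ge0.
(* [m1] is the law of the pair on the tail event, [m2] its full law times the probability [r] of the
   tail. They agree on rectangles by induction, hence on the preimage of [A] under [Phi n], which
   need not be a rectangle. *)
pose m1_ : {measure set (T1 * T2) -> \bar R} := pushforward (mrestr P (mtail n.+1 mB)) SX.
pose m1 := m1_ mSX.
pose m2 : {measure set (T1 * T2) -> \bar R} := mscale (NngNum r0) (distribution P SX_).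
have m1E C : m1 C = P (SX @^-1` C `&` tail n.+1 B) by [].
have m2E C : m2 C = (r%:E * P (SX @^-1` C))%E by [].
have E C : measurable C -> m1 C = m2 C.
  apply: measure_eq_rect.
    rewrite m1E preimage_setT setTI.
    by rewrite ltey_eq Pfin//; exact: mtail.
  move=> A' B' mA' mB'.
  have mSA' : measurable (S n @^-1` A') by apply: mpre => //; exact: recursion_measurable.
  have e (D : nat -> set T2) : (forall k, measurable (D k)) -> D n = B' ->
      fine (P (SX @^-1` (A' `*` B') `&` tail n.+1 D)) =
      fine (P (S n @^-1` A')) * fine (P (X n @^-1` B')) * \prod_(n.+1 <= k < N) fine (P (X k @^-1` D k)).
    move=> mD Dn.
    rewrite (_ : SX @^-1` _ = S n @^-1` A' `&` X n @^-1` D n); last by rewrite Dn.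
    by rewrite -setIA -tailS// IH// big_ltn// Dn mulrA.
  (* Two tails with the same [n]-th event: the given one, and the trivial one, whose product is 1
     and which therefore computes the law of the pair itself. *)
  have e1 := e (fun k => if k == n then B' else B k).
  have e2 := e (fun k => if k == n then B' else setT).
  rewrite m1E m2E.
  rewrite -[LHS]fineK ?Pfin//; last first.
    by apply: measurableI; [apply: mpre => //; exact: measurableX|exact: mtail].
  rewrite -[X in (_ * X)%E]fineK ?Pfin//; last by apply: mpre => //; exact: measurableX.
  rewrite -EFinM; congr (_%:E).
  have t1 : tail n.+1 (fun k => if k == n then B' else B k) = tail n.+1 B.
    apply: eq_bigcapr => k /= /andP[nk _].
    by rewrite gtn_eqF.
  have t2 : tail n.+1 (fun k => if k == n then B' else setT) = setT.
    by apply/seteqP; split => // w _ k /= /andP[nk _]; rewrite gtn_eqF.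
  rewrite -t1 e1; [|by move=> k; case: ifP|by rewrite eqxx].
  move: e2; rewrite t2 setIT => ->; [|by move=> k; case: ifP|by rewrite eqxx].
  rewrite [X in _ = _ * (_ * X)]big1_seq; last first.
    move=> k /=; rewrite mem_index_iota => /andP[nk _].
    by rewrite gtn_eqF//= preimage_setT probability_setT.
  rewrite mulr1 mulrC; congr (_ * _).
  by apply: eq_big_nat => k /andP[nk _]; rewrite gtn_eqF.
have mPA : measurable (Phi n @^-1` A) by exact: mpre.
have -> : S n.+1 @^-1` A = SX @^-1` (Phi n @^-1` A).
  by apply/seteqP; split => w /=; rewrite SSE.
have := E _ mPA; rewrite m1E m2E => ->.
by rewrite fineM//= ?Pfin//; [rewrite mulrC|exact: mpre].
Qed.

Lemma recursion_indep n : (n < N)%N -> indep2 P (S n) (X n).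
Proof.
move=> nN A B mA mB.
have mSA : measurable (S n @^-1` A) by apply: mpre => //; exact: recursion_measurable.
have := @chain_tail n (ltnW nN) A (fun k => if k == n then B else setT) mA.
have -> : tail n (fun k => if k == n then B else setT) = X n @^-1` B.
  apply/seteqP; split => w.
    by move=> /(_ n); rewrite /= leqnn nN eqxx; exact.
  by move=> h k /= _; case: eqP => [->|].
rewrite big_ltn// eqxx big1_seq; last first.
  move=> k /=; rewrite mem_index_iota => /andP[nk _].
  by rewrite gtn_eqF//= preimage_setT probability_setT.
rewrite mulr1 -fineM ?Pfin//; last exact: mpre.
move=> h; rewrite -[LHS]fineK ?h; last by rewrite Pfin//; apply: measurableI => //; exact: mpre.
  by rewrite fineK// fin_numM// Pfin//; exact: mpre.
by move=> k; case: ifP.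
Qed.

End chain.

(** * Second moments of martingale sums *)

Section martingale.
Context {R : realType} {d d0 d1 d2 : measure_display} {Om : measurableType d}
  {T0 : measurableType d0} {T1 : measurableType d1} {T2 : measurableType d2}
  (P : probability Om R).
Variables (X0 : Om -> T0) (X : nat -> Om -> T2) (N : nat).
Variables (psi : T0 -> T1) (Phi : nat -> T1 * T2 -> T1) (S : nat -> Om -> T1).
Hypotheses (mX0 : measurable_fun setT X0) (mX : forall k, measurable_fun setT (X k)).
Hypotheses (mpsi : measurable_fun setT psi) (mPhi : forall k, measurable_fun setT (Phi k)).
Hypotheses (S0E : forall w, S 0%N w = psi (X0 w))
  (SSE : forall k w, S k.+1 w = Phi k (S k w, X k w)).
Hypothesis indX : indep_family P X0 X N.
Variables (e : T1 * T2 -> R) (v : T1 -> R).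
Hypotheses (me : measurable_fun setT e) (mv : measurable_fun setT v).
Hypotheses (L1e : forall k, L1 P (fun w => e (S k w, X k w) ^+ 2))
  (L1es : forall k s, L1 P (fun w => e (s, X k w) ^+ 2))
  (Ee : forall k s, Ex P (fun w => e (s, X k w)) = 0)
  (Ee2 : forall k s, Ex P (fun w => e (s, X k w) ^+ 2) <= v s)
  (L1v : forall k, L1 P (fun w => v (S k w))).

(** Orthogonality of the increments: in the expanded square the cross term vanishes once the past is
    frozen, because [e (s, X k)] is centered for every [s]. *)
Lemma martingale_sqr n : (n <= N)%N ->
  L1 P (fun w => (\sum_(k < n) e (S k w, X k w)) ^+ 2) /\
  Ex P (fun w => (\sum_(k < n) e (S k w, X k w)) ^+ 2)
    <= \sum_(k < n) Ex P (fun w => v (S k w)).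
Proof.
pose M n w := \sum_(k < n) e (S k w, X k w).
(* The running sum is adjoined to the state, so that the pair is again a recursion in the inputs and
   is independent of the next one. *)
pose S' n w := (S n w, M n w).
pose psi' t := (psi t, 0 : R).
pose Phi' k (z : (T1 * R) * T2) := (Phi k (z.1.1, z.2), z.1.2 + e (z.1.1, z.2)).
have mpsi' : measurable_fun setT psi' by apply: measurable_fun_pair.
have mz : measurable_fun setT (fun z : (T1 * R) * T2 => (z.1.1, z.2)).
  apply: measurable_fun_pair => //; apply: measurableT_comp => //.
have mez : measurable_fun setT (fun z : (T1 * R) * T2 => e (z.1.1, z.2)).
  exact: (measurableT_comp me).
have mPhi' k : measurable_fun setT (Phi' k).
  apply: measurable_fun_pair; first exact: (measurableT_comp (mPhi k)).
  by apply: measurable_funD => //; apply: measurableT_comp.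
have S'0 w : S' 0%N w = psi' (X0 w) by rewrite /S' /M big_ord0 S0E.
have S'S k w : S' k.+1 w = Phi' k (S' k w, X k w).
  by rewrite /S' /M big_ord_recr/= SSE.
have ind' k := recursion_indep mX0 mX mpsi' mPhi' S'0 S'S indX (n := k).
have mS' k := recursion_measurable mX0 mX mpsi' mPhi' S'0 S'S k.
have mS k := recursion_measurable mX0 mX mpsi mPhi S0E SSE k.
have mM k : measurable_fun setT (M k) by apply: (measurableT_comp measurable_snd (mS' k)).
have meS k : measurable_fun setT (fun w => e (S k w, X k w)).
  by apply: (measurableT_comp me); apply: measurable_fun_pair.
have mes k s : measurable_fun setT (fun w => e (s, X k w)).
  by apply: (measurableT_comp me); apply: measurable_fun_pair.
elim: n => [_|n IH nN].
  rewrite big_ord0; under eq_fun do rewrite big_ord0.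
  by split; [exact: L1_cst|under eq_fun do rewrite expr0n/=; rewrite Ex_cst].
have [LM EM] := IH (ltnW nN).
rewrite -/(M n) in LM EM.
have ME w : \sum_(k < n.+1) e (S k w, X k w) = M n w + e (S n w, X n w) by rewrite big_ord_recr.
have LM1 : L1 P (fun w => (M n w + e (S n w, X n w)) ^+ 2) by exact: L1_sqrD.
split; first by under eq_fun do rewrite ME.
rewrite big_ord_recr/=; apply: le_trans (lerD EM (lexx _)).
rewrite -ExD//; under eq_fun do rewrite ME.
apply: (@indep2_Ex_le _ _ _ _ _ _ _ P (S' n) (X n) (mS' n) (mX n) (ind' n nN)
  (fun z => (z.1.2 + e (z.1.1, z.2)) ^+ 2) (fun s => s.2 ^+ 2 + v s.1)) => //.
- apply: measurable_funX; apply: measurable_funD => //; exact: measurableT_comp.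
- by apply: measurable_funD; [exact: measurable_funX|exact: measurableT_comp].
- exact: (L1D LM (L1v n)).
- move=> s /=; apply: L1_sqrD => //; exact: L1_cst.
- move=> [s m] /=.
  have Le : L1 P (fun w => e (s, X n w)) by exact: L1_sqr_le.
  have -> : (fun w => (m + e (s, X n w)) ^+ 2) =
    (fun w => m ^+ 2 + (2 * m) * e (s, X n w) + e (s, X n w) ^+ 2).
    by apply/funext => w; ring.
  have LZ := L1Z (2 * m) Le; have Lc := L1_cst P (m ^+ 2).
  rewrite ExD//; last exact: L1D.
  by rewrite ExD// ExZ// Ee mulr0 addr0 Ex_cst lerD2l.
Qed.

End martingale.

Section same_law.
Context {R : realType} {d : measure_display} {Om : measurableType d} (P : probability Om R).
Context {d' : measure_display} {T : measurableType d'}.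
Variables (X Y : Om -> T).
Hypotheses (mX : measurable_fun setT X) (mY : measurable_fun setT Y) (XY : same_law P X Y).

Let X_ : {mfun Om >-> T} := HB.pack X (isMeasurableFun.Build _ _ _ _ _ mX).
Let Y_ : {mfun Om >-> T} := HB.pack Y (isMeasurableFun.Build _ _ _ _ _ mY).

Lemma same_law_integral (f : T -> R) : measurable_fun setT f -> (forall t, 0 <= f t) ->
  (\int[P]_w (f (X w))%:E = \int[P]_w (f (Y w))%:E)%E.
Proof.
move=> mf f0.
have mfE : measurable_fun setT (EFin \o f) by exact/measurable_EFinP.
transitivity (\int[distribution P X_]_t (EFin \o f) t)%E.
  by rewrite ge0_integral_distribution// => t; rewrite lee_fin.
rewrite (eq_measure_integral (distribution P Y_)); last by move=> A mA _; exact: XY.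
by rewrite ge0_integral_distribution// => t; rewrite lee_fin.
Qed.

Lemma same_law_L1 (f : T -> R) : measurable_fun setT f ->
  L1 P (fun w => f (Y w)) -> L1 P (fun w => f (X w)).
Proof.
move=> mf /integrableP[_ h]; apply/integrableP; split.
  by apply/measurable_EFinP; exact: measurableT_comp.
have mn : measurable_fun setT (fun t => `|f t|) by exact: (measurableT_comp (@normr_measurable _ setT)).
apply: le_lt_trans h; rewrite le_eqVlt; apply/orP; left; apply/eqP.
exact: (same_law_integral mn).
Qed.

Lemma same_law_Ex (f : T -> R) : measurable_fun setT f ->
  L1 P (fun w => f (Y w)) -> Ex P (fun w => f (X w)) = Ex P (fun w => f (Y w)).
Proof.
move=> mf lf; have lfX := same_law_L1 mf lf.
have mfE : measurable_fun setT (EFin \o f) by exact/measurable_EFinP.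
congr fine.
transitivity (\int[distribution P X_]_t (EFin \o f) t)%E.
  by rewrite integral_distribution.
rewrite (eq_measure_integral (distribution P Y_)); last by move=> A mA _; exact: XY.
by rewrite integral_distribution.
Qed.

End same_law.

(** * Gaussian laws *)

Section density.
Context {R : realType}.
Notation leb := (@lebesgue_measure R).
Variables (nu : probability (measurableTypeR R) R) (f : measurableTypeR R -> R).
Hypotheses (mf : measurable_fun setT f) (f0 : forall x, 0 <= f x).
Hypothesis nuE : forall B : set (measurableTypeR R), measurable B -> nu B = (\int[leb]_(x in B) (f x)%:E)%E.

Let mfE : measurable_fun setT (EFin \o f). Proof. exact/measurable_EFinP. Qed.

Let numu : nu `<< leb.
Proof.
apply/null_content_dominatesP => A mA muA0; rewrite nuE//.
by apply: null_set_integral => //; exact: measurable_funTS.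
Qed.

(** [nu] is dominated by Lebesgue measure and its Radon-Nikodym derivative equals [f] almost
    everywhere, both having the same integral over every measurable set. *)
Lemma ge0_integral_density (g : measurableTypeR R -> R) : measurable_fun setT g -> (forall x, 0 <= g x) ->
  (\int[nu]_x (g x)%:E = \int[leb]_x (g x * f x)%:E)%E.
Proof.
move=> mg g0.
rewrite -(@Radon_Nikodym_SigmaFinite.change_of_variables _ (measurableTypeR R) R nu leb numu)//; last first.
  exact/measurable_EFinP.
have mRN := @Radon_Nikodym_SigmaFinite.f_integrable _ (measurableTypeR R) R nu leb numu.
have mRN2 := measurable_int _ mRN.
have ae : ae_eq leb setT (Radon_Nikodym_SigmaFinite.f nu leb) (EFin \o f).
  apply: integral_ae_eq => // A _ mA.
  transitivity (nu A); last exact: nuE.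
  by apply/esym/Radon_Nikodym_SigmaFinite.f_integral.
apply: ae_eq_integral => //.
- by apply: emeasurable_funM => //; exact/measurable_EFinP.
- by apply/measurable_EFinP; exact: measurable_funM.
- by apply: filterS ae => x /= h _; rewrite h// EFinM.
Qed.

Lemma density_L1 (g : measurableTypeR R -> R) : L1 nu g -> leb.-integrable setT (EFin \o (fun x => g x * f x)).
Proof.
move=> lg; have mg := L1_meas lg.
apply/integrableP; split; first exact/measurable_EFinP/measurable_funM.
under eq_integral do rewrite /= normrM (ger0_norm (f0 _)).
rewrite -(ge0_integral_density (g := fun x => `|g x|))//; last first.
  exact: (measurableT_comp (@normr_measurable _ setT)).
by case/integrableP : lg.
Qed.

Lemma Ex_density (g : measurableTypeR R -> R) : L1 nu g -> Ex nu g = \int[leb]_x (g x * f x).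
Proof.
move=> lg; have mg := L1_meas lg.
have mp : measurable_fun setT (fun x => Num.max (g x) 0) by exact: measurable_funrpos.
have mn : measurable_fun setT (fun x => Num.max (- g x) 0) by exact: measurable_funrneg.
have lp : L1 nu (fun x => Num.max (g x) 0).
  by apply: L1_le (L1_norm lg) => // x; rewrite ger0_norm ?le_max ?lexx ?orbT// ge_max normr_ge0 ler_norm.
have ln : L1 nu (fun x => Num.max (- g x) 0).
  apply: L1_le (L1_norm lg) => // x; rewrite ger0_norm ?le_max ?lexx ?orbT// ge_max normr_ge0.
  by rewrite -normrN ler_norm.
have gE x : g x = Num.max (g x) 0 - Num.max (- g x) 0.
  by rewrite /Num.max; case: ifPn; case: ifPn; lra.
have P h : L1 nu h -> (forall x, 0 <= h x) -> Ex nu h = \int[leb]_x (h x * f x).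
  move=> lh h0; have mh := L1_meas lh.
  by rewrite /Ex /Rintegral (ge0_integral_density mh h0).
under [RHS]eq_Rintegral do rewrite gE mulrBl.
rewrite RintegralB//; [|exact: (density_L1 lp)|exact: (density_L1 ln)].
rewrite -!P//; [|by move=> x; rewrite le_max lexx orbT..].
by rewrite -ExB//; congr (Ex _); apply/funext => x.
Qed.

End density.

(** * The characteristic function of the standard Gaussian *)

Section gauss_char.
Context {R : realType}.
Notation leb := (@lebesgue_measure R).
Let phi : R -> R := normal_pdf 0 1.
Let p : R := normal_peak 1.

Implicit Types (x t : R).

Let isM (f g : R -> R) x (df dg : R) : is_derive x 1 f df -> is_derive x 1 g dg ->
  is_derive x 1 (fun y => f y * g y) (f x * dg + g x * df).
Proof. by move=> hf hg; apply: (is_derive_eq (is_deriveM hf hg)). Qed.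

Let isC (f g : R -> R) x (df dg : R) : is_derive (g x) 1 f df -> is_derive x 1 g dg ->
  is_derive x 1 (fun y => f (g y)) (df * dg).
Proof. by move=> hf hg; apply: (is_derive_eq (is_derive1_comp hf hg)). Qed.

Let isL t x : is_derive x 1 (fun y : R => t * y) t.
Proof.
by apply: (is_derive_eq (isM (is_derive_cst t x 1) (is_derive_id x 1))); rewrite mulr1 mulr0 addr0.
Qed.

Let isA t c x : is_derive x 1 (fun y : R => t * y + c) t.
Proof.
by apply: (is_derive_eq (is_deriveD (isL t x) (is_derive_cst c x 1))); rewrite addr0.
Qed.

Let phiE x : phi x = p * expR (- (x ^+ 2 / 2)).
Proof.
by rewrite /phi /normal_pdf oner_eq0 /normal_fun subr0 expr1n mulr2n mulNr.
Qed.

Let p0 : 0 < p. Proof. by apply: normal_peak_gt0; rewrite oner_eq0. Qed.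
Let phi0 x : 0 <= phi x. Proof. exact: normal_pdf_ge0. Qed.

Let dphi x : is_derive x 1 phi (- x * phi x).
Proof.
rewrite (_ : phi = fun y => p * expR (- 2^-1 * y * y)); last first.
  by apply/funext => y; rewrite phiE; congr (_ * expR _); ring.
apply: (is_derive_eq (isM (is_derive_cst p x 1)
  (isC (is_derive_expR _) (isM (isL (- 2^-1) x) (is_derive_id x 1))))).
by rewrite /=; field.
Qed.

Let cphi : continuous phi. Proof. by apply: continuous_normal_pdf; rewrite oner_eq0. Qed.
Let mphi : measurable_fun setT phi. Proof. exact: measurable_normal_pdf. Qed.
Let iphi : leb.-integrable setT (EFin \o phi). Proof. exact: integrable_normal_pdf. Qed.

Let q : R := normal_peak (Num.sqrt 2).

(** Domination by a multiple of the Gaussian density of variance 2: half of the exponent absorbs the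
    factor, as [|x| <= 1 + x^2/4 <= expR (x^2/4)]. *)
Let ixphi : leb.-integrable setT (EFin \o (fun x => `|x| * phi x)).
Proof.
have i2 := @integrable_normal_pdf R 0 (Num.sqrt 2).
have sq2 : Num.sqrt 2 != 0 :> R by rewrite gt_eqF// sqrtr_gt0.
have q0 : 0 < q by apply: normal_peak_gt0.
have i3 := integrableZl measurableT (p / q) i2.
apply: le_integrable i3 => //.
  apply/measurable_EFinP; apply: measurable_funM => //; exact: normr_measurable.
move=> x _ /=; rewrite lee_fin normrM normr_id (ger0_norm (phi0 x)) [leRHS]ger0_norm; last first.
  by apply: mulr_ge0; [exact/ltW/divr_gt0|exact: normal_pdf_ge0].
rewrite /normal_pdf (negbTE sq2) -/q /normal_fun subr0 sqr_sqrtr ?ler0n// mulrA divfK ?gt_eqF//.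
rewrite phiE mulrCA ler_pM2l//.
have -> : - (x ^+ 2 / 2) = - x ^+ 2 / (2 *+ 2) + (- x ^+ 2 / (2 *+ 2)) by field.
rewrite expRD mulrA ler_piMl ?expR_ge0// mulNr expRN ler_pdivrMr ?expR_gt0// mul1r.
apply: le_trans (expR_ge1Dx _); rewrite -(real_normK (num_real x)).
have -> : `|x| ^+ 2 / (2 *+ 2) = (`|x| / 2) ^+ 2 by field.
have := sqr_ge0 (`|x| / 2 - 1); set y := `|x| / 2.
have -> : `|x| = 2 * y by rewrite /y; field.
by nra.
Qed.

Let phi_cvg : (fun n => phi n%:R) @ \oo --> (0 : R).
Proof.
apply: (@squeeze_cvgr _ _ _ _ (cst 0) (fun n => (2 * p) * harmonic n)).
- near=> n; rewrite phi0 /= phiE.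
  have -> : 2 * p * harmonic n = p * (2 * n.+1%:R^-1) by rewrite /harmonic /= -mulrA mulrCA.
  rewrite ler_pM2l// expRN -[leRHS]invrK lef_pV2 ?posrE ?expR_gt0 ?invr_gt0 ?mulr_gt0//.
  apply: le_trans (expR_ge1Dx _).
  rewrite invfM invrK -(natr1 n).
  have n1 : 1 <= n%:R :> R by rewrite ler1n; near: n; exists 1%N.
  by nra.
- exact: cvg_cst.
- by rewrite -[X in _ --> X](mulr0 (2 * p)); apply: cvgMr; exact: cvg_harmonic.
Unshelve. all: by end_near. Qed.

Variable c : R.

Let cosM t x : `|cos (t * x + c) * phi x| <= phi x.
Proof. by rewrite normrM (ger0_norm (phi0 x)) ler_piMl// cos_max. Qed.

Let mcos t : measurable_fun setT (fun x => cos (t * x + c)).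
Proof. by meas. Qed.
Let msin t : measurable_fun setT (fun x => sin (t * x + c)).
Proof. by meas. Qed.

Let icos t : leb.-integrable setT (EFin \o (fun x => cos (t * x + c) * phi x)).
Proof.
apply: le_integrable iphi => //.
  by apply/measurable_EFinP; exact: (measurable_funM (mcos t) mphi).
by move=> x _ /=; rewrite lee_fin (ger0_norm (phi0 x)).
Qed.

Let isin t : leb.-integrable setT (EFin \o (fun x => x * sin (t * x + c) * phi x)).
Proof.
apply: le_integrable ixphi => //.
  apply/measurable_EFinP.
  exact: (measurable_funM (measurable_funM (@measurable_id _ _ setT) (msin t)) mphi).
move=> x _ /=; rewrite lee_fin !normrM normr_id ler_wpM2r ?normr_ge0//.
by rewrite ler_piMr// sin_max.
Qed.

Let G t x := (t * cos (t * x + c) - x * sin (t * x + c)) * phi x.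

Let iG t : leb.-integrable setT (EFin \o G t).
Proof.
have := integrableB measurableT (integrableZl measurableT t (icos t)) (isin t).
apply: eq_integrable => // x _ /=; rewrite -EFinB; congr (_%:E).
by rewrite /G mulrBl mulrA.
Qed.

(** Stein's identity: [G t] is the derivative of [sin (t x + c) * phi x], which vanishes at both
    infinities. The fundamental theorem on growing intervals is combined with dominated
    convergence. *)
Let intG0 t : \int[leb]_x G t x = 0.
Proof.
pose F x := sin (t * x + c) * phi x.
have dF x : is_derive x 1 F (G t x).
  apply: (is_derive_eq (isM (isC (is_derive_sin _) (isA t c x)) (dphi x))).
  by rewrite /G; ring.
have cG : continuous (G t).
  move=> x; apply: cvgM; last exact: cphi.
  apply: cvgB; apply: cvgM; try exact: cvg_cst; try exact: cvg_id.
    apply: continuous_comp; last exact: continuous_cos.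
    by apply: cvgD; [apply: cvgM; [exact: cvg_cst|exact: cvg_id]|exact: cvg_cst].
  apply: continuous_comp; last exact: continuous_sin.
  by apply: cvgD; [apply: cvgM; [exact: cvg_cst|exact: cvg_id]|exact: cvg_cst].
have FTC n : (\int[leb]_(x in `[(- n.+1%:R)%R, (n.+1%:R)%R]) (G t x)%:E = (F (n.+1%:R)%R)%:E - (F (- n.+1%:R)%R)%:E)%E.
  apply: continuous_FTC2.
  - by rewrite gtrN.
  - exact: continuous_subspaceT.
  - have cF : continuous F by move=> x; apply/differentiable_continuous/derivable1_diffP; case: (dF x).
    split.
    + by move=> x _; case: (dF x).
    + by apply: cvg_at_right_filter; exact: cF.
    + by apply: cvg_at_left_filter; exact: cF.
  - by move=> x _; rewrite derive1E; exact: derive_val.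
pose g n := (EFin \o G t) \_ `[- n.+1%:R, n.+1%:R].
have mGE : measurable_fun setT (EFin \o G t) by exact: measurable_int (iG t).
have mg n : measurable_fun setT (g n).
  by apply/(measurable_restrictT _ _).1 => //; exact: measurable_funTS.
have [_ _ H] : [/\ leb.-integrable setT (EFin \o G t),
  (\int[leb]_x `|g n x - (EFin \o G t) x| @[n --> \oo] --> 0)%E &
  (\int[leb]_x g n x @[n --> \oo] --> \int[leb]_x (EFin \o G t) x)%E].
  apply: (@dominated_convergence _ _ _ leb _ measurableT g (EFin \o G t) (abse \o (EFin \o G t))) => //.
  - apply: aeW => x _; apply: cvg_near_cst; near=> n; rewrite /g /patch ifT//.
    rewrite inE /= in_itv /= -ler_norml.
    apply: (@le_trans _ _ n%:R); last by rewrite ler_nat.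
    by near: n; exact: nbhs_infty_ger.
  - exact: integrable_abse.
  - apply: aeW => x n _; rewrite /g /patch; case: ifP => // _.
    by rewrite abse0 lee_fin normr_ge0.
have FnE n : (\int[leb]_x g n x = ((F n.+1%:R - F (- n.+1%:R))%R)%:E)%E.
  by rewrite -integral_mkcond FTC EFinB.
have {}H : (F n.+1%:R - F (- n.+1%:R)) @[n --> \oo] --> \int[leb]_x G t x.
  move: H; under eq_fun do rewrite FnE.
  rewrite -[X in _ --> X -> _]fineK; last exact: integrable_fin_num.
  by move=> /fine_cvg.
apply/esym; apply: (cvg_unique _ _ H) => //.
have F1 x : `|F x| <= phi x by rewrite /F normrM (ger0_norm (phi0 x)) ler_piMl// sin_max.
have phiN x : phi (- x) = phi x by rewrite !phiE sqrrN.
apply: norm_cvg0; apply: (@squeeze_cvgr _ _ _ _ (cst 0) (fun n => 2 * phi n.+1%:R)).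
- near=> n; rewrite normr_ge0 /= (le_trans (ler_normB _ _))//.
  by rewrite mulrDl mul1r lerD// -phiN.
- exact: cvg_cst.
- rewrite -[X in _ --> X](mulr0 2); apply: cvgMr.
  by have := phi_cvg; rewrite -(cvg_shiftS (fun n => phi n%:R)).
Unshelve. all: by end_near. Qed.

Let psi t := \int[leb]_x (cos (t * x + c) * phi x).

(** Differentiation under the integral, dominated by [|x| * phi x], gives minus the integral of
    [x sin (t x + c) phi x], which [intG0] identifies with [t * psi t]. *)
Let dpsi t : is_derive t 1 psi (- t * psi t).
Proof.
pose f t x := cos (t * x + c) * phi x.
have df x y : is_derive x 1 (f ^~ y) (- (y * sin (x * y + c) * phi y)).
  have h : is_derive x 1 (fun s => cos (s * y + c)) (- sin (x * y + c) * y).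
    rewrite (_ : (fun s => _) = (fun s => cos (y * s + c))); last first.
      by apply/funext => s; rewrite mulrC.
    by apply: (is_derive_eq (isC (is_derive_cos _) (isA y c x))); rewrite (mulrC y).
  by apply: (is_derive_eq (isM h (is_derive_cst (phi y) x 1))); rewrite /cst; ring.
have dfE x y : partial1of2 f x y = - (y * sin (x * y + c) * phi y).
  by rewrite partial1of2E; exact: derive_val.
have It : t \in `]t - 1, t + 1[ by rewrite in_itv/=; lra.
have H1 x y : setT y -> derivable (f ^~ y) x 1 by move=> _; case: (df x y).
have H2 x y : setT y -> `|partial1of2 f x y| <= `|y| * phi y.
  move=> _; rewrite dfE normrN !normrM (ger0_norm (phi0 y)) ler_wpM2r//.
  by rewrite ler_piMr// sin_max.
have H3 y : 0 <= `|y| * phi y by rewrite mulr_ge0.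
have D1 := @differentiation_under_integral R _ _ leb f setT measurableT t (t - 1) (t + 1) It
  (fun x _ => icos x) (fun x y _ => @H1 x y) _ H3 ixphi (fun x y _ => @H2 x y).
have D2 := @derivable_under_integral R _ _ leb f setT measurableT t (t - 1) (t + 1) It
  (fun x _ => icos x) (fun x y _ => @H1 x y) _ H3 ixphi (fun x y _ => @H2 x y).
apply: DeriveDef => //; rewrite -derive1E D1.
have := intG0 t; rewrite /G.
under eq_Rintegral do rewrite mulrBl -mulrA.
rewrite RintegralB//; last exact: (integrableZl measurableT t (icos t)).
rewrite RintegralZl// -/(psi t) => h.
have -> : \int[leb]_y partial1of2 f t y = \int[leb]_y (-1 * (y * sin (t * y + c) * phi y)).
  by apply: eq_Rintegral => y _; rewrite dfE mulN1r.
by rewrite RintegralZl//; lra.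
Qed.

(** The product of [psi t] with [expR (t^2/2)] has derivative zero, and its value at [0] is [cos c].
    The phase [c] makes one real integral carry both the real and the imaginary part. *)
Lemma gauss_char_pdf t : psi t = cos c * expR (- (t ^+ 2 / 2)).
Proof.
pose k t := psi t * expR (2^-1 * t * t).
have dk x : is_derive x 1 k 0.
  apply: (is_derive_eq (isM (dpsi x)
    (isC (is_derive_expR _) (isM (isL 2^-1 x) (is_derive_id x 1))))).
  by rewrite /=; field.
have k0 : k t = k 0 by apply: is_derive_0_is_cst.
have : k 0 = cos c.
  rewrite /k mulr0 expR0 mulr1 /psi.
  under eq_Rintegral do rewrite mul0r add0r.
  rewrite RintegralZl//.
  by rewrite /Rintegral integral_normal_pdf ?oner_eq0//= mulr1.
rewrite -k0 /k => <-; rewrite -[RHS]mulrA -expRD.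
by rewrite (_ : _ + _ = 0) ?expR0 ?mulr1//; field.
Qed.

Lemma gauss_char t : \int[normal_prob 0 1]_x cos (t * x + c) = cos c * expR (- (t ^+ 2 / 2)).
Proof.
rewrite -gauss_char_pdf /psi.
have m : measurable_fun setT (fun x : measurableTypeR R => cos (t * x + c)) by exact: mcos.
rewrite -(@Ex_density R (normal_prob 0 1) phi)//.
by apply: (@L1_bounded _ _ _ _ _ 1) => // w; exact: cos_max.
Qed.


End gauss_char.

Section gauss2.
Context {R : realType}.

(** Image of two independent standard Gaussians under the Cholesky factor with rows [(a, 0)] and
    [(b, c)]; the hypothesis on [s12] makes the radicand of [c] nonnegative. *)
Lemma gauss2_exists (s11 s12 s22 : R) : 0 < s11 -> s12 ^+ 2 <= s11 * s22 ->
  exists mu : probability (R * R)%type R, is_gauss2 s11 s12 s22 mu.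
Proof.
move=> s11p hs.
pose N := @normal_prob R 0 1.
pose a := Num.sqrt s11; pose b := s12 / a; pose c := Num.sqrt (s22 - s12 ^+ 2 / s11).
have a0 : 0 < a by rewrite sqrtr_gt0.
have a2 : a ^+ 2 = s11 by rewrite sqr_sqrtr// ltW.
have c2 : c ^+ 2 = s22 - s12 ^+ 2 / s11.
  by rewrite sqr_sqrtr// subr_ge0 ler_pdivrMr// mulrC.
pose f (z : measurableTypeR R * measurableTypeR R) : R * R := (a * z.1, b * z.1 + c * z.2).
have m1 : measurable_fun setT (fst : measurableTypeR R * measurableTypeR R -> R).
  exact: measurable_fst.
have m2 : measurable_fun setT (snd : measurableTypeR R * measurableTypeR R -> R).
  exact: measurable_snd.
have mf : measurable_fun setT f.
  apply: measurable_fun_pair; first by apply: measurable_funM.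
  by apply: measurable_funD; apply: measurable_funM.
pose F : {mfun (measurableTypeR R * measurableTypeR R)%type >-> (R * R)%type} :=
  HB.pack f (isMeasurableFun.Build _ _ _ _ _ mf).
pose mu : probability (R * R)%type R := distribution (N \x N)%E F.
exists mu.
have main u1 u2 th :
    (\int[mu]_p (cos (u1 * p.1 + u2 * p.2 + th))%:E =
     (cos th * expR (- (u1 ^+ 2 * s11 + 2 * u1 * u2 * s12 + u2 ^+ 2 * s22) / 2))%:E)%E.
  pose h (p : R * R) := cos (u1 * p.1 + u2 * p.2 + th).
  have mh : measurable_fun setT h by rewrite /h; meas.
  have ih : (N \x N)%E.-integrable setT (EFin \o h \o f).
    apply/integrableP; split; first by apply/measurable_EFinP; exact: measurableT_comp.
    apply: (@le_lt_trans _ _ (\int[(N \x N)%E]_x (cst 1 x)))%E.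
      apply: ge0_le_integral => //.
        by apply/measurable_EFinP/measurableT_comp => //; exact: measurableT_comp.
      by move=> x _; rewrite lee_fin cos_max.
    rewrite integral_cst// mul1e.
    by apply: (@le_lt_trans _ _ 1%E); [exact: (@probability_le1 _ _ _ (N \x N)%E)|exact: ltry].
  transitivity (\int[(N \x N)%E]_z (EFin \o h \o f) z)%E.
    have mhE : measurable_fun setT (EFin \o h) by exact/measurable_EFinP.
    exact: (integral_pushforward mf (mu := (N \x N)%E) (D := setT) mhE ih).
  rewrite -integral12_prod_meas1//.
  (* Integrates one coordinate, the phase [d] carrying the other coordinate and [th]; it is used
     once per coordinate. *)
  have step t d : (\int[N]_x (cos (t * x + d))%:E = (cos d * expR (- (t ^+ 2 / 2)))%:E)%E.
    rewrite -gauss_char /Rintegral fineK//.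
    apply: integrable_fin_num => //.
    have mc : measurable_fun setT (fun x : measurableTypeR R => cos (t * x + d)).
      have : measurable_fun setT (fun x : R => cos (t * x + d)) by meas.
      by [].
    exact: (@L1_bounded _ _ _ N _ 1 mc (fun w => cos_max _)).
  have -> : (fun x => \int[N]_y (EFin \o h \o f) (x, y))%E = (fun x => (expR (- ((u2 * c) ^+ 2 / 2)))%:E *
      (cos ((u1 * a + u2 * b) * x + th))%:E)%E.
    apply/funext => x; rewrite -EFinM mulrC -step; apply: eq_integral => y _ /=.
    by rewrite /h /=; congr (cos _)%:E; ring.
  rewrite integralZl//; last first.
    have mc : measurable_fun setT (fun x : measurableTypeR R => cos ((u1 * a + u2 * b) * x + th)).
      have : measurable_fun setT (fun x : R => cos ((u1 * a + u2 * b) * x + th)) by meas.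
      by [].
    exact: (@L1_bounded _ _ _ N _ 1 mc (fun w => cos_max _)).
  rewrite step -EFinM mulrCA -expRD; congr (_ * expR _)%:E.
  have ab : a * b = s12 by rewrite /b mulrCA divff ?mulr1// gt_eqF.
  have b2 : b ^+ 2 = s12 ^+ 2 / s11 by rewrite /b expr_div_n a2.
  have -> : (u2 * c) ^+ 2 = u2 ^+ 2 * (s22 - s12 ^+ 2 / s11) by rewrite exprMn c2.
  have -> : (u1 * a + u2 * b) ^+ 2 = u1 ^+ 2 * s11 + 2 * u1 * u2 * s12 + u2 ^+ 2 * (s12 ^+ 2 / s11).
    by rewrite -b2 -ab -a2; ring.
  by field; rewrite gt_eqF.
move=> u1 u2; split.
  by have := main u1 u2 0; rewrite cos0 mul1r; under eq_integral do rewrite addr0.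
(* A phase of minus a quarter turn turns the cosine into the sine. *)
have := main u1 u2 (- (pi / 2)); rewrite cosN cos_pihalf mul0r => h.
apply: etrans h; apply: eq_integral => p _; congr (_%:E).
by rewrite cosB cos_pihalf sin_pihalf mulr0 mulr1 add0r.
Qed.

End gauss2.

(** * Convergence in law from characteristic functions *)

Section trig.
Context {R : realType}.

(** Real trigonometric polynomials in two variables with arbitrary frequencies. The phase [c]
    includes the sines, so that the product-to-sum formula for cosines suffices for closure under
    products. *)
Inductive trig : (R * R -> R) -> Prop :=
| trig_cos u v c : trig (fun p => cos (u * p.1 + v * p.2 + c))
| trig_add f g : trig f -> trig g -> trig (fun p => f p + g p)
| trig_scale k f : trig f -> trig (fun p => k * f p).

Lemma trig_cst c : trig (fun _ => c).
Proof.
rewrite (_ : (fun _ => c) = (fun p => c * cos (0 * p.1 + 0 * p.2 + 0))).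
  exact/trig_scale/trig_cos.
by apply/funext => p; rewrite !mul0r !addr0 cos0 mulr1.
Qed.

Lemma trig_mul f g : trig f -> trig g -> trig (fun p => f p * g p).
Proof.
move=> hf; elim: hf g => [u v c g hg|f1 f2 _ IH1 _ IH2 g hg|k f1 _ IH g hg].
- elim: hg => [u' v' c'|g1 g2 _ IH1 _ IH2|k g1 _ IH].
  + rewrite (_ : (fun p => _) = (fun p => 2^-1 * cos ((u + u') * p.1 + (v + v') * p.2 + (c + c'))
      + 2^-1 * cos ((u - u') * p.1 + (v - v') * p.2 + (c - c')))).
      by apply: trig_add; exact/trig_scale/trig_cos.
    apply/funext => p.
    set A := u * p.1 + v * p.2 + c; set B := u' * p.1 + v' * p.2 + c'.
    rewrite (_ : _ + (c + c') = A + B); last by rewrite /A /B; ring.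
    rewrite (_ : _ + (c - c') = A - B); last by rewrite /A /B; ring.
    by rewrite (cosD A B) (cosB A B); field.
  + by rewrite (_ : (fun p => _) = (fun p => cos (u * p.1 + v * p.2 + c) * g1 p + cos (u * p.1 + v * p.2 + c) * g2 p));
      [exact: trig_add|apply/funext => p; rewrite mulrDr].
  + by rewrite (_ : (fun p => _) = (fun p => k * (cos (u * p.1 + v * p.2 + c) * g1 p)));
      [exact: trig_scale|apply/funext => p; rewrite mulrCA].
- by rewrite (_ : (fun p => _) = (fun p => f1 p * g p + f2 p * g p));
    [apply: trig_add; [exact: IH1|exact: IH2]|apply/funext => p; rewrite mulrDl].
- by rewrite (_ : (fun p => _) = (fun p => k * (f1 p * g p)));
    [apply: trig_scale; exact: IH|apply/funext => p; rewrite mulrA].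
Qed.

Lemma trig_measurable f : trig f -> measurable_fun setT f.
Proof.
elim=> [u v c|f1 f2 _ h1 _ h2|k f1 _ h1]; first by meas.
- exact: measurable_funD.
- by apply: measurable_funM.
Qed.

(* [bern n F s] is the expectation of [F] at the number of successes among [n] trials of
   probability [s], that is, the Bernstein polynomial of [F] evaluated at [s]. *)
Fixpoint bern (n : nat) (F : nat -> R) (s : R) : R :=
  if n is m.+1 then s * bern m (fun j => F j.+1) s + (1 - s) * bern m F s else F 0%N.

Lemma bernD n F G s : bern n (fun j => F j + G j) s = bern n F s + bern n G s.
Proof. by elim: n F G => [//|n IH] F G /=; rewrite !IH; ring. Qed.

Lemma bernZ n k F s : bern n (fun j => k * F j) s = k * bern n F s.
Proof. by elim: n F => [//|n IH] F /=; rewrite !IH; ring. Qed.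

Lemma bern_cst n c s : bern n (fun _ => c) s = c.
Proof. by elim: n => [//|n IH] /=; rewrite !IH; ring. Qed.

Lemma bern_id n s : bern n (fun j => j%:R) s = n%:R * s.
Proof.
elim: n => [|n IH] /=; first by rewrite mul0r.
rewrite (_ : (fun j => j.+1%:R) = (fun j => j%:R + 1)); last by apply/funext => j; rewrite natr1.
by rewrite bernD bern_cst IH -(natr1 n); ring.
Qed.

Lemma bern_sqr n s : bern n (fun j => j%:R ^+ 2) s = n%:R * s * (1 - s) + (n%:R * s) ^+ 2.
Proof.
elim: n => [|n IH] /=; first by rewrite !mul0r expr0n/= addr0.
rewrite (_ : (fun j => j.+1%:R ^+ 2) = (fun j => j%:R ^+ 2 + (2 * j%:R + 1))); last first.
  by apply/funext => j; rewrite -(natr1 j); ring.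
by rewrite !bernD bern_cst bernZ bern_id IH -(natr1 n); ring.
Qed.

Lemma bern_le n F G s : 0 <= s <= 1 -> (forall j, (j <= n)%N -> F j <= G j) ->
  bern n F s <= bern n G s.
Proof.
move=> /andP[s0 s1]; elim: n F G => [|n IH] F G FG /=; first exact: FG.
apply: lerD; apply: ler_wpM2l => //; rewrite ?subr_ge0//; apply: IH => j jn; apply: FG => //.
by rewrite (leq_trans jn).
Qed.

(** The left side is the variance [s (1 - s) / n] of the frequency of successes. *)
Lemma bern_var n s : (0 < n)%N -> 0 <= s <= 1 ->
  bern n (fun j => (s - j%:R / n%:R) ^+ 2) s <= n%:R^-1.
Proof.
move=> n0 /andP[s0 s1].
have nz : n%:R != 0 :> R by rewrite pnatr_eq0 -lt0n.
rewrite (_ : (fun j => _) = (fun j => s ^+ 2 + ((- 2 * s / n%:R) * j%:R + n%:R^-1 ^+ 2 * j%:R ^+ 2))); last first.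
  by apply/funext => j; field.
rewrite !bernD !bernZ bern_cst bern_id bern_sqr.
rewrite (_ : _ + _ = (s * (1 - s)) * n%:R^-1); last by field.
by rewrite ler_piMl ?invr_ge0//; nra.
Qed.

Lemma bern_trig n (F : nat -> R * R -> R) (t : R * R -> R) : trig t ->
  (forall j, trig (F j)) -> trig (fun p => bern n (fun j => F j p) (t p)).
Proof.
move=> ht; elim: n F => [|n IH] F hF /=; first exact: hF.
apply: trig_add; apply: trig_mul => //; try exact: IH.
rewrite (_ : (fun p => 1 - t p) = (fun p => 1 + (-1) * t p)).
  by apply: trig_add; [exact: trig_cst|exact: trig_scale].
by apply/funext => p; rewrite mulN1r.
Qed.

(** Quantitative injectivity of sine between its extrema. With midpoint [m] and half-distance
    [e >= d], the difference is [2 cos m sin e]; the two end constraints give [|m| <= pi/2 - e],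
    hence [cos m >= sin e]. *)
Lemma sin_gap (d a b : R) : 0 < d < 1 -> - (pi / 2) <= b -> a <= pi / 2 -> 2 * d <= a - b ->
  2 * sin d ^+ 2 <= sin a - sin b.
Proof.
move=> /andP[d0 d1] hb ha hab.
have pi2 := @pihalf_ge1 R.
set e := (a - b) / 2; set m := (a + b) / 2.
have -> : a = m + e by rewrite /m /e; field.
have -> : b = m - e by rewrite /m /e; field.
have de : d <= e by rewrite /e; lra.
have me : `|m| <= pi / 2 - e by rewrite ler_norml /m /e; apply/andP; split; lra.
rewrite sinD sinB.
have -> : sin m * cos e + cos m * sin e - (sin m * cos e - cos m * sin e) = 2 * (cos m * sin e) by ring.
have sd0 : 0 < sin d by apply: sin_gt0_pihalf; apply/andP; split => //; lra.
have hN : e <= pi / 2 by have := normr_ge0 m; lra.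
have sde : sin d <= sin e.
  by rewrite leNgt ltr_sin -?leNgt// in_itv/=; apply/andP; split; lra.
have cm : sin e <= cos m.
  rewrite -cosBpihalf -(cos_norm (e - _)) -(cos_norm m).
  have he : `|e - pi / 2| = pi / 2 - e by rewrite distrC ger0_norm// subr_ge0.
  by rewrite he leNgt ltr_cos -?leNgt// in_itv/=; apply/andP; split; rewrite ?normr_ge0//; lra.
rewrite ler_pM2l// expr2; apply: ler_pM => //; try exact: ltW.
exact: le_trans cm.
Qed.

End trig.

Section approx.
Context {R : realType}.

(** Uniform continuity by compactness of the box. Only [p] is confined to it, because the
    interpolation nodes of [trig_approx] may lie outside. *)
Lemma unif_box (g : R * R -> R) (L e : R) : continuous g -> 0 < e ->
  exists2 r, 0 < r & forall p, `|p.1| <= L -> `|p.2| <= L -> forall q,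
    `|p.1 - q.1| < r -> `|p.2 - q.2| < r -> `|g p - g q| <= e.
Proof.
move=> cg e0.
have cK : compact (`[- L, L] `*` `[- L, L] : set (R * R)).
  by apply: compact_setX; exact: segment_compact.
move/compact_near_coveringP : cK => /(_ R (at_right 0)
  (fun r p => forall q, `|p.1 - q.1| < r -> `|p.2 - q.2| < r -> `|g p - g q| <= e) _).
case.
  move=> x _.
  have /cvgrPdist_lt /(_ (e / 2)) := cg x.
  rewrite divr_gt0// => /(_ isT) /nbhs_ballP [r /= r0 Hr].
  have r20 : 0 < r / 2 by rewrite divr_gt0.
  exists (ball x (r / 2), [set i | i < r / 2]) => /=.
    split; first exact: nbhsx_ballx.
    exact: nbhs_right_lt.
  move=> [x' i] /= [[/= b1 b2] hi] q q1 q2.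
  rewrite /ball /= in b1 b2.
  have h1 : `|g x - g x'| < e / 2.
    apply: Hr; split; rewrite /ball /=; [apply: lt_trans b1 _|apply: lt_trans b2 _]; lra.
  have h2 : `|g x - g q| < e / 2.
    apply: Hr; split; rewrite /ball /=.
      by rewrite -(subrK x'.1 x.1) -addrA (le_lt_trans (ler_normD _ _))//; lra.
    by rewrite -(subrK x'.2 x.2) -addrA (le_lt_trans (ler_normD _ _))//; lra.
  rewrite -(subrK (g x) (g x')) -addrA (le_trans (ler_normD _ _))// distrC.
  by lra.
move=> r /= r0 Hr; exists (r / 2); first by rewrite divr_gt0.
move=> p p1 p2 q q1 q2.
apply: (Hr (r / 2)) => //=.
- by rewrite sub0r normrN ger0_norm; lra.
- by rewrite divr_gt0.
- by split; rewrite /= in_itv/= -ler_norml.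
Qed.

(** Bernstein polynomials in the variable [t x = (1 + sin (x/L)) / 2], which is injective on
    [[-L, L]]. As averages of values of [g] they are bounded by [M] on the whole plane, so that the
    error outside the box never exceeds [2 * M]. *)
Lemma trig_approx (g : R * R -> R) (M L e : R) : continuous g -> (forall p, `|g p| <= M) ->
  0 < L -> 0 < e ->
  exists Q, [/\ trig Q, forall p, `|Q p| <= M &
    forall p, `|p.1| <= L -> `|p.2| <= L -> `|g p - Q p| <= 2 * e].
Proof.
move=> cg gM L0 e0.
have [r r0 Hr] := unif_box L cg e0.
have M0 : 0 <= M by apply: le_trans (gM (0, 0)); exact: normr_ge0.
pose t x : R := (1 + sin (x / L)) / 2.
have t01 x : 0 <= t x <= 1.
  have := sin_geN1 (x / L); have := sin_le1 (x / L).
  by rewrite /t => h1 h2; apply/andP; split; lra.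
(* Points at distance [r] are at distance at least [2 * d] after division by [L]; the cap keeps [d]
   in the range of [sin_gap]. *)
pose d := Num.min (r / (2 * L)) 2^-1.
have d0 : 0 < d by rewrite /d lt_min; apply/andP; split; [apply: divr_gt0 => //; exact: mulr_gt0|lra].
have d1 : d < 1 by rewrite /d gt_min; apply/orP; right; lra.
have dr : 2 * d * L <= r.
  have : d <= r / (2 * L) by rewrite /d ge_min lexx.
  by rewrite ler_pdivlMr ?mulr_gt0//; lra.
have pi2 := @pihalf_ge1 R.
have sd : 0 < sin d by apply: sin_gt0_pihalf; apply/andP; split => //; lra.
pose eta := sin d ^+ 2.
have eta0 : 0 < eta by exact: exprn_gt0.
(* Chebyshev constant: when a coordinate of the point and of the node differ by at least [r], the
   trivial bound [2 * M] is at most [B] times the squared distance of their images under [t]. *)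
pose B := 2 * M / eta ^+ 2.
have B0 : 0 <= B by apply: divr_ge0; [apply: mulr_ge0|exact: sqr_ge0].
have gap x y : `|x| <= L -> `|y / L| <= pi / 2 -> r <= `|x - y| -> eta ^+ 2 <= (t x - t y) ^+ 2.
  move=> xL yL xy.
  have xl : `|x / L| <= pi / 2.
    by rewrite normrM normfV (gtr0_norm L0) ler_pdivrMr//; nra.
  have dxy : 2 * d <= `|x / L - y / L|.
    rewrite -mulrBl normrM normfV (gtr0_norm L0) ler_pdivlMr//.
    exact: le_trans xy.
  move: xl yL; rewrite !ler_norml => /andP[x1 x2] /andP[y1 y2].
  have dd : 0 < d < 1 by rewrite d0.
  rewrite -(real_normK (num_real (t x - t y))) ler_pXn2r ?nnegrE ?normr_ge0 ?(ltW eta0)//.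
  have -> : t x - t y = (sin (x / L) - sin (y / L)) / 2 by rewrite /t; field.
  rewrite normrM (gtr0_norm (x := 2^-1)) ?invr_gt0// ler_pdivlMr// mulrC /eta.
  move: dxy; case: (ger0P (x / L - y / L)) => [h|h] dxy.
    by apply: le_trans (ler_norm _); apply: sin_gap.
  rewrite distrC; apply: le_trans (ler_norm _); apply: sin_gap => //.
  lra.
have [n n0 Hn] : exists2 n, (0 < n)%N & 2 * B * n%:R^-1 <= e.
  exists (Num.truncn (2 * B / e)).+1 => //.
  rewrite ler_pdivrMr// [e * _]mulrC -ler_pdivrMr//; apply: ltW.
  exact: truncnS_gt.
(* The node is the preimage of [j / n] under [t], taken where [x / L] ranges over
   [[-pi/2, pi/2]]. *)
pose xn j := L * asin (2 * (j%:R / n%:R) - 1).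
have nR : 0 < n%:R :> R by rewrite ltr0n.
have xnP j : (j <= n)%N -> `|xn j / L| <= pi / 2 /\ t (xn j) = j%:R / n%:R.
  move=> jn; have j1 : 0 <= j%:R / n%:R :> R by rewrite divr_ge0.
  have j1' : j%:R / n%:R <= 1 :> R by rewrite ler_pdivrMr// mul1r ler_nat.
  have j2 : -1 <= (2 * (j%:R / n%:R) - 1 : R) <= 1 by apply/andP; split; lra.
  rewrite /t /xn mulrAC divff ?gt_eqF// mul1r; split.
    by rewrite ler_norml asin_geNpi2// asin_lepi2.
  by rewrite asinK ?in_itv//; field; rewrite gt_eqF.
have bnd x y j k : `|x| <= L -> `|y| <= L -> (j <= n)%N -> (k <= n)%N ->
    `|g (x, y) - g (xn j, xn k)| <= e + B * ((t x - j%:R / n%:R) ^+ 2 + (t y - k%:R / n%:R) ^+ 2).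
  move=> xL yL /xnP[j1 <-] /xnP[k1 <-].
  have s1 := sqr_ge0 (t x - t (xn j)); have s2 := sqr_ge0 (t y - t (xn k)).
  have Be : B * eta ^+ 2 = 2 * M by rewrite /B divfK// gt_eqF// exprn_gt0.
  have g2 : `|g (x, y) - g (xn j, xn k)| <= 2 * M.
    by rewrite (le_trans (ler_normB _ _))// mulrDl mul1r lerD.
  case: (ltP `|x - xn j| r) => h1; last first.
    have := gap _ _ xL j1 h1 => h.
    apply: le_trans g2 _; rewrite -Be -[leLHS]add0r lerD ?(ltW e0)// ler_wpM2l//.
    by apply: le_trans h _; rewrite lerDl.
  case: (ltP `|y - xn k| r) => h2; last first.
    have := gap _ _ yL k1 h2 => h.
    apply: le_trans g2 _; rewrite -Be -[leLHS]add0r lerD ?(ltW e0)// ler_wpM2l//.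
    by apply: le_trans h _; rewrite lerDr.
  apply: le_trans (Hr (x, y) xL yL (xn j, xn k) h1 h2) _.
  by rewrite lerDl mulr_ge0// addr_ge0.
pose Q (p : R * R) := bern n (fun j => bern n (fun k => g (xn j, xn k)) (t p.2)) (t p.1).
have tt1 : trig (fun p => t p.1).
  rewrite (_ : (fun p => _) = (fun p : R * R => 2^-1 + 2^-1 * cos (L^-1 * p.1 + 0 * p.2 + (- (pi / 2))))).
    by apply: trig_add; [exact: trig_cst|exact/trig_scale/trig_cos].
  by apply/funext => p; rewrite mul0r addr0 cosBpihalf /t (mulrC L^-1); field.
have tt2 : trig (fun p => t p.2).
  rewrite (_ : (fun p => _) = (fun p : R * R => 2^-1 + 2^-1 * cos (0 * p.1 + L^-1 * p.2 + (- (pi / 2))))).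
    by apply: trig_add; [exact: trig_cst|exact/trig_scale/trig_cos].
  by apply/funext => p; rewrite mul0r add0r cosBpihalf /t (mulrC L^-1); field.
have bern_abs (c : R) (F G : nat -> R) (s : R) : 0 <= s <= 1 -> (forall j, (j <= n)%N -> `|c - F j| <= G j) ->
    `|c - bern n F s| <= bern n G s.
  move=> s01 FG; rewrite -[c](bern_cst n c s).
  have -> : bern n (fun _ => c) s - bern n F s = bern n (fun j => c + (-1) * F j) s.
    by rewrite bernD bernZ mulN1r.
  rewrite ler_norml; apply/andP; split.
    rewrite -[- bern n G s]mulN1r -bernZ; apply: bern_le => // j jn.
    by rewrite !mulN1r; have := FG _ jn; rewrite ler_norml => /andP[].
  by apply: bern_le => // j jn; rewrite mulN1r (le_trans (ler_norm _))// FG.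
exists Q; split.
- apply: (@bern_trig _ n (fun j p => bern n (fun k => g (xn j, xn k)) (t p.2))) => // j.
  by apply: (@bern_trig _ n (fun k p => g (xn j, xn k))) => // k; exact: trig_cst.
- move=> p; rewrite -normrN -sub0r /Q -[leRHS](bern_cst n M (t p.1)).
  apply: (@bern_abs _ _ _ _) => // j jn; rewrite -[leRHS](bern_cst n M (t p.2)).
  by apply: (@bern_abs _ _ _ _) => // k kn; rewrite sub0r normrN.
- move=> [x y] /= xL yL.
  have := @bern_abs (g (x, y)) (fun j => bern n (fun k => g (xn j, xn k)) (t y))
    (fun j => (e + B * (t x - j%:R / n%:R) ^+ 2) + B * bern n (fun k => (t y - k%:R / n%:R) ^+ 2) (t y)) (t x) (t01 x).
  rewrite /Q /= => h; apply: le_trans (h _) _.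
    move=> j jn; rewrite -bernZ -[e + _](bern_cst n _ (t y)) -bernD.
    apply: (@bern_abs _ _ _ _) => // k kn.
    by apply: le_trans (bnd _ _ _ _ xL yL jn kn) _; rewrite mulrDr addrA.
  rewrite !bernD !bern_cst bernZ.
  have v1 := bern_var n0 (t01 x); have v2 := bern_var n0 (t01 y).
  have w1 := ler_wpM2l B0 v1; have w2 := ler_wpM2l B0 v2.
  by lra.
Qed.

End approx.

(** * From characteristic functions to convergence in law *)

Section levy.
Context {R : realType} {d : measure_display} {Om : measurableType d} (P : probability Om R).
Variables (V : nat -> Om -> R * R) (mu : probability (R * R)%type R) (K0 : nat) (C : R).
Hypotheses (mV : forall K, (K0 <= K)%N -> measurable_fun setT (V K))
  (LV1 : forall K, (K0 <= K)%N -> L1 P (fun w => (V K w).1))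
  (LV2 : forall K, (K0 <= K)%N -> L1 P (fun w => (V K w).2))
  (EV1 : forall K, (K0 <= K)%N -> Ex P (fun w => `|(V K w).1|) <= C)
  (EV2 : forall K, (K0 <= K)%N -> Ex P (fun w => `|(V K w).2|) <= C).
Hypothesis char : forall u v c, (fun K => Ex P (fun w => cos (u * (V K w).1 + v * (V K w).2 + c))) @ \oo -->
  Ex mu (fun p => cos (u * p.1 + v * p.2 + c)).

Lemma trig_bounded (f : R * R -> R) : trig f -> exists M, forall p, `|f p| <= M.
Proof.
elim=> [u v c|f1 f2 _ [M1 h1] _ [M2 h2]|k f1 _ [M h]].
- by exists 1 => p; exact: cos_max.
- by exists (M1 + M2) => p; rewrite (le_trans (ler_normD _ _))// lerD.
- by exists (`|k| * M) => p; rewrite normrM ler_wpM2l.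
Qed.

Let L1_trig (T : measurableType d) (Q : probability T R) (X : T -> R * R) f :
  measurable_fun setT X -> trig f -> L1 Q (f \o X).
Proof.
move=> mX tf; have [M hM] := trig_bounded tf.
apply: (@L1_bounded _ _ _ _ _ M) => [|w]; last exact: hM.
by apply: measurableT_comp => //; exact: trig_measurable.
Qed.

Lemma L1_trig_mu f : trig f -> L1 mu f.
Proof.
move=> tf; have [M hM] := trig_bounded tf.
by apply: (@L1_bounded _ _ _ _ _ M) => [|w]; [exact: trig_measurable|exact: hM].
Qed.

Lemma trig_cvg f : trig f -> (fun K => Ex P (f \o V K)) @ \oo --> Ex mu f.
Proof.
elim=> [u v c|f1 f2 t1 h1 t2 h2|k f1 t1 h1]; first exact: char.
- rewrite (_ : Ex mu _ = Ex mu f1 + Ex mu f2); last by rewrite -ExD//; exact: L1_trig_mu.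
  apply: cvg_trans (cvgD h1 h2); apply: near_eq_cvg; near=> K.
  have K0K : (K0 <= K)%N by near: K; exact: nbhs_infty_ge.
  by apply/esym; apply: ExD; apply: L1_trig => //; exact: mV.
- rewrite (_ : Ex mu _ = k * Ex mu f1); last by rewrite -ExZ//; exact: L1_trig_mu.
  have hk : (fun K => k * Ex P (f1 \o V K)) @ \oo --> k * Ex mu f1 by apply: cvgMr.
  apply: cvg_trans hk; apply: near_eq_cvg; near=> K.
  have K0K : (K0 <= K)%N by near: K; exact: nbhs_infty_ge.
  by apply/esym; apply: ExZ; apply: L1_trig => //; exact: mV.
Unshelve. all: by end_near. Qed.

(** Comparison through [Q n], which approximates [g] on the box of half-width [n.+1]. Under [mu]
    dominated convergence applies; under [P] the mass outside the box is at most [2 C / n.+1] by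
    Markov's inequality, uniformly in [K], and this plays the part of tightness. *)
Lemma char_cvg_law : cvg_law P V mu.
Proof.
move=> g cg [M gM].
have M0 : 0 <= M by apply: le_trans (gM (0, 0)); exact: normr_ge0.
have M1p : 0 < M + 1 by lra.
have hn n : exists Q, [/\ trig Q, forall p, `|Q p| <= M &
    forall p : R * R, `|p.1| <= n.+1%:R -> `|p.2| <= n.+1%:R -> `|g p - Q p| <= 2 * n.+1%:R^-1].
  by apply: trig_approx => //; rewrite ?ltr0n// invr_gt0 ltr0n.
have [Q HQ] := choice hn.
have tQ n : trig (Q n) by case: (HQ n).
have QM n p : `|Q n p| <= M by case: (HQ n).
have Qg n p : `|p.1| <= n.+1%:R -> `|p.2| <= n.+1%:R -> `|g p - Q n p| <= 2 * n.+1%:R^-1.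
  by case: (HQ n) => _ _; exact.
have QC p : (fun n => Q n p) @ \oo --> g p.
  apply/cvgrPdist_le => e e0; have e2 : 0 < e / 2 by rewrite divr_gt0.
  near=> n.
  have pn : `|p.1| + `|p.2| <= n.+1%:R.
    apply: (@le_trans _ _ n%:R); last by rewrite ler_nat.
    by near: n; exact: nbhs_infty_ger.
  have := Qg n p; have := normr_ge0 p.1; have := normr_ge0 p.2 => p1 p2.
  move=> h; apply: le_trans (h _ _) _; [lra|lra|].
  rewrite mulrC -ler_pdivlMr//.
  apply: ltW; near: n; exact: near_infty_natSinv_lt (PosNum e2).
have mg : measurable_fun setT g.
  apply: (@measurable_fun_cvg _ _ _ _ Q) => [n|p _]; first exact: trig_measurable.
  exact: QC.
have lg : L1 mu g by exact: L1_bounded gM.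
have lgV K : (K0 <= K)%N -> L1 P (g \o V K).
  move=> kK; apply: (@L1_bounded _ _ _ _ _ M) => [|w]; last exact: gM.
  by apply: measurableT_comp => //; exact: mV.
have QC2 : (fun n => Ex mu (fun p => `|g p - Q n p|)) @ \oo --> (0 : R).
  pose z : R * R -> \bar R := fun _ => 0%:E.
  pose D n x : \bar R := (`|g x - Q n x|)%:E.
  have [_ _ H] : [/\ mu.-integrable setT z,
    (\int[mu]_x `|D n x - z x| @[n --> \oo] --> 0)%E &
    (\int[mu]_x D n x @[n --> \oo] --> \int[mu]_x z x)%E].
    apply: (@dominated_convergence _ _ _ mu _ measurableT D z (EFin \o cst (2 * M))).
    - move=> n; apply/measurable_EFinP; have := trig_measurable (tQ n) => mQ; by meas.
    - exact: measurable_cst.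
    - apply: aeW => p _; apply: cvg_EFin; first by apply: nearW.
      rewrite -(normr0 R) -(subrr (g p)); apply: cvg_norm; apply: cvgB; [exact: cvg_cst|exact: QC].
    - exact: L1_cst.
    - apply: aeW => p n _; rewrite lee_fin normr_id (le_trans (ler_normB _ _))// mulrDl mul1r lerD//.
  by move: H; rewrite /z integral_cst//= mul0e => /fine_cvg.
rewrite (_ : fine _ = Ex mu g)//.
rewrite (_ : (fun K => fine _) = (fun K => Ex P (g \o V K))); last first.
  by apply/funext => K; rewrite EfineE.
apply/cvgrPdist_le => e e0.
(* [2 * M] bounds the error outside the box and [2 * C] the mean of the sum of the two moduli. *)
pose D := 2 * M * (2 * C).
have e4 : 0 < e / 4 by rewrite divr_gt0.
have e5 : 0 < e / (4 * (`|D| + 2)) by rewrite divr_gt0// mulr_gt0// ltr_wpDl.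
near \oo => n.
have n1 : Ex mu (fun p => `|g p - Q n p|) <= e / 4.
  near: n; move/cvgrPdist_le : QC2 => /(_ _ e4); apply: filterS => n.
  by rewrite sub0r normrN; apply: le_trans; exact: ler_norm.
have n2 : n.+1%:R^-1 <= e / (4 * (`|D| + 2)).
  apply: ltW; near: n; exact: near_infty_natSinv_lt (PosNum e5).
have n3 : (2 + D) * n.+1%:R^-1 <= e / 4.
  apply: (@le_trans _ _ ((`|D| + 2) * n.+1%:R^-1)).
    by rewrite ler_wpM2r// addrC lerD2r ler_norm.
  rewrite mulrC -ler_pdivlMr ?ltr_wpDl//; apply: le_trans n2 _.
  by rewrite invfM mulrA.
near=> K.
have kK : (K0 <= K)%N by near: K; exact: nbhs_infty_ge.
have lQV : L1 P (Q n \o V K) by apply: L1_trig => //; exact: mV.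
have k1 : `|Ex mu (Q n) - Ex P (Q n \o V K)| <= e / 4.
  by near: K; move: (trig_cvg (tQ n)) => /cvgrPdist_le /(_ _ e4).
have k2 : `|Ex mu g - Ex mu (Q n)| <= e / 4.
  have lQ := L1_trig_mu (tQ n).
  by rewrite -ExB//; apply: le_trans n1; apply: Ex_norm; exact: L1B.
have k3 : `|Ex P (Q n \o V K) - Ex P (g \o V K)| <= e / 4.
  have l1 := LV1 kK; have l2 := LV2 kK.
  rewrite -ExB ?lgV//; apply: le_trans n3.
  (* The first term is the error inside the box; outside, the sum of the moduli divided by [n.+1]
     exceeds 1 and may multiply [2 * M]. *)
  apply: (@le_trans _ _ (Ex P (fun w => 2 * n.+1%:R^-1 + (2 * M * n.+1%:R^-1) * (`|(V K w).1| + `|(V K w).2|)))).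
    apply: Ex_norm_le.
    - by apply: L1B => //; exact: lgV.
    - by apply: L1D; [exact: L1_cst|apply: L1Z; apply: L1D; exact: L1_norm].
    move=> w; rewrite /= distrC; set p := V K w.
    have N0 : 0 < n.+1%:R :> R by rewrite ltr0n.
    have gQ : `|g p - Q n p| <= 2 * M by rewrite (le_trans (ler_normB _ _))// mulrDl mul1r lerD.
    have a1 := normr_ge0 p.1; have a2 := normr_ge0 p.2.
    have i0 : 0 < n.+1%:R^-1 :> R by rewrite invr_gt0.
    case: (lerP (`|p.1| + `|p.2|) n.+1%:R) => hp.
      apply: le_trans (Qg n p _ _) _; [lra|lra|].
      by rewrite lerDl !mulr_ge0// ?(ltW i0)// addr_ge0.
    apply: le_trans gQ _; rewrite -[leLHS]add0r lerD ?mulr_ge0 ?(ltW i0)//.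
    rewrite -mulrA ler_peMr ?mulr_ge0//.
    by rewrite mulrC ler_pdivlMr// mul1r ltW.
  have ln1 := L1_norm l1; have ln2 := L1_norm l2.
  rewrite ExD; [|exact: L1_cst|exact: (L1Z _ (L1D ln1 ln2))].
  rewrite Ex_cst ExZ; last exact: (L1D ln1 ln2).
  rewrite ExD// [leRHS]mulrDl lerD2l /D [leRHS]mulrAC ler_wpM2l//.
    by rewrite !mulr_ge0// invr_ge0.
  by have := EV1 kK; have := EV2 kK; lra.
have t1 := ler_distD (Ex mu (Q n)) (Ex mu g) (Ex P (g \o V K)).
have t2 := ler_distD (Ex P (Q n \o V K)) (Ex mu (Q n)) (Ex P (g \o V K)).
by lra.
Unshelve. all: by end_near. Qed.

End levy.

(** * Central limit theorem for triangular arrays *)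

Section taylor.
Context {R : realType}.
Implicit Types x y : R.

Lemma sin_mvt y : 0 < y -> exists2 c, 0 < c < y & y - sin y = (1 - cos c) * y.
Proof.
move=> y0; pose f x := x - sin x.
have df x : x \in `]0, y[ -> is_derive x 1 f (1 - cos x).
  by move=> _; apply: (is_derive_eq (is_deriveB (is_derive_id x 1) (is_derive_sin x))).
have cf : {within `[0, y], continuous f}.
  apply: continuous_subspaceT => x; apply: cvgB; [exact: cvg_id|exact: continuous_sin].
have [c ] := MVT y0 df cf.
rewrite in_itv /= => hc; rewrite /f sin0 !subr0 => e; exists c => //.
Qed.

(** By the mean value theorem the difference is [(1 - cos c) * y] with [0 < c < y], and
    [1 - cos c = 2 sin (c/2)^2]; the constant is not optimized. *)
Lemma sin_sub_bound y : 0 <= y -> 0 <= y - sin y <= y ^+ 3.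
Proof.
rewrite le_eqVlt => /predU1P[<-|y0]; first by rewrite sin0 subrr expr0n/= lexx.
have sin_le (z : R) : 0 < z -> sin z <= z.
  move=> z0; have [c _ e] := sin_mvt z0.
  by rewrite -subr_ge0 e mulr_ge0 ?(ltW z0)// subr_ge0 cos_le1.
have [c /andP[c0 cy] ->] := sin_mvt y0.
rewrite mulr_ge0 ?(ltW y0) ?subr_ge0 ?cos_le1//=.
rewrite exprSr ler_pM2r//.
have c2 : 0 < c / 2 by rewrite divr_gt0.
have -> : 1 - cos c = 2 * sin (c / 2) ^+ 2.
  rewrite {1}(_ : c = c / 2 + c / 2); last by field.
  by have := cos2Dsin2 (c / 2); rewrite cosD -!expr2; lra.
have s1 : `|sin (c / 2)| <= c / 2.
  rewrite ler_norml sin_le// andbT.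
  case: (leP c 2) => h; last by have := sin_geN1 (c / 2); lra.
  have c22 : 0 < c / 2 < 2 by rewrite c2 /=; lra.
  by have := sin2_gt0 c22; lra.
have s2 : sin (c / 2) ^+ 2 <= (c / 2) ^+ 2.
  by rewrite -(real_normK (num_real (sin _))) ler_pXn2r ?nnegrE ?(ltW c2).
have c3 : c ^+ 2 <= y ^+ 2 by rewrite ler_pXn2r ?nnegrE ?(ltW c0) ?(ltW y0) ?(ltW cy).
have c4 : c ^+ 2 = 4 * (c / 2) ^+ 2 by field.
rewrite c4 in c3.
by have := sqr_ge0 (c / 2); lra.
Qed.

(** The cubic bound serves below Lindeberg's truncation level, the quadratic one above it. *)
Lemma sin_rem x : `|sin x - x| <= `|x| ^+ 3 /\ `|sin x - x| <= 2 * x ^+ 2.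
Proof.
have h : `|sin x - x| <= `|x| ^+ 3.
  wlog x0 : x / 0 <= x.
    move=> h; case: (leP 0 x) => [/h //|/ltW x0].
    by have := h (- x); rewrite sinN -opprD !normrN oppr_ge0 => /(_ x0).
  have /andP[h1 h2] := sin_sub_bound x0.
  by rewrite distrC !ger0_norm.
split => //.
case: (leP `|x| 1) => x1.
  apply: le_trans h _; rewrite -(real_normK (num_real x)) exprSr mulrC.
  by have := normr_ge0 x; have := sqr_ge0 `|x|; nra.
apply: le_trans (ler_normB _ _) _; rewrite -(real_normK (num_real x)).
by have := sin_max x; nra.
Qed.

(** With [y = x / 2] the remainder factors as [2 (y - sin y) (y + sin y)], which reduces it to the
    bound for the sine. *)
Lemma cos_rem x : `|cos x - 1 + x ^+ 2 / 2| <= `|x| ^+ 3 /\ `|cos x - 1 + x ^+ 2 / 2| <= 2 * x ^+ 2.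
Proof.
wlog x0 : x / 0 <= x.
  move=> h; case: (leP 0 x) => [/h //|/ltW x0].
  by have := h (- x); rewrite cosN sqrrN !normrN oppr_ge0 => /(_ x0).
pose y := x / 2; have y0 : 0 <= y by rewrite divr_ge0.
have /andP[h1 h2] := sin_sub_bound y0.
have -> : cos x - 1 + x ^+ 2 / 2 = 2 * (y - sin y) * (y + sin y).
  rewrite (_ : x = y + y); last by rewrite /y; field.
  rewrite cosD -!expr2; have := cos2Dsin2 y => e.
  have -> : cos y ^+ 2 = 1 - sin y ^+ 2 by lra.
  by field.
have sy : `|sin y| <= y.
  rewrite ler_norml; apply/andP; split; last by lra.
  case: (leP y 1) => y1; last by have := sin_geN1 y; lra.
  case: (ltrgt0P y) y0 h1 => [yp|//|->] _ _; last by rewrite sin0 oppr0.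
  have y2 : 0 < y < 2 by rewrite yp /=; lra.
  by have := sin2_gt0 y2; lra.
move: sy; rewrite ler_norml => /andP[s1 s2].
have p1 : 0 <= y + sin y by lra.
rewrite ger0_norm ?mulr_ge0// (ger0_norm x0).
have xy : x = 2 * y by rewrite /y; field.
have y3 : 0 <= y ^+ 3 by rewrite exprn_ge0.
have b2 : 2 * (y - sin y) * (y + sin y) <= 8 * y ^+ 2.
  have m1 : y - sin y <= 2 * y by lra.
  have m2 : y + sin y <= 2 * y by lra.
  by have := ler_pM h1 p1 m1 m2; rewrite expr2; lra.
split; last by rewrite xy exprMn; lra.
rewrite xy exprMn.
case: (leP y 1) => y1.
  have : 2 * (y - sin y) * (y + sin y) <= 2 * y ^+ 3 * (2 * y).
    by apply: ler_pM => //; rewrite ?mulr_ge0//; lra.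
  have : y ^+ 3 * y <= y ^+ 3 by rewrite ler_piMr.
  by lra.
have : y ^+ 2 <= y ^+ 3 by rewrite (exprSr y 2) ler_peMr ?sqr_ge0// ltW.
by lra.
Qed.

Lemma expN_rem y : 0 <= y -> `|expR (- y) - 1 + y| <= y ^+ 2.
Proof.
move=> y0; have h := expR_ge1Dx (- y); have h2 := expR_ge1Dx y.
rewrite ger0_norm; last by lra.
have e1 : expR (- y) <= (1 + y)^-1 by rewrite expRN lef_pV2 ?posrE ?expR_gt0//; lra.
have e2 : (1 + y)^-1 <= 1 - y + y ^+ 2.
  rewrite -[leLHS]mul1r ler_pdivrMr; last by lra.
  by have := exprn_ge0 3 y0; lra.
by lra.
Qed.

End taylor.

Section iid_char.
Context {R : realType} {d d0 : measure_display} {Om : measurableType d} {T0 : measurableType d0}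
  (P : probability Om R).
Variables (X0 : Om -> T0) (Xs : nat -> Om -> R) (X : Om -> R) (U : R -> R).
Hypotheses (mX0 : measurable_fun setT X0) (mXs : forall n, measurable_fun setT (Xs n))
  (mX : measurable_fun setT X) (lawX : forall n, same_law P (Xs n) X)
  (indX : forall N, indep_family P X0 Xs N) (mU : measurable_fun setT U).

(** The angle addition formula and freezing give [C k.+1 = c * C k - s * D k] for the means of
    cosine and sine. Replacing the multiplication by [c + i s] with one by [b] costs at most
    [|c - b| + |s|] per step, and earlier errors do not grow because [b <= 1]. *)
Lemma iid_char_bound (t b th : R) (n : nat) : 0 <= b <= 1 ->
  `|Ex P (fun w => cos (t * (\sum_(k < n) U (Xs k w)) + th)) - b ^+ n * cos th| <=
  n%:R * (`|Ex P (fun w => cos (t * U (X w))) - b| + `|Ex P (fun w => sin (t * U (X w)))|).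
Proof.
move=> /andP[b0 b1].
set c := Ex P (fun w => cos (t * U (X w))); set s := Ex P (fun w => sin (t * U (X w))).
pose S n w := \sum_(k < n) U (Xs k w).
pose Phi (k : nat) (z : R * R) := z.1 + U z.2.
have mPhi k : measurable_fun setT (Phi k).
  by apply: measurable_funD => //; exact: (measurableT_comp mU).
have SS k w : S k.+1 w = Phi k (S k w, Xs k w) by rewrite /S big_ord_recr.
have S0 w : S 0%N w = cst 0 (X0 w) by rewrite /S big_ord0.
have mS k : measurable_fun setT (S k).
  exact: (recursion_measurable mX0 mXs (@measurable_cst _ _ _ _ setT (0 : R)) mPhi S0 SS).
have iS k : indep2 P (S k) (Xs k).
  exact: (recursion_indep mX0 mXs (@measurable_cst _ _ _ _ setT (0 : R)) mPhi S0 SS (indX k.+1)).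
have mcU : measurable_fun setT (fun y => cos (t * U y)).
  by apply: (measurableT_comp measurable_cos); apply: measurable_funM.
have msU : measurable_fun setT (fun y => sin (t * U y)).
  by apply: (measurableT_comp measurable_sin); apply: measurable_funM.
have b_cos (f : Om -> R) : measurable_fun setT f -> L1 P (fun w => cos (f w)).
  move=> mf; apply: (@L1_bounded _ _ _ _ _ 1); last by move=> w; exact: cos_max.
  exact: (measurableT_comp measurable_cos).
have b_sin (f : Om -> R) : measurable_fun setT f -> L1 P (fun w => sin (f w)).
  move=> mf; apply: (@L1_bounded _ _ _ _ _ 1); last by move=> w; exact: sin_max.
  exact: (measurableT_comp measurable_sin).
have mtU (Y : Om -> R) : measurable_fun setT Y -> measurable_fun setT (fun w => t * U (Y w)).
  by move=> mY; apply: measurable_funM => //; exact: (measurableT_comp mU mY).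
have LcU (Y : Om -> R) : measurable_fun setT Y -> L1 P (fun w => cos (t * U (Y w))).
  by move=> mY; apply: b_cos; exact: mtU.
have LsU (Y : Om -> R) : measurable_fun setT Y -> L1 P (fun w => sin (t * U (Y w))).
  by move=> mY; apply: b_sin; exact: mtU.
have cE k : Ex P (fun w => cos (t * U (Xs k w))) = c.
  exact: (same_law_Ex (mXs k) mX (lawX k) mcU (LcU X mX)).
have sE k : Ex P (fun w => sin (t * U (Xs k w))) = s.
  exact: (same_law_Ex (mXs k) mX (lawX k) msU (LsU X mX)).
have mtS k : measurable_fun setT (fun w => t * S k w + th).
  by apply: measurable_funD => //; apply: measurable_funM.
pose C k := Ex P (fun w => cos (t * S k w + th)).
pose D k := Ex P (fun w => sin (t * S k w + th)).
have rec k : C k.+1 = c * C k - s * D k.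
  have Lc := b_cos _ (mtS k); have Ls := b_sin _ (mtS k).
  rewrite /C /D -(ExZ _ Lc) -(ExZ _ Ls) -(ExB (L1Z _ Lc) (L1Z _ Ls)).
  apply: etrans (_ : _ = Ex P (fun w => cos (t * (S k w + U (Xs k w)) + th))) _.
    by congr (Ex _); apply/funext => w; rewrite SS.
  apply: (@indep2_Ex_eq _ _ _ _ _ _ _ P (S k) (Xs k) (mS k) (mXs k) (iS k)
    (fun z => cos (t * (z.1 + U z.2) + th)) (fun x => c * cos (t * x + th) - s * sin (t * x + th))).
  - apply: (measurableT_comp measurable_cos); apply: measurable_funD => //; apply: measurable_funM => //.
    by apply: measurable_funD => //; exact: (measurableT_comp mU).
  - by meas.
  - apply: b_cos; apply: measurable_funD => //; apply: measurable_funM => //.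
    by apply: measurable_funD; [exact: mS|exact: (measurableT_comp mU (mXs k))].
  - exact: (L1B (L1Z _ Lc) (L1Z _ Ls)).
  - move=> x; apply: b_cos; apply: measurable_funD => //; apply: measurable_funM => //.
    by apply: measurable_funD; [exact: measurable_cst|exact: (measurableT_comp mU (mXs k))].
  - move=> x /=.
    have -> : (fun w => cos (t * (x + U (Xs k w)) + th)) =
      (fun w => cos (t * x + th) * cos (t * U (Xs k w)) - sin (t * x + th) * sin (t * U (Xs k w))).
      by apply/funext => w; rewrite -cosD; congr cos; ring.
    rewrite (ExB (L1Z _ (LcU _ (mXs k))) (L1Z _ (LsU _ (mXs k)))) (ExZ _ (LcU _ (mXs k))) (ExZ _ (LsU _ (mXs k))).
    by rewrite cE sE; ring.
have C1 k : `|C k| <= 1 by apply: Ex_norm_bound => [|w]; [exact: L1_meas (b_cos _ (mtS k))|exact: cos_max].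
have D1 k : `|D k| <= 1 by apply: Ex_norm_bound => [|w]; [exact: L1_meas (b_sin _ (mtS k))|exact: sin_max].
rewrite -/(C n); elim: n => [|n IH].
  rewrite expr0 mul1r mul0r /C (_ : (fun w => _) = (fun _ => cos th)) ?Ex_cst ?subrr ?normr0//.
  by apply/funext => w; rewrite /S big_ord0 mulr0 add0r.
have -> : C n.+1 - b ^+ n.+1 * cos th = (c - b) * C n + b * (C n - b ^+ n * cos th) - s * D n.
  by rewrite rec exprS; ring.
have t1 := ler_normB ((c - b) * C n + b * (C n - b ^+ n * cos th)) (s * D n).
have t2 := ler_normD ((c - b) * C n) (b * (C n - b ^+ n * cos th)).
have x1 : `|(c - b) * C n| <= `|c - b| by rewrite normrM ler_piMr.
have x2 : `|s * D n| <= `|s| by rewrite normrM ler_piMr.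
have x3 : `|b * (C n - b ^+ n * cos th)| <= n%:R * (`|c - b| + `|s|).
  by rewrite normrM (ger0_norm b0); apply: le_trans IH; rewrite ler_piMl.
by rewrite -(natr1 n) [leRHS]mulrDl [1 * _]mul1r; lra.
Qed.

End iid_char.

(** Its mean is the Lindeberg functional. Smallness for large [r], uniformly over a family, is
    uniform integrability of the squares. *)
Definition tailsq {R : realType} (r u : R) : R := if `|u| <= r then 0 else u ^+ 2.

(** * Lindeberg's theorem *)

Section clt.
Context {R : realType} {d d0 : measure_display} {Om : measurableType d} {T0 : measurableType d0}
  (P : probability Om R).
Variables (X0 : nat -> Om -> T0) (Xs : nat -> nat -> Om -> R) (X : nat -> Om -> R) (U : nat -> R -> R)
  (sig2 : nat -> R) (v : R) (K0 : nat).
Hypotheses (mX0 : forall K, (K0 <= K)%N -> measurable_fun setT (X0 K))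
  (mXs : forall K, (K0 <= K)%N -> forall n, measurable_fun setT (Xs K n))
  (mX : forall K, (K0 <= K)%N -> measurable_fun setT (X K))
  (lawX : forall K, (K0 <= K)%N -> forall n, same_law P (Xs K n) (X K))
  (indX : forall K, (K0 <= K)%N -> forall N, indep_family P (X0 K) (Xs K) N)
  (mU : forall K, (K0 <= K)%N -> measurable_fun setT (U K))
  (LU : forall K, (K0 <= K)%N -> L1 P (fun w => U K (X K w) ^+ 2))
  (EU : forall K, (K0 <= K)%N -> Ex P (fun w => U K (X K w)) = 0)
  (EU2 : forall K, (K0 <= K)%N -> Ex P (fun w => U K (X K w) ^+ 2) = sig2 K)
  (sigv : sig2 @ \oo --> v)
  (lind : forall e, 0 < e -> exists2 r, 0 <= r &
     forall K, (K0 <= K)%N -> Ex P (fun w => tailsq r (U K (X K w))) <= e).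

Lemma measurable_tailsq (r : R) : measurable_fun setT (tailsq r).
Proof. by rewrite /tailsq; meas. Qed.

(** Where [|u| <= r], the cubic bound gives [K^2 |u/K|^3 <= (r/K) u^2]; elsewhere the quadratic
    bound gives [2 u^2]. *)
Let rem_bound (K : nat) (f : R -> R) : (K0 <= K)%N -> (0 < K)%N -> measurable_fun setT f ->
  (forall x, `|f x| <= `|x| ^+ 3) -> (forall x, `|f x| <= 2 * x ^+ 2) -> forall r, 0 <= r ->
  (K ^ 2)%:R * `|Ex P (fun w => f (K%:R^-1 * U K (X K w)))| <=
  r / K%:R * sig2 K + 2 * Ex P (fun w => tailsq r (U K (X K w))).
Proof.
move=> kK kp mf f3 f2 r r0.
have K1 : 0 < K%:R :> R by rewrite ltr0n.
have mUX : measurable_fun setT (fun w => U K (X K w)) by exact: (measurableT_comp (mU kK) (mX kK)).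
have mfU : measurable_fun setT (fun w => f (K%:R^-1 * U K (X K w))).
  by apply: (measurableT_comp mf); apply: measurable_funM.
have LT : L1 P (fun w => tailsq r (U K (X K w))).
  apply: (@L1_le _ _ _ _ _ (fun w => U K (X K w) ^+ 2)); last exact: LU.
    exact: (measurableT_comp (measurable_tailsq r)).
  by move=> w; rewrite /tailsq; case: ifP => _; rewrite ?normr0 ?sqr_ge0// ger0_norm ?sqr_ge0.
have Lf : L1 P (fun w => f (K%:R^-1 * U K (X K w))).
  apply: (@L1_le _ _ _ _ _ (fun w => 2 * (K%:R^-1 * U K (X K w)) ^+ 2)) => //.
  by apply: L1Z; apply: L1_sqrZ; exact: LU.
have LB := L1D (L1Z (r / K%:R) (LU kK)) (L1Z 2 LT).
rewrite -EU2// -(ExZ _ (LU kK)) -(ExZ _ LT) -(ExD (L1Z _ (LU kK)) (L1Z _ LT)).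
rewrite -(ger0_norm (ler0n R (K ^ 2))) -normrM -(ExZ _ Lf).
apply: Ex_norm_le => //; first exact: L1Z.
move=> w; set u := U K (X K w); rewrite normrM ger0_norm// natrX.
have uu : (K%:R ^+ 2) * (K%:R^-1 * u) ^+ 2 = u ^+ 2 by field; rewrite gt_eqF.
rewrite /tailsq; case: ifP => ur.
  rewrite mulr0 addr0.
  apply: le_trans (ler_wpM2l (sqr_ge0 _) (f3 _)) _.
  rewrite normrM (ger0_norm (x := K%:R^-1)) ?invr_ge0 ?(ltW K1)//.
  have -> : K%:R ^+ 2 * (K%:R^-1 * `|u|) ^+ 3 = `|u| / K%:R * u ^+ 2.
    by rewrite -(real_normK (num_real u)); field; rewrite gt_eqF.
  by rewrite ler_wpM2r ?sqr_ge0// ler_wpM2r// invr_ge0 ltW.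
apply: le_trans (ler_wpM2l (sqr_ge0 _) (f2 _)) _.
rewrite mulrCA uu lerDr mulr_ge0 ?sqr_ge0// divr_ge0// ltW.
Qed.

Let rem_cvg (f : R -> R) : measurable_fun setT f ->
  (forall x, `|f x| <= `|x| ^+ 3) -> (forall x, `|f x| <= 2 * x ^+ 2) ->
  (fun K => (K ^ 2)%:R * `|Ex P (fun w => f (K%:R^-1 * U K (X K w)))|) @ \oo --> (0 : R).
Proof.
move=> mf f3 f2; apply/cvgrPdist_le => e e0.
have e4 : 0 < e / 4 by rewrite divr_gt0.
have [r r0 Hr] := lind e4.
have e2 : 0 < e / 2 by rewrite divr_gt0.
have v1 : 0 < `|v| + 1 by rewrite ltr_wpDl.
have sv : \forall K \near \oo, sig2 K <= `|v| + 1.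
  move/cvgrPdist_le : sigv => /(_ _ (ltr01)); apply: filterS => K h.
  by have := ler_norm v; move: h; rewrite ler_norml; lra.
near=> K.
have kK : (K0 <= K)%N by near: K; exact: nbhs_infty_ge.
have kp : (0 < K)%N by near: K; exact: nbhs_infty_gt.
have K1 : 0 < K%:R :> R by rewrite ltr0n.
rewrite sub0r normrN normrM normr_id (ger0_norm (ler0n R _)).
apply: le_trans (rem_bound kK kp mf f3 f2 r0) _.
have := Hr _ kK => h1.
have : r / K%:R * sig2 K <= e / 2.
  have s1 : sig2 K <= `|v| + 1 by near: K; exact: sv.
  apply: (@le_trans _ _ (r / K%:R * (`|v| + 1))).
    by rewrite ler_wpM2l// divr_ge0// ltW.
  rewrite mulrAC ler_pdivrMr// [e / 2 * _]mulrC -ler_pdivrMr//.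
  by near: K; rewrite /=; exact: nbhs_infty_ger.
by lra.
Unshelve. all: by end_near. Qed.

(** The linear term of the sine vanishes by centering, and the quadratic term of the cosine cancels
    that of [b K]. What remains per summand is handled by [rem_cvg] and [expN_rem], after
    multiplication by the number [K^2] of summands. *)
Lemma triangular_clt (th : R) :
  (fun K => Ex P (fun w => cos (K%:R^-1 * (\sum_(k < K ^ 2) U K (Xs K k w)) + th))) @ \oo -->
  cos th * expR (- (v / 2)).
Proof.
(* The characteristic function at [1/K] of a centered Gaussian of variance [sig2 K]; for [K > 0] its
   power [K^2] is exactly [expR (- (sig2 K / 2))]. *)
pose b K : R := expR (- (sig2 K / 2 * (K%:R^-1) ^+ 2)).
have s0 K : (K0 <= K)%N -> 0 <= sig2 K.
  by move=> kK; rewrite -EU2//; apply: Ex_ge0 => w; exact: sqr_ge0.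
pose f1 (x : R) := sin x - x.
pose f2 (x : R) := cos x - 1 + x ^+ 2 / 2.
have mf1 : measurable_fun setT f1 by rewrite /f1; apply: measurable_funB => //; exact: measurable_sin.
have mf2 : measurable_fun setT f2.
  apply: measurable_funD; first by apply: measurable_funB => //; exact: measurable_cos.
  by apply: measurable_funM => //; exact: measurable_funX.
have r1 := rem_cvg mf1 (fun x => (sin_rem x).1) (fun x => (sin_rem x).2).
have r2 := rem_cvg mf2 (fun x => (cos_rem x).1) (fun x => (cos_rem x).2).
have r3 : (fun K => (sig2 K / 2) ^+ 2 * (K%:R^-1) ^+ 2) @ \oo --> (0 : R).
  have iv : (fun K => K%:R^-1) @ \oo --> (0 : R).
    by have := @cvg_harmonic R; rewrite /harmonic -(cvg_shiftS (fun K => K%:R^-1 : R)).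
  rewrite -[X in _ --> X](mulr0 ((v / 2) ^+ 2)); apply: cvgM.
    by rewrite expr2; under eq_fun do rewrite expr2; apply: cvgM; apply: cvgM => //; exact: cvg_cst.
  by rewrite -(mulr0 (0 : R)); under eq_fun do rewrite expr2; apply: cvgM.
have bb : (fun K => b K ^+ (K ^ 2) * cos th) @ \oo --> cos th * expR (- (v / 2)).
  have h : (fun K => cos th * expR (- (sig2 K / 2))) @ \oo --> cos th * expR (- (v / 2)).
    apply: cvgMr; apply: continuous_cvg; first exact: continuous_expR.
    by apply: cvgN; apply: cvgM => //; exact: cvg_cst.
  apply: cvg_trans h; apply: near_eq_cvg; near=> K.
  have kp : (0 < K)%N by near: K; exact: nbhs_infty_gt.
  rewrite mulrC /b -expRM_natl; congr (expR _ * _); rewrite natrX; field.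
  by rewrite pnatr_eq0 -lt0n.
have err : (fun K => Ex P (fun w => cos (K%:R^-1 * (\sum_(k < K ^ 2) U K (Xs K k w)) + th)) - b K ^+ (K ^ 2) * cos th)
    @ \oo --> (0 : R).
  apply: norm_cvg0.
  pose B K := (K ^ 2)%:R * `|Ex P (fun w => f1 (K%:R^-1 * U K (X K w)))| +
    (K ^ 2)%:R * `|Ex P (fun w => f2 (K%:R^-1 * U K (X K w)))| + (sig2 K / 2) ^+ 2 * (K%:R^-1) ^+ 2.
  have cB : B @ \oo --> (0 : R).
    by rewrite -(addr0 0) -[X in _ --> X + _](addr0 0); apply: cvgD => //; apply: cvgD.
  apply: (squeeze_cvgr _ (cvg_cst 0) cB); near=> K.
  have kK : (K0 <= K)%N by near: K; exact: nbhs_infty_ge.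
  have kp : (0 < K)%N by near: K; exact: nbhs_infty_gt.
  have K1 : 0 < K%:R :> R by rewrite ltr0n.
  rewrite normr_ge0 /=.
  have y0 : 0 <= sig2 K / 2 * K%:R^-1 ^+ 2 by rewrite mulr_ge0 ?sqr_ge0// divr_ge0// s0.
  have b01 : 0 <= b K <= 1.
    by rewrite /b expR_ge0 /= -[X in _ <= X]expR0 ler_expR oppr_le0.
  apply: le_trans (iid_char_bound (mX0 kK) (mXs kK) (mX kK) (lawX kK) (indX kK) (mU kK) _ _ _ b01) _.
  have mUX : measurable_fun setT (fun w => U K (X K w)) by exact: (measurableT_comp (mU kK) (mX kK)).
  have LU1 := L1_sqr_le mUX (LU kK).
  have mtU : measurable_fun setT (fun w => K%:R^-1 * U K (X K w)) by apply: measurable_funM.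
  have Ls : L1 P (fun w => sin (K%:R^-1 * U K (X K w))).
    apply: (@L1_bounded _ _ _ _ _ 1); last by move=> w; exact: sin_max.
    exact: (measurableT_comp measurable_sin).
  have Lc : L1 P (fun w => cos (K%:R^-1 * U K (X K w))).
    apply: (@L1_bounded _ _ _ _ _ 1); last by move=> w; exact: cos_max.
    exact: (measurableT_comp measurable_cos).
  have sE : Ex P (fun w => sin (K%:R^-1 * U K (X K w))) = Ex P (fun w => f1 (K%:R^-1 * U K (X K w))).
    rewrite /f1 (ExB Ls (L1Z _ LU1)) (ExZ _ LU1) EU// mulr0 subr0//.
  have cE : Ex P (fun w => cos (K%:R^-1 * U K (X K w))) - b K =
     Ex P (fun w => f2 (K%:R^-1 * U K (X K w))) - (b K - 1 + sig2 K / 2 * K%:R^-1 ^+ 2).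
    have Lq := L1Z (K%:R^-1 ^+ 2 / 2) (LU kK).
    have -> : (fun w => f2 (K%:R^-1 * U K (X K w))) =
      (fun w => (cos (K%:R^-1 * U K (X K w)) - 1) + K%:R^-1 ^+ 2 / 2 * U K (X K w) ^+ 2).
      by apply/funext => w; rewrite /f2; congr (_ + _); rewrite exprMn; ring.
    rewrite (ExD (L1B Lc (L1_cst _ _)) Lq) (ExB Lc (L1_cst _ _)) Ex_cst (ExZ _ (LU kK)) EU2//; ring.
  rewrite sE cE /B.
  have k3 : (K ^ 2)%:R * `|b K - 1 + sig2 K / 2 * K%:R^-1 ^+ 2| <= (sig2 K / 2) ^+ 2 * (K%:R^-1) ^+ 2.
    apply: le_trans (ler_wpM2l (ler0n _ _) (expN_rem y0)) _.
    rewrite natrX le_eqVlt; apply/orP; left; apply/eqP; field.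
    by rewrite gt_eqF.
  have k4 := ler_wpM2l (ler0n R (K ^ 2)) (ler_normB (Ex P (fun w => f2 (K%:R^-1 * U K (X K w))))
    (b K - 1 + sig2 K / 2 * K%:R^-1 ^+ 2)).
  rewrite mulrDr in k4; rewrite [leLHS]mulrDr [leLHS]addrC -[leRHS]addrA lerD2l.
  by apply: le_trans k4 _; rewrite lerD2l.
have h := cvgD err bb; rewrite add0r in h.
set F := (fun K => Ex P _).
rewrite (_ : F = (fun K => F K - b K ^+ (K ^ 2) * cos th) \+ (fun K => b K ^+ (K ^ 2) * cos th)); first exact: h.
by apply/funext => K; rewrite /= subrK.
Unshelve. all: by end_near. Qed.

End clt.

(** * Sums of powers *)

Section rates.
Context {R : realType}.
Implicit Types (s t : R) (k n K : nat).

(** The shift avoids the base [0] and matches the step [gam k.+1] of the update from [k] to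
    [k.+1]. *)
Definition pw s k : R := k.+1%:R `^ (- s).

Lemma pw_gt0 s k : 0 < pw s k.
Proof. by apply: powR_gt0; rewrite ltr0n. Qed.

Lemma pw_le1 s k : 0 <= s -> pw s k <= 1.
Proof.
move=> s0; rewrite /pw powRN invf_le1 ?powR_gt0 ?ltr0n//.
rewrite -[leLHS](_ : 1 `^ s = 1); last by rewrite powR1.
by rewrite ge0_ler_powR// ?nnegrE// ler1n.
Qed.

Lemma pwD s t k : pw (s + t) k = pw s k * pw t k.
Proof. by rewrite /pw opprD powRD//; apply/implyP => _; rewrite pnatr_eq0. Qed.

Lemma pw_half k : pw 2^-1 k = (Num.sqrt k.+1%:R)^-1.
Proof. by rewrite /pw powRN powR12_sqrt. Qed.

Lemma pw1 k : pw 1 k = k.+1%:R^-1.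
Proof. by rewrite /pw powRN powRr1. Qed.

Lemma pw_dec s k : 0 <= s -> pw s k.+1 <= pw s k.
Proof.
move=> s0; rewrite /pw !powRN lef_pV2 ?posrE ?powR_gt0 ?ltr0n//.
by rewrite ge0_ler_powR// ?nnegrE// ler_nat.
Qed.

Lemma pw_cvg0 s : 0 < s -> pw s k @[k --> \oo] --> (0 : R).
Proof.
move=> s0; apply/cvgrPdist_le => e e0; near=> k.
rewrite sub0r normrN ger0_norm ?(ltW (pw_gt0 _ _))// /pw powRN.
rewrite -[leRHS]invrK lef_pV2 ?posrE ?powR_gt0 ?invr_gt0 ?ltr0n//.
have e10 : 0 <= e^-1 by rewrite invr_ge0 ltW.
have -> : e^-1 = (e^-1 `^ s^-1) `^ s by rewrite -powRrM mulVf ?gt_eqF// powRr1.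
rewrite ge0_ler_powR ?nnegrE ?powR_ge0 ?(ltW s0)//.
apply: (@le_trans _ _ k%:R); last by rewrite ler_nat.
by near: k; exact: nbhs_infty_ger.
Unshelve. all: by end_near. Qed.

Lemma sqr_cvg_oo : (fun K => (K ^ 2)%N) @ \oo --> \oo.
Proof.
apply/cvgnyPge => A; near=> K.
have KA : (A <= K)%N by near: K; exact: nbhs_infty_ge.
have K0 : (0 < K)%N by near: K; exact: nbhs_infty_gt.
by apply: leq_trans KA _; rewrite expnS expn1 leq_pmulr.
Unshelve. all: by end_near. Qed.

(** Telescoping: with [x] and [y] the square roots of [n] and [n.+1], the inequality
    [1/y <= 2 (y - x)] is [(y - x)^2 >= 0] combined with [y^2 = x^2 + 1]. *)
Lemma sum_pw_half n : \sum_(k < n) pw 2^-1 k <= 2 * Num.sqrt n%:R.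
Proof.
elim: n => [|n IH]; first by rewrite big_ord0 mulr_ge0 ?sqrtr_ge0.
rewrite big_ord_recr/=; apply: le_trans (lerD IH (lexx _)) _; rewrite pw_half.
set x := Num.sqrt n%:R; set y := Num.sqrt n.+1%:R.
have y0 : 0 < y by rewrite sqrtr_gt0 ltr0n.
have x0 : 0 <= x by exact: sqrtr_ge0.
have xy : x <= y by rewrite ler_sqrt ?ltr0n// ler_nat.
have x2 : x ^+ 2 = n%:R by rewrite sqr_sqrtr.
have y2 : y ^+ 2 = x ^+ 2 + 1 by rewrite x2 sqr_sqrtr// natr1.
rewrite -(ler_pM2r y0) mulrDl mulVf ?gt_eqF//.
by have := sqr_ge0 (y - x); nra.
Qed.

(** Eventually [pw s] is at most a small multiple of [pw 2^-1], whose sum up to [K^2] is at most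
    [2 K]; the finitely many early terms cost a constant. *)
Lemma sum_pw_cvg0 s : 2^-1 < s -> (fun K => K%:R^-1 * \sum_(k < K ^ 2) pw s k) @ \oo --> (0 : R).
Proof.
move=> s12; apply/cvgrPdist_le => e e0.
have e3 : 0 < e / 3 by rewrite divr_gt0.
have s0 : 0 <= s by apply/ltW/lt_trans/s12; rewrite invr_gt0.
have [N _ HN] : \forall k \near \oo, pw (s - 2^-1) k <= e / 3.
  have := pw_cvg0 (s := s - 2^-1); rewrite subr_gt0 => /(_ s12) /cvgrPdist_le /(_ _ e3).
  apply: filterS => k; rewrite sub0r normrN; apply: le_trans; exact: ler_norm.
near=> K.
have K0 : 0 < K%:R :> R by rewrite ltr0n; near: K; exact: nbhs_infty_gt.
have S n : \sum_(k < n) pw s k <= N%:R + (e / 3) * (2 * Num.sqrt n%:R).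
  have h : \sum_(k < n) pw s k <= (minn n N)%:R + (e / 3) * \sum_(k < n) pw 2^-1 k.
    elim: n => [|n IH]; first by rewrite !big_ord0 mulr0 addr0.
    rewrite !big_ord_recr/=; case: (leqP N n) => Nn.
      rewrite (minn_idPr _) ?(leq_trans Nn)//; rewrite (minn_idPr Nn) in IH.
      apply: le_trans (lerD IH (lexx _)) _; rewrite mulrDr addrA lerD2l.
      have -> : pw s n = pw (s - 2^-1) n * pw 2^-1 n by rewrite -pwD subrK.
      by rewrite ler_wpM2r ?(ltW (pw_gt0 _ _))//; exact: HN.
    rewrite (minn_idPl _)//; rewrite (minn_idPl (ltnW Nn)) in IH.
    apply: le_trans (lerD IH (pw_le1 n s0)) _.
    rewrite -(natr1 n) mulrDr; have := mulr_ge0 (ltW e3) (ltW (pw_gt0 2^-1 n)); lra.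
  apply: le_trans h _; apply: lerD; first by rewrite ler_nat geq_minr.
  by rewrite ler_wpM2l ?(ltW e3)//; exact: sum_pw_half.
rewrite sub0r normrN ger0_norm; last first.
  by rewrite mulr_ge0 ?invr_ge0 ?(ltW K0)// sumr_ge0// => k _; exact/ltW/pw_gt0.
have := S (K ^ 2)%N; rewrite natrX sqrtr_sqr (ger0_norm (ltW K0)) => h.
rewrite mulrC ler_pdivrMr//; apply: le_trans h _.
have : N%:R <= (e / 3) * K%:R.
  by rewrite mulrC -ler_pdivrMr//; near: K; exact: nbhs_infty_ger.
by lra.
Unshelve. all: by end_near. Qed.

(** For [k < K^2] one factor [1/K] is at most [pw 2^-1 k]; moved into the sum, it raises the
    exponent above one half. *)
Lemma sum_pw_cvg0_sqr s : 0 < s ->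
  (fun K => (K%:R^-1) ^+ 2 * \sum_(k < K ^ 2) pw s k) @ \oo --> (0 : R).
Proof.
move=> s0.
apply: (@squeeze_cvgr _ _ _ _ (cst 0) (fun K => K%:R^-1 * \sum_(k < K ^ 2) pw (s + 2^-1) k)).
- near=> K; have K0 : 0 < K%:R :> R by rewrite ltr0n; near: K; exact: nbhs_infty_gt.
  apply/andP; split.
    by rewrite mulr_ge0 ?sqr_ge0// sumr_ge0// => k _; exact/ltW/pw_gt0.
  rewrite expr2 -mulrA ler_pM2l ?invr_gt0// mulrC ler_pdivrMr// mulr_suml ler_sum// => k _.
  rewrite pwD -mulrA ler_peMr ?(ltW (pw_gt0 _ _))// pw_half mulrC ler_pdivlMr ?sqrtr_gt0 ?ltr0n//.
  rewrite mul1r -(ger0_norm (ltW K0)) -sqrtr_sqr -natrX ler_sqrt ?ltr0n ?ler_nat//.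
- exact: cvg_cst.
- by apply: sum_pw_cvg0; rewrite ltrDr.
Unshelve. all: by end_near. Qed.

Lemma pwV_cvg0 t : 0 <= t < 2^-1 -> (fun K => K%:R^-1 * (pw t (K ^ 2)%N)^-1) @ \oo --> (0 : R).
Proof.
move=> /andP[t0 t12].
have c0 : (fun K => 2 * pw (2^-1 - t) (K ^ 2)%N) @ \oo --> (0 : R).
  rewrite -[X in _ --> X](mulr0 2); apply: cvgMr.
  apply: (cvg_comp _ _ sqr_cvg_oo (pw_cvg0 _)); by rewrite subr_gt0.
apply: (squeeze_cvgr _ (cvg_cst 0) c0).
near=> K; have K0 : 0 < K%:R :> R by rewrite ltr0n; near: K; exact: nbhs_infty_gt.
have p0 u k := ltW (pw_gt0 u k).
apply/andP; split; first by rewrite mulr_ge0 ?invr_ge0 ?(ltW K0).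
rewrite mulrC ler_pdivrMr//.
have -> : pw (2^-1 - t) (K ^ 2)%N = pw 2^-1 (K ^ 2)%N * (pw t (K ^ 2)%N)^-1.
  have := pwD (2^-1 - t) t (K ^ 2)%N; rewrite subrK => ->.
  by rewrite mulfK// gt_eqF// pw_gt0.
set X := (pw t _)^-1; set p := pw 2^-1 _.
have -> : 2 * (p * X) * K%:R = (2 * K%:R * p) * X by ring.
rewrite ler_peMl ?invr_ge0// /p pw_half ler_pdivlMr ?sqrtr_gt0 ?ltr0n// mul1r.
rewrite -[leRHS]ger0_norm ?mulr_ge0 ?(ltW K0)// -sqrtr_sqr ler_sqrt ?sqr_ge0//.
rewrite exprMn -natrX -natr1.
have : 1 <= (K ^ 2)%:R :> R by rewrite ler1n expn_gt0 -(ltr0n R) K0.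
by lra.
Unshelve. all: by end_near. Qed.

(* The multiplicative form of [beta < 1]: the relative decrease of [pw s] is [o(pw s)]. *)
Lemma pw_ratio s k : 0 <= s <= 1 -> pw s k * (1 - k.+2%:R^-1) <= pw s k.+1.
Proof.
move=> /andP[s0 s1].
have k1 : 0 < k.+1%:R :> R by rewrite ltr0n.
have k2 : 0 < k.+2%:R :> R by rewrite ltr0n.
have e : 1 - k.+2%:R^-1 = k.+1%:R / k.+2%:R :> R.
  by rewrite -{2}(natr1 k.+1) -[k.+2%:R in LHS](natr1 k.+1); field; rewrite -!natr1 in k2 *; rewrite gt_eqF.
have h : k.+1%:R / k.+2%:R <= (k.+1%:R / k.+2%:R) `^ s :> R.
  rewrite -[leLHS]powRr1 ?divr_ge0//.
  set x := _ / _; have x0 : 0 < x by exact: divr_gt0.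
  rewrite /powR gt_eqF// ler_expR ler_wnM2r// ln_le0// /x ler_pdivrMr// mul1r ler_nat//.
rewrite e; apply: le_trans (ler_wpM2l (ltW (pw_gt0 _ _)) h) _.
rewrite powRM ?invr_ge0 ?(ltW k1) ?(ltW k2)// /pw !powRN mulrA mulVf ?mul1r ?gt_eqF ?powR_gt0//.
by rewrite -powR_inv1 ?(ltW k2)// -powRrM mulN1r powRN.
Qed.

(** The increment of [x^s] over a unit step is at most of order [x^(s-1)]; these increments are the
    weights of the Abel summation. *)
Lemma pwV_incr s k : 0 <= s <= 1 -> 0 <= (pw s k.+1)^-1 - (pw s k)^-1 <= pw (1 - s) k.
Proof.
move=> s01; have /andP[s0 s1] := s01.
have p0 := pw_gt0 s k; have p1 := pw_gt0 s k.+1.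
rewrite subr_ge0 lef_pV2 ?posrE// pw_dec//= lerBlDr.
have := pw_ratio k s01 => h.
have k2 : 0 < k.+2%:R^-1 :> R by rewrite invr_gt0 ltr0n.
have k12 : k.+2%:R^-1 <= k.+1%:R^-1 :> R by rewrite lef_pV2 ?posrE ?ltr0n// ler_nat.
have q : pw (1 - s) k.+1 * pw s k.+1 = k.+2%:R^-1 by rewrite -pwD subrK pw1.
rewrite -(ler_pM2r p1) mulVf ?gt_eqF// mulrDl.
have d : pw (1 - s) k.+1 <= pw (1 - s) k by rewrite pw_dec// subr_ge0.
have h2 : 1 - k.+2%:R^-1 <= (pw s k)^-1 * pw s k.+1 by rewrite mulrC ler_pdivlMr// mulrC.
have h3 := ler_wpM2r (ltW p1) d; rewrite q in h3.
by apply: (@le_trans _ _ (k.+2%:R^-1 + (1 - k.+2%:R^-1))); [rewrite addrC subrK|exact: lerD].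
Qed.

End rates.

(** * Deterministic Robbins-Monro recursions *)

Section robbins_monro.
Context {R : realType}.
Variables (g : nat -> R) (c C A0 : R).
Hypotheses (g0 : forall n, 0 < g n) (gdec : forall n, g n.+1 <= g n).
Hypothesis gc : g @ \oo --> (0 : R).
Hypothesis gr : forall e, 0 < e -> \forall n \near \oo, g n * (1 - e * g n) <= g n.+1.
Hypotheses (c0 : 0 < c) (C0 : 0 <= C).

(** [A] is fixed before the sequence [a], which later gives uniformity in the bias parameter. Beyond
    some rank the induction closes: half of the contraction [c * g n] absorbs the factor
    [C * g n ^+ 2], a quarter the additive noise, and the last quarter the relative decrease of
    [g]. *)
Lemma robbins_monro_bound : exists2 A, 0 <= A & forall a : nat -> R, (forall n, 0 <= a n) ->
  a 0%N <= A0 -> (forall n, a n.+1 <= (1 - c * g n + C * g n ^+ 2) * a n + C * g n ^+ 2) ->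
  forall n, a n <= A * g n.
Proof.
have c4 : 0 < c / 4 by rewrite divr_gt0.
have [N1 _ HN1] := gr c4.
(* The first threshold ensures [C * g n <= c / 2], the second keeps [1 - c / 2 * g n]
   nonnegative. *)
have e0 : 0 < Num.min (c / (2 * (C + 1))) (2 / c) by rewrite lt_min !divr_gt0// mulr_gt0// ltr_wpDl.
have [N2 _ HN2] : \forall n \near \oo, g n <= Num.min (c / (2 * (C + 1))) (2 / c).
  move/cvgrPdist_le : gc => /(_ _ e0); apply: filterS => n.
  by rewrite sub0r normrN; apply: le_trans; exact: ler_norm.
pose N := maxn N1 N2.
have gle n : g n <= g 0%N by elim: n => [//|n IH]; exact: le_trans (gdec n) IH.
(* A majorant of every admissible sequence that ignores the contraction; it settles the ranks up to
   [N]. *)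
pose M := fix M n := if n is m.+1 then (1 + C * g 0%N ^+ 2) * M m + C * g 0%N ^+ 2 else Num.max A0 0.
have M0 n : 0 <= M n.
  elim: n => [|n IH] /=; first by rewrite le_max lexx orbT.
  by rewrite addr_ge0// mulr_ge0// ?sqr_ge0// addr_ge0// mulr_ge0// sqr_ge0.
have gdec2 m n : (m <= n)%N -> g n <= g m.
  by elim: n => [|n IH]; [rewrite leqn0 => /eqP->|rewrite leq_eqVlt => /predU1P[->//|/IH]; exact: le_trans].
pose B := \sum_(k < N.+1) M k.
have MB n : (n <= N)%N -> M n <= B.
  by move=> nN; rewrite /B (bigD1 (Ordinal (nN : (n < N.+1)%N)))//= lerDl sumr_ge0.
have B0 : 0 <= B by apply: sumr_ge0.
(* The first summand dominates the noise in the induction, the second covers the ranks up to [N],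
   where [g n >= g N]. *)
exists (4 * C / c + B / g N).
  by rewrite addr_ge0// divr_ge0 ?mulr_ge0// ltW.
move=> a a0 aA0 aS.
have sq n : g n ^+ 2 <= g 0%N ^+ 2 by rewrite ler_pXn2r ?nnegrE// ltW.
have aM n : a n <= M n.
  elim: n => [|n IH] /=; first by rewrite le_max aA0.
  apply: le_trans (aS n) _; apply: lerD; last by rewrite ler_wpM2l.
  apply: (@le_trans _ _ ((1 + C * g 0%N ^+ 2) * a n)).
    rewrite ler_wpM2r//; have := ler_wpM2l C0 (sq n); have := mulr_gt0 c0 (g0 n); lra.
  by rewrite ler_wpM2l// addr_ge0// mulr_ge0// sqr_ge0.
set A := _ + _.
have AC : 4 * C / c <= A by rewrite lerDl divr_ge0// ltW.
have A00 : 0 <= A by apply: le_trans AC; rewrite divr_ge0 ?mulr_ge0// ltW.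
elim=> [|n IH].
  apply: le_trans (aM 0%N) _; apply: le_trans (MB _ (leq0n _)) _.
  rewrite /A mulrDl -[leLHS]add0r lerD//.
    by rewrite mulr_ge0 ?divr_ge0 ?mulr_ge0// ltW.
  by rewrite mulrAC ler_pdivlMr// ler_wpM2l.
case: (ltnP n N) => nN.
  apply: le_trans (aM n.+1) _; apply: le_trans (MB _ nN) _.
  rewrite /A mulrDl -[leLHS]add0r lerD//.
    by rewrite mulr_ge0 ?divr_ge0 ?mulr_ge0// ltW.
  by rewrite mulrAC ler_pdivlMr// ler_wpM2l// gdec2.
have h1 := HN1 n; rewrite /= in h1; have {}h1 := h1 (leq_trans (leq_maxl _ _) nN).
have h2 := HN2 n; rewrite /= le_min in h2; have /andP[h2a h2b] := h2 (leq_trans (leq_maxr _ _) nN).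
have gn := g0 n.
have Cg : C * g n <= c / 2.
  move: h2a; rewrite ler_pdivlMr ?mulr_gt0 ?ltr_wpDl// => h; nra.
have cg : c / 2 * g n <= 1.
  by move: h2b; rewrite ler_pdivlMr//; lra.
have C4 : C <= A * (c / 4).
  by move: AC; rewrite ler_pdivrMr//; lra.
apply: le_trans (aS n) _.
have s1 : (1 - c * g n + C * g n ^+ 2) * a n <= (1 - c / 2 * g n) * a n.
  by rewrite ler_wpM2r//; nra.
have s2 : (1 - c / 2 * g n) * a n <= (1 - c / 2 * g n) * (A * g n).
  by rewrite ler_wpM2l// subr_ge0.
have s3 : C * g n ^+ 2 <= A * (c / 4) * g n ^+ 2 by rewrite ler_wpM2r// sqr_ge0.
have s4 := ler_wpM2l A00 h1.
by nra.
Qed.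

End robbins_monro.

(** * Mean-square error of the VaR recursion *)

(** The product of the right side with [1 - y] is [1 + y^2 (1 - 2 y)], while
    [(1 - y) * expR y <= 1]. The restriction on [y] is the origin of the bound [2^-1] imposed on
    [l * g n * a]. *)
Lemma expR_le_quad {R : realType} (y : R) : y <= 2^-1 -> expR y <= 1 + y + 2 * y ^+ 2.
Proof.
move=> y2; have h := expR_ge1Dx (- y); rewrite expRN in h.
have h1 : 0 < 1 - y by lra.
have e0 := expR_gt0 y.
have h2 : (1 - y) * expR y <= 1 by rewrite -ler_pdivlMr// mul1r.
rewrite -(ler_pM2l h1); apply: le_trans h2 _.
have := sqr_ge0 y; nra.
Qed.

Section H1.
Context {R : realType} (alpha : R).
Hypothesis alpha01 : 0 < alpha < 1.
Let a : R := (1 - alpha)^-1.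

Lemma a_gt1 : 1 < a.
Proof. by rewrite /a invf_gt1; have /andP[] := alpha01; lra. Qed.

Lemma H1_bound xi x : `|H1 alpha xi x| <= a.
Proof.
have a1 := a_gt1; rewrite /H1 -/a; case: ifP => _; rewrite ?mulr1 ?mulr0 ?subr0.
  by rewrite ler0_norm; lra.
by rewrite normr1 ltW.
Qed.

Lemma H1_measurable : measurable_fun setT (fun z : R * R => H1 alpha z.1 z.2).
Proof. by rewrite /H1; meas. Qed.

End H1.

(* [lyap l] is [2 (cosh (l x) - 1)]: quadratic near the minimizer and exponential far from it,
   so that a drift which is only bounded at infinity still contracts it. *)
Definition lyap {R : realType} (l x : R) : R := expR (l * x) + expR (- (l * x)) - 2.

Section lyap.
Context {R : realType} (l : R).
Hypotheses (l0 : 0 < l) (l1 : l <= 1).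
Let W := lyap l.

Lemma lyapN x : W (- x) = W x.
Proof. by rewrite /W /lyap mulrN opprK addrAC addrC addrA addrAC (addrC (expR _)). Qed.

(** With [y = l x / 2], [W x] is the square of [expR y - expR (- y)], a difference that is at least
    [y] for [y >= 0]. *)
Lemma lyap_ge_sqr x : l ^+ 2 / 4 * x ^+ 2 <= W x.
Proof.
wlog x0 : x / 0 <= x.
  move=> h; case: (lerP 0 x) => [/h //|/ltW x0].
  by have := h (- x); rewrite lyapN sqrrN oppr_ge0; apply.
pose y := l * x / 2.
have y0 : 0 <= y by rewrite /y divr_ge0// mulr_ge0// ltW.
have -> : l ^+ 2 / 4 * x ^+ 2 = y ^+ 2 by rewrite /y; field.
rewrite /W /lyap (_ : l * x = y + y); last by rewrite /y; field.
rewrite opprD !expRD.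
have := expR_ge1Dx y; have := expRxMexpNx_1 y; have : expR (- y) <= 1 by rewrite -expR0 ler_expR oppr_le0.
have := expR_gt0 (- y).
set u := expR y; set v := expR (- y) => v0 v1 uv u1.
have : 0 <= u - v - y by lra.
have -> : u * u + v * v - 2 = (u - v) ^+ 2 by rewrite sqrrB mulr2n uv; ring.
by nra.
Qed.

Lemma lyap_ge0 x : 0 <= W x.
Proof. by apply: le_trans (lyap_ge_sqr x); rewrite mulr_ge0 ?divr_ge0 ?sqr_ge0. Qed.

(** The first factor is the derivative of [W] divided by [l]. Paired with a drift that saturates at
    distance 1, it still controls a full multiple of [W], which fails for [x^2]. *)
Lemma lyap_drift x : 0 <= x -> W x <= (expR (l * x) - expR (- (l * x))) * Num.min 1 x.
Proof.
move=> x0; rewrite /W /lyap.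
set y := l * x.
have y0 : 0 <= y by rewrite /y mulr_ge0// ltW.
have yx : y <= x by rewrite /y ler_piMl.
have := expR_ge1Dx (- y); have := expRxMexpNx_1 y; have : expR (- y) <= 1 by rewrite -expR0 ler_expR oppr_le0.
have := expR_gt0 (- y); have : 1 <= expR y by rewrite -expR0 ler_expR.
set u := expR y; set v := expR (- y) => u1 v0 v1 uv hv.
case: (leP 1 x) => hx; first by rewrite mulr1; lra.
apply: (@le_trans _ _ ((u - v) * y)); last by rewrite ler_wpM2l//; lra.
have u0 : 0 < u by lra.
have -> : u + v - 2 = (u - 1) * (1 - v).
  have -> : (u - 1) * (1 - v) = u + v - 1 - u * v by ring.
  by rewrite uv; ring.
have : (u - v) * y - (u - 1) * (1 - v) = (u - 1) * (y - (1 - v)) + (1 - v) * y by ring.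
have : 0 <= (u - 1) * (y - (1 - v)) by apply: mulr_ge0; lra.
have : 0 <= (1 - v) * y by apply: mulr_ge0; lra.
by lra.
Qed.

(** Second-order expansion of both exponentials; the remainder is relative, [W x + 2] being their
    sum. *)
Lemma lyap_step x z : `|l * z| <= 2^-1 ->
  W (x - z) <= W x - l * z * (expR (l * x) - expR (- (l * x))) + 2 * (l * z) ^+ 2 * (W x + 2).
Proof.
rewrite ler_norml => /andP[h1 h2].
rewrite /W /lyap mulrBr opprB expRD (addrC (l * z)) expRD.
have e1 : expR (- (l * z)) <= 1 - l * z + 2 * (l * z) ^+ 2.
  by apply: le_trans (expR_le_quad _) _; [lra|rewrite sqrrN].
have e2 := expR_le_quad h2.
have p1 := expR_gt0 (l * x); have p2 := expR_gt0 (- (l * x)).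
set E1 := expR (l * x) in p1 *; set E2 := expR (- (l * x)) in p2 *.
have f1 := ler_wpM2l (ltW p1) e1; have f2 := ler_wpM2l (ltW p2) e2.
by nra.
Qed.

End lyap.

Section SA.
Context {R : realType} {d : measure_display} {Om : measurableType d} (P : probability Om R).
Variables (alpha : R) (gam : nat -> R) (Xs : nat -> Om -> R) (xi0 : Om -> R) (X : Om -> R).
Hypothesis alpha01 : 0 < alpha < 1.
Hypotheses (mxi0 : measurable_fun setT xi0) (mXs : forall n, measurable_fun setT (Xs n))
  (mX : measurable_fun setT X) (lawX : forall n, same_law P (Xs n) X)
  (indX : forall N, indep_family P xi0 Xs N).
Let a : R := (1 - alpha)^-1.
Let g n := gam n.+1.
Let xi n w := (nsa alpha gam Xs xi0 n w).1.
Let H := H1 alpha.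
Definition meanH xi := Ex P (fun w => H1 alpha xi (X w)).
Let D := meanH.
Hypothesis g0 : forall n, 0 < g n.

Let a1 : 1 < a. Proof. exact: a_gt1. Qed.
Let a0 : 0 < a. Proof. by apply: lt_trans a1. Qed.
Let mH : measurable_fun setT (fun z : R * R => H z.1 z.2). Proof. exact: H1_measurable. Qed.

Let Phi n (z : R * R) := z.1 - g n * H z.1 z.2.
Let mPhi n : measurable_fun setT (Phi n).
Proof. by apply: measurable_funB => //; apply: measurable_funM. Qed.

Lemma xiS n w : xi n.+1 w = xi n w - g n * H (xi n w) (Xs n w).
Proof. by []. Qed.

Lemma xi_measurable n : measurable_fun setT (xi n).
Proof.
exact: (recursion_measurable mxi0 mXs (@measurable_id _ _ setT) mPhi (S := xi) (fun=> erefl) (fun _ _ => erefl)).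
Qed.

Lemma xi_indep n : indep2 P (xi n) (Xs n).
Proof.
exact: (recursion_indep mxi0 mXs (@measurable_id _ _ setT) mPhi (S := xi) (fun=> erefl) (fun _ _ => erefl) (indX n.+1)).
Qed.

Let mHX s Y : measurable_fun setT Y -> measurable_fun setT (fun w : Om => H s (Y w)).
Proof.
by move=> mY; apply: (measurableT_comp mH (g := fun w => (s, Y w))); apply: measurable_fun_pair.
Qed.

Let LHX s Y : measurable_fun setT Y -> L1 P (fun w : Om => H s (Y w)).
Proof. by move=> mY; apply: (@L1_bounded _ _ _ _ _ a); [exact: mHX|move=> w; exact: H1_bound]. Qed.

Lemma Ex_HXs s n : Ex P (fun w => H s (Xs n w)) = D s.
Proof.
apply: (same_law_Ex (mXs n) mX (lawX n) (f := H s)); last exact: LHX.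
by apply: (measurableT_comp mH (g := fun x => (s, x))); apply: measurable_fun_pair.
Qed.

Section lyapunov.
Variables (xs c l : R).
Hypotheses (l01 : 0 < l <= 1) (lg : forall n, l * g n * a <= 2^-1).
Hypotheses (hDr : forall x, xs <= x -> c * Num.min 1 (x - xs) <= D x)
  (hDl : forall x, x <= xs -> c * Num.min 1 (xs - x) <= - D x).
Hypothesis c0 : 0 < c.
Let W := lyap l.
Let l0 : 0 < l. Proof. by case/andP: l01. Qed.
Let l1 : l <= 1. Proof. by case/andP: l01. Qed.

Let drift x : c * W (x - xs) <= D x * (expR (l * (x - xs)) - expR (- (l * (x - xs)))).
Proof.
case: (lerP xs x) => hx.
  have h := hDr hx; have x0 : 0 <= x - xs by rewrite subr_ge0.
  have dr := lyap_drift l0 l1 x0; rewrite -/W in dr.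
  have e0 : 0 <= expR (l * (x - xs)) - expR (- (l * (x - xs))).
    by rewrite subr_ge0 ler_expR; have := mulr_ge0 (ltW l0) x0; lra.
  apply: le_trans (ler_wpM2l (ltW c0) dr) _.
  by rewrite mulrCA mulrC ler_wpM2r.
have h := hDl (ltW hx); have x0 : 0 <= xs - x by rewrite subr_ge0 ltW.
have dr := lyap_drift l0 l1 x0; rewrite -/W in dr.
have wE : W (x - xs) = W (xs - x) by rewrite /W -lyapN opprB.
have lE : l * (x - xs) = - (l * (xs - x)) by rewrite -mulrN opprB.
rewrite wE lE opprK.
have e0 : 0 <= expR (l * (xs - x)) - expR (- (l * (xs - x))).
  by rewrite subr_ge0 ler_expR; have := mulr_ge0 (ltW l0) x0; lra.
apply: le_trans (ler_wpM2l (ltW c0) dr) _.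
rewrite -[leRHS]mulrNN opprB mulrCA mulrC ler_wpM2r//.
Qed.

Let mW : measurable_fun setT W.
Proof. by rewrite /W /lyap; meas. Qed.

Hypothesis LW0 : L1 P (fun w => W (xi0 w - xs)).

Let step n s x : W (s - g n * H s x - xs) <= W (s - xs)
    - (l * g n * (expR (l * (s - xs)) - expR (- (l * (s - xs))))) * H s x
    + 2 * (l * g n * a) ^+ 2 * (W (s - xs) + 2).
Proof.
rewrite addrAC.
have Ha := H1_bound alpha01 s x; rewrite -/a -/H in Ha.
have lgp : 0 <= l * g n by rewrite mulr_ge0// ltW.
have lz : `|l * (g n * H s x)| <= l * g n * a.
  by rewrite mulrA normrM (ger0_norm lgp) ler_wpM2l.
have := @lyap_step R l (s - xs) _ (le_trans lz (lg n)); rewrite -/W => h.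
apply: le_trans h _; apply: lerD; first by rewrite lerD2l lerN2 le_eqVlt; apply/orP; left; apply/eqP; ring.
apply: ler_wpM2r; first by rewrite addr_ge0//; exact: lyap_ge0.
rewrite ler_wpM2l//.
rewrite -(real_normK (num_real (l * (g n * H s x)))) ler_pXn2r ?nnegrE//.
by rewrite mulr_ge0 ?(ltW a0).
Qed.

(** A bound free of the sign of the drift, used to propagate integrability along the recursion. *)
Let lyap_crude n s x : W (s - g n * H s x - xs) <= 2 * W (s - xs) + 2.
Proof.
apply: le_trans (step n s x) _.
have Ha := H1_bound alpha01 s x; rewrite -/a -/H in Ha.
have lgp : 0 <= l * g n by rewrite mulr_ge0// ltW.
have lga : 0 <= l * g n * a by rewrite mulr_ge0// ltW.
have p1 := expR_gt0 (l * (s - xs)); have p2 := expR_gt0 (- (l * (s - xs))).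
have W0 := lyap_ge0 l0 (s - xs); rewrite -/W in W0.
have h1 : 2 * (l * g n * a) ^+ 2 * (W (s - xs) + 2) <= 2^-1 * (W (s - xs) + 2).
  apply: ler_wpM2r; first by rewrite addr_ge0.
    move: lga (lg n); set y := l * g n * a => y0 y1.
    by have : 0 <= y * (2^-1 - y); [rewrite mulr_ge0// subr_ge0|lra].
have h2 : - (l * g n * (expR (l * (s - xs)) - expR (- (l * (s - xs)))) * H s x) <= 2^-1 * (W (s - xs) + 2).
  apply: le_trans (ler_norm _) _; rewrite normrN !normrM (ger0_norm (ltW l0)) (ger0_norm (ltW (g0 n))).
  rewrite mulrAC; apply: ler_pM => //.
  - by rewrite !mulr_ge0// ltW.
  - by apply: le_trans (lg n); rewrite ler_wpM2l.
  - rewrite /W /lyap subrK (le_trans (ler_normB _ _))// !ger0_norm// ltW//.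
by lra.
Qed.

Lemma lyap_L1 n : L1 P (fun w => W (xi n w - xs)).
Proof.
elim: n => [//|n IH].
have m1 : measurable_fun setT (fun w => W (xi n.+1 w - xs)).
  by apply: measurableT_comp => //; apply: measurable_funB => //; exact: xi_measurable.
apply: (@L1_le _ _ _ _ _ (fun w => 2 * W (xi n w - xs) + 2)) => //.
  move=> w; rewrite ger0_norm; last exact: lyap_ge0.
  by rewrite xiS; exact: lyap_crude.
by apply: L1D; [exact: L1Z|exact: L1_cst].
Qed.

Lemma lyap_rec n : Ex P (fun w => W (xi n.+1 w - xs)) <=
  (1 - l * c * g n + 4 * l ^+ 2 * a ^+ 2 * g n ^+ 2) * Ex P (fun w => W (xi n w - xs))
  + 4 * l ^+ 2 * a ^+ 2 * g n ^+ 2.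
Proof.
set A := 1 - _ + _; set B := 4 * _ * _ * _.
have LW := lyap_L1 n; have LW1 := lyap_L1 n.+1.
have LA := L1Z A LW; have LB := L1_cst P B.
have -> : A * Ex P (fun w => W (xi n w - xs)) + B = Ex P (fun w => A * W (xi n w - xs) + B).
  by rewrite (ExD LA LB) (ExZ _ LW); congr (_ + _); exact/esym/Ex_cst.
apply: (@indep2_Ex_le _ _ _ _ _ _ _ P (xi n) (Xs n) (xi_measurable n) (mXs n) (xi_indep n)
  (fun z => W (z.1 - g n * H z.1 z.2 - xs)) (fun s => A * W (s - xs) + B)).
- by apply: measurableT_comp => //; apply: measurable_funB => //; exact: mPhi.
- apply: measurable_funD => //; apply: measurable_funM => //; apply: measurableT_comp => //.
  by apply: measurable_funB.
- exact: LW1.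
- exact: (L1D LA LB).
- move=> s /=; apply: (@L1_bounded _ _ _ _ _ (2 * W (s - xs) + 2)).
    apply: measurableT_comp => //; apply: measurable_funB => //; apply: measurable_funB => //.
    by apply: measurable_funM => //; exact: mHX.
  by move=> w; rewrite ger0_norm ?lyap_ge0//; exact: lyap_crude.
- move=> s /=.
  pose k := l * g n * (expR (l * (s - xs)) - expR (- (l * (s - xs)))).
  pose q := W (s - xs) + 2 * (l * g n * a) ^+ 2 * (W (s - xs) + 2).
  have LH := LHX s (mXs n).
  have h : Ex P (fun w => W (s - g n * H s (Xs n w) - xs)) <= Ex P (fun w => q + (- k) * H s (Xs n w)).
    apply: Ex_le.
    - apply: (@L1_bounded _ _ _ _ _ (2 * W (s - xs) + 2)).
        apply: measurableT_comp => //; apply: measurable_funB => //; apply: measurable_funB => //.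
        by apply: measurable_funM => //; exact: mHX.
      by move=> w; rewrite ger0_norm ?lyap_ge0//; exact: lyap_crude.
    - by apply: L1D; [exact: L1_cst|exact: L1Z].
    - by move=> w; apply: le_trans (step n s (Xs n w)) _; rewrite /q /k; lra.
  apply: le_trans h _; rewrite ExD; [|exact: L1_cst|exact: L1Z].
  rewrite Ex_cst ExZ// Ex_HXs.
  have W0 := lyap_ge0 l0 (s - xs); rewrite -/W in W0.
  have dr := drift s; have lgp : 0 <= l * g n by rewrite mulr_ge0// ltW.
  have {}dr := ler_wpM2l lgp dr.
  have sq : 0 <= (l * g n * a) ^+ 2 by exact: sqr_ge0.
  have -> : B = 4 * (l * g n * a) ^+ 2 by rewrite /B; ring.
  have -> : A = 1 - l * c * g n + 4 * (l * g n * a) ^+ 2 by rewrite /A; ring.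
  rewrite /q /k.
  have := mulr_ge0 sq W0; move: sq dr.
  set E := expR _ - expR _; set w := W _; set y := (_ ^+ 2).
  by move=> sq dr yw; nra.
Qed.

End lyapunov.
End SA.

Lemma lipschitz_measurable {R : realType} (f : R -> R) (L : R) :
  (forall x y, `|f x - f y| <= L * `|x - y|) -> measurable_fun setT f.
Proof.
move=> h; apply: continuous_measurable_fun => x.
apply/cvgrPdist_le => e e0.
have L1p : 0 < `|L| + 1 by rewrite ltr_wpDl.
have e1 : 0 < e / (`|L| + 1) by rewrite divr_gt0.
near=> y.
apply: le_trans (h x y) _.
apply: (@le_trans _ _ ((`|L| + 1) * `|x - y|)).
  by rewrite ler_wpM2r//; have := ler_norm L; lra.
rewrite mulrC -ler_pdivlMr//.
Unshelve. all: try by end_near. Qed.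

Section sq_bound.
Context {R : realType} {d : measure_display} {Om : measurableType d} (P : probability Om R).
Variables (alpha gamma1 beta c l A0 : R).
Hypotheses (alpha01 : 0 < alpha < 1) (gamma10 : 0 < gamma1) (beta01 : 0 <= beta < 1)
  (c0 : 0 < c) (l01 : 0 < l <= 1) (lg : l * gamma1 * (1 - alpha)^-1 <= 2^-1).
Hypothesis beta0 : 0 < beta.
Let gam n : R := gamma1 * n%:R `^ (- beta).
Let g n : R := gamma1 * pw beta n.

Lemma step_gt0 n : 0 < gamma1 * pw beta n. Proof. by rewrite mulr_gt0 ?pw_gt0. Qed.

(** The relative decrease of the step is at most [1/n.+2], which is at most
    [pw (1 - beta) n * pw beta n]; since [beta < 1], the first factor tends to zero. *)
Let gr e : 0 < e -> \forall n \near \oo, g n * (1 - e * g n) <= g n.+1.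
Proof.
move=> e0.
have b1 : 0 < 1 - beta by rewrite subr_gt0; case/andP: beta01.
have eg : 0 < e * gamma1 by rewrite mulr_gt0.
have := pw_cvg0 b1 => /cvgrPdist_le /(_ _ eg); apply: filterS => n.
rewrite sub0r normrN ger0_norm ?(ltW (pw_gt0 _ _))// => h.
rewrite /g -mulrA ler_pM2l//; apply: le_trans (pw_ratio n (s := beta) _); last first.
  by case/andP: beta01 => -> /ltW.
rewrite ler_wpM2l ?(ltW (pw_gt0 _ _))// lerD2l lerN2 mulrA.
apply: (@le_trans _ _ (pw (1 - beta) n * pw beta n)).
  by rewrite -pwD subrK pw1 lef_pV2 ?posrE ?ltr0n// ler_nat.
by rewrite ler_wpM2r ?(ltW (pw_gt0 _ _)).
Qed.

Let gc : g @ \oo --> (0 : R).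
Proof. by rewrite -[X in _ --> X](mulr0 gamma1); apply: cvgMr; exact: pw_cvg0. Qed.

Let lc0 : 0 < l * c. Proof. by case/andP: l01 => l0 _; rewrite mulr_gt0. Qed.

(** The order of the quantifiers carries the uniformity: [A] depends on the drift constant [c], the
    exponent [l], the initial bound [A0] and the steps, not on the law of [X]. *)
Lemma SA_sqr_bound : exists2 A, 0 <= A &
  forall (Xs : nat -> Om -> R) (xi0 X : Om -> R) (xs : R),
  measurable_fun setT xi0 -> (forall n, measurable_fun setT (Xs n)) ->
  measurable_fun setT X -> (forall n, same_law P (Xs n) X) ->
  (forall N, indep_family P xi0 Xs N) ->
  (forall x, xs <= x -> c * Num.min 1 (x - xs) <= meanH P alpha X x) ->
  (forall x, x <= xs -> c * Num.min 1 (xs - x) <= - meanH P alpha X x) ->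
  L1 P (fun w => lyap l (xi0 w - xs)) -> Ex P (fun w => lyap l (xi0 w - xs)) <= A0 ->
  forall n, L1 P (fun w => ((nsa alpha gam Xs xi0 n w).1 - xs) ^+ 2) /\
    Ex P (fun w => ((nsa alpha gam Xs xi0 n w).1 - xs) ^+ 2) <= A * g n.
Proof.
have a0 : 0 < (1 - alpha)^-1 by apply: lt_trans (a_gt1 alpha01).
have /andP[l0 l1] := l01.
have C0 : 0 <= 4 * l ^+ 2 * (1 - alpha)^-1 ^+ 2 by rewrite mulr_ge0 ?sqr_ge0// mulr_ge0 ?sqr_ge0.
have gd n : g n.+1 <= g n.
  by rewrite /g ler_pM2l// pw_dec// ltW.
have [A A00 HA] := robbins_monro_bound A0 step_gt0 gd gc gr lc0 C0.
exists (4 / l ^+ 2 * A); first by rewrite mulr_ge0// divr_ge0// sqr_ge0.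
move=> Xs xi0 X xs mxi0 mXs mX lawX indX hr hl LW EW n.
have g0 k : 0 < gam k.+1 by exact: step_gt0.
have lgn k : l * gam k.+1 * (1 - alpha)^-1 <= 2^-1.
  apply: le_trans lg; rewrite ler_wpM2r ?(ltW a0)// ler_wpM2l ?(ltW l0)// /gam ler_piMr ?(ltW gamma10)//.
  by apply: pw_le1; exact: ltW.
have LWn := lyap_L1 alpha01 mxi0 mXs g0 l01 lgn LW.
have rec := lyap_rec alpha01 mxi0 mXs mX lawX indX g0 l01 lgn hr hl c0 LW.
have {}LWn k : L1 P (fun w => lyap l ((nsa alpha gam Xs xi0 k w).1 - xs)) by exact: LWn.
pose a k := Ex P (fun w => lyap l ((nsa alpha gam Xs xi0 k w).1 - xs)).
have ha k : a k <= A * g k.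
  apply: HA => // m.
  by apply: Ex_ge0 => w; exact: lyap_ge0.
pose De w := (nsa alpha gam Xs xi0 n w).1 - xs.
have mD : measurable_fun setT De.
  by apply: measurable_funB => //; exact: (xi_measurable alpha gam mxi0 mXs).
have lq : 0 < l ^+ 2 / 4 by rewrite divr_gt0// exprn_gt0.
have LD : L1 P (fun w => De w ^+ 2).
  apply: (@L1_le _ _ _ _ _ (fun w => (l ^+ 2 / 4)^-1 * lyap l (De w))).
  - exact: measurable_funX.
  - move=> w; rewrite ger0_norm ?sqr_ge0// mulrC ler_pdivlMr// mulrC.
    exact: lyap_ge_sqr.
  - exact: (L1Z _ (LWn n)).
split => //.
apply: (@le_trans _ _ (4 / l ^+ 2 * a n)); last first.
  by rewrite -[4 / l ^+ 2 * A * _]mulrA ler_wpM2l// divr_ge0// sqr_ge0.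
rewrite /a -(ExZ _ (LWn n)); apply: Ex_le => //; first exact: (L1Z _ (LWn n)).
move=> w; have h := lyap_ge_sqr l0 (De w).
rewrite -(ler_pM2l lq); apply: le_trans h _; rewrite mulrA.
have -> : l ^+ 2 / 4 * (4 / l ^+ 2) = 1 by field; rewrite gt_eqF.
by rewrite mul1r.
Qed.

End sq_bound.

(** * Averaging *)

Section remainders.
Context {R : realType} {d : measure_display} {Om : measurableType d} (P : probability Om R).
Variables (alpha : R) (gam : nat -> R) (Xs : nat -> Om -> R) (xi0 : Om -> R) (X : Om -> R).
Hypothesis alpha01 : 0 < alpha < 1.
Hypotheses (mxi0 : measurable_fun setT xi0) (mXs : forall n, measurable_fun setT (Xs n))
  (mX : measurable_fun setT X) (lawX : forall n, same_law P (Xs n) X)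
  (indX : forall N, indep_family P xi0 Xs N).
Let a : R := (1 - alpha)^-1.
Let g n := gam n.+1.
Let xi n w := (nsa alpha gam Xs xi0 n w).1.
Let H := H1 alpha.
Let D := meanH P alpha X.
Hypotheses (g0 : forall n, 0 < g n) (gdec : forall n, g n.+1 <= g n).
Variables (xs b M L : R) (q : nat -> R).
Let De n w := xi n w - xs.
Let s n := Num.sqrt (q n).
Hypotheses (M0 : 0 <= M) (q0 : forall n, 0 <= q n).
Hypotheses (LDe : forall n, L1 P (fun w => De n w ^+ 2))
  (EDe : forall n, Ex P (fun w => De n w ^+ 2) <= q n).
Hypotheses (Dxs : D xs = 0) (Dlin : forall x, `|D x - b * (x - xs)| <= M * (x - xs) ^+ 2)
  (Dlip : forall x y, `|D x - D y| <= L * `|x - y|)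
  (Hvar : forall x, Ex P (fun w => (H x (X w) - H xs (X w)) ^+ 2) <= M * `|x - xs|).

Let a1 : 1 < a. Proof. exact: a_gt1. Qed.
Let a0 : 0 < a. Proof. by apply: lt_trans a1. Qed.
Let mH : measurable_fun setT (fun z : R * R => H z.1 z.2). Proof. exact: H1_measurable. Qed.
Let mD : measurable_fun setT D. Proof. exact: lipschitz_measurable Dlip. Qed.
Let mHx x : measurable_fun setT (H x).
Proof. by apply: (measurableT_comp mH (g := fun y => (x, y))); apply: measurable_fun_pair. Qed.
Let Phi n (z : R * R) := z.1 - g n * H z.1 z.2.
Let mPhi n : measurable_fun setT (Phi n).
Proof. by apply: measurable_funB => //; apply: measurable_funM. Qed.
Let mxi n : measurable_fun setT (xi n). Proof. exact: (xi_measurable alpha gam mxi0 mXs). Qed.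
Let mDe n : measurable_fun setT (De n). Proof. by apply: measurable_funB. Qed.
Let L1De n : L1 P (De n). Proof. exact: L1_sqr_le. Qed.
Let LH x Y : measurable_fun setT Y -> L1 P (fun w : Om => H x (Y w)).
Proof.
by move=> mY; apply: (@L1_bounded _ _ _ _ _ a); [exact: measurableT_comp|move=> w; exact: H1_bound].
Qed.

Let EDs n : Ex P (fun w => `|De n w|) <= s n.
Proof. by apply: Ex_norm_sqrt; rewrite ?sqrtr_ge0 ?sqr_sqrtr. Qed.

(** The noise at the current iterate minus the noise at [xs], centered because [D xs = 0]. *)
Let e (z : R * R) := H z.1 z.2 - H xs z.2 - D z.1.
Let me : measurable_fun setT e.
Proof.
apply: measurable_funB; first apply: measurable_funB => //.
  exact: (measurableT_comp (mHx xs)).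
exact: (measurableT_comp mD).
Qed.

Let e_bound z : `|e z| <= 2 * a + `|D z.1|.
Proof.
rewrite /e; apply: le_trans (ler_normB _ _) _; rewrite lerD2r.
apply: le_trans (ler_normB _ _) _; have := H1_bound alpha01 z.1 z.2; have := H1_bound alpha01 xs z.2.
by rewrite -/a -/H; lra.
Qed.

Let D_bound x : `|D x| <= a.
Proof.
apply: Ex_norm_bound; last by move=> w; exact: H1_bound.
exact: (measurableT_comp (mHx x)).
Qed.

Let e_bound3 z : `|e z| <= 3 * a.
Proof. by apply: le_trans (e_bound z) _; have := D_bound z.1; lra. Qed.

Let e_sqr (Y : Om -> R * R) : measurable_fun setT Y -> L1 P (fun w => e (Y w) ^+ 2).
Proof.
move=> mY; apply: (@L1_bounded _ _ _ _ _ ((3 * a) ^+ 2)).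
  by apply: measurable_funX; exact: (measurableT_comp me).
move=> w; rewrite normrX ler_pXn2r ?nnegrE ?normr_ge0//.
by rewrite mulr_ge0// ltW.
Qed.


Let Ee k x : Ex P (fun w => e (x, Xs k w)) = 0.
Proof.
rewrite /e /=.
have l1 := LH x (mXs k); have l2 := LH xs (mXs k); have l3 := L1_cst P (D x).
rewrite (ExB (L1B l1 l2) l3) (ExB l1 l2) Ex_cst.
by rewrite /H !(Ex_HXs alpha01 mXs mX lawX) -/D Dxs subr0 subrr.
Qed.

Let Ee2 k x : Ex P (fun w => e (x, Xs k w) ^+ 2) <= M * `|x - xs|.
Proof.
have l1 := LH x (mXs k); have l2 := LH xs (mXs k).
have lD := L1B l1 l2.
have mF : measurable_fun setT (fun y => (H x y - H xs y) ^+ 2).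
  by apply: measurable_funX; apply: measurable_funB.
have lF (Y : Om -> R) : measurable_fun setT Y -> L1 P (fun w => (H x (Y w) - H xs (Y w)) ^+ 2).
  move=> mY; apply: (@L1_bounded _ _ _ _ _ ((2 * a) ^+ 2)).
    exact: (measurableT_comp mF).
  move=> w; rewrite normrX ler_pXn2r ?nnegrE ?normr_ge0//; last by rewrite mulr_ge0// ltW.
  apply: le_trans (ler_normB _ _) _; have := H1_bound alpha01 x (Y w); have := H1_bound alpha01 xs (Y w).
  by rewrite -/a -/H; lra.
apply: le_trans (Hvar x); rewrite -(same_law_Ex (mXs k) mX (lawX k) mF (lF X mX)).
have -> : (fun w => e (x, Xs k w) ^+ 2) = (fun w => (H x (Xs k w) - H xs (Xs k w)) ^+ 2 +
    ((- 2 * D x) * (H x (Xs k w) - H xs (Xs k w)) + D x ^+ 2)).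
  by apply/funext => w; rewrite /e /=; ring.
have lZ := L1Z (- 2 * D x) lD; have lc := L1_cst P (D x ^+ 2).
rewrite (ExD (lF _ (mXs k)) (L1D lZ lc)) (ExD lZ lc) (ExZ _ lD) (ExB l1 l2) Ex_cst.
rewrite /H !(Ex_HXs alpha01 mXs mX lawX) -/D Dxs subr0 gerDl.
by have := sqr_ge0 (D x); nra.
Qed.

Let Mn n w := \sum_(k < n) e (xi k w, Xs k w).

(** Since [H1] jumps, the variance of an increment is only of the order of the distance to [xs], not
    of its square; hence a sum of root mean squares [s k]. *)
Let Mn_sqr n : L1 P (fun w => Mn n w ^+ 2) /\ Ex P (fun w => Mn n w ^+ 2) <= M * \sum_(k < n) s k.
Proof.
have mv : measurable_fun setT (fun x : R => M * `|x - xs|).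
  by apply: measurable_funM => //; apply: (measurableT_comp (@normr_measurable _ setT)); apply: measurable_funB.
have h1 k : L1 P (fun w => e (xi k w, Xs k w) ^+ 2) by apply: e_sqr; apply: measurable_fun_pair.
have h2 k x : L1 P (fun w => e (x, Xs k w) ^+ 2) by apply: e_sqr; apply: measurable_fun_pair.
have h3 k : L1 P (fun w => M * `|xi k w - xs|) by apply: L1Z; apply: L1_norm; exact: L1De.
have [] := martingale_sqr mxi0 mXs (@measurable_id _ _ setT) mPhi (S := xi)
  (fun=> erefl) (fun _ _ => erefl) (indX n) me mv h1 h2 Ee Ee2 h3 (leqnn n).
move=> {}h1 {}h2; split => //; apply: le_trans h2 _.
rewrite mulr_sumr; apply: ler_sum => k _; rewrite ExZ; last by apply: L1_norm; exact: L1De.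
apply: ler_wpM2l => //; exact: EDs.
Qed.

Let Tn n w := \sum_(k < n) (De k w - De k.+1 w) / g k.

(** Abel summation shifts the differences from [De] to the slowly varying [1 / g]. *)
Let Tn_abel n w : Tn n w = De 0%N w / g 0%N - De n w / g n +
  \sum_(k < n) De k.+1 w * ((g k.+1)^-1 - (g k)^-1).
Proof.
elim: n => [|n IH]; first by rewrite /Tn !big_ord0 subrr addr0.
by rewrite /Tn !big_ord_recr/= -/(Tn n w) IH; ring.
Qed.

Let r k w := D (xi k w) - b * De k w.

(** One step reads [H (xi k) (Xs k) = (De k - De k.+1) / g k], and [H (xi k)] is the sum of [H xs],
    the increment [e], the linear part [b * De k] and the Taylor rest [r k]. *)
Let decomposition n w : b * (\sum_(k < n) De k w) + \sum_(k < n) H xs (Xs k w) =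
  Tn n w - Mn n w - \sum_(k < n) r k w.
Proof.
rewrite /Tn /Mn mulr_sumr -big_split -!sumrB /=; apply: eq_bigr => k _.
have -> : De k w - De k.+1 w = H (xi k w) (Xs k w) * g k.
  by rewrite /De /xi /g /H /=; ring.
by rewrite mulfK ?gt_eqF// /r /e /=; ring.
Qed.

Let L1_bsum (n : nat) (F : nat -> Om -> R) : (forall k, L1 P (F k)) ->
  L1 P (fun w => \sum_(k < n) F k w).
Proof. by move=> h; apply: L1_sum. Qed.

Lemma xi_remainder n : Ex P (fun w => `|b * (\sum_(k < n) De k w) + \sum_(k < n) H xs (Xs k w)|) <=
  s 0%N / g 0%N + s n / g n + \sum_(k < n) s k.+1 * ((g k.+1)^-1 - (g k)^-1)
  + Num.sqrt (M * \sum_(k < n) s k) + M * \sum_(k < n) q k.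
Proof.
have [LM EM] := Mn_sqr n.
have mM : measurable_fun setT (Mn n).
  apply: measurable_sum => k; exact: (measurableT_comp me (measurable_fun_pair (mxi k) (mXs k))).
have s0 k : 0 <= s k by exact: sqrtr_ge0.
have Mq : 0 <= M * \sum_(k < n) s k by rewrite mulr_ge0// sumr_ge0.
have EM1 : Ex P (fun w => `|Mn n w|) <= Num.sqrt (M * \sum_(k < n) s k).
  by apply: Ex_norm_sqrt; rewrite ?sqrtr_ge0 ?sqr_sqrtr.
have gd k : 0 <= (g k.+1)^-1 - (g k)^-1 by rewrite subr_ge0 lef_pV2 ?posrE.
have LDn k := L1_norm (L1De k).
have LM1 := L1_norm (L1_sqr_le mM LM).
pose B w := `|De 0%N w| / g 0%N + `|De n w| / g n + \sum_(k < n) `|De k.+1 w| * ((g k.+1)^-1 - (g k)^-1)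
  + `|Mn n w| + M * \sum_(k < n) De k w ^+ 2.
have Lr (k : nat) c : L1 P (fun w => `|De k w| * c).
  by under eq_fun do rewrite mulrC; exact: L1Z.
have Er (k : nat) c : Ex P (fun w => `|De k w| * c) = Ex P (fun w => `|De k w|) * c.
  by under eq_fun do rewrite mulrC; rewrite ExZ// mulrC.
have LS1 : L1 P (fun w => \sum_(k < n) `|De k.+1 w| * ((g k.+1)^-1 - (g k)^-1)).
  by apply: (L1_bsum n (F := fun k w => `|De k.+1 w| * ((g k.+1)^-1 - (g k)^-1))).
have LS2 : L1 P (fun w => \sum_(k < n) De k w ^+ 2).
  by apply: (L1_bsum n (F := fun k w => De k w ^+ 2)).
have LB12 := L1D (Lr 0%N (g 0%N)^-1) (Lr n (g n)^-1).
have LB3 := L1D LB12 LS1.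
have LB4 := L1D LB3 LM1.
have LB := L1D LB4 (L1Z M LS2).
have EB : Ex P B <= s 0%N / g 0%N + s n / g n + \sum_(k < n) s k.+1 * ((g k.+1)^-1 - (g k)^-1)
  + Num.sqrt (M * \sum_(k < n) s k) + M * \sum_(k < n) q k.
  rewrite /B (ExD LB4 (L1Z M LS2)) (ExD LB3 LM1) (ExD LB12 LS1) (ExD (Lr _ _) (Lr _ _)) (ExZ _ LS2) !Er.
  rewrite !Ex_sum//; apply: lerD; first apply: lerD => //; first apply: lerD; first apply: lerD.
  - by rewrite ler_wpM2r ?invr_ge0// ltW.
  - by rewrite ler_wpM2r ?invr_ge0// ltW.
  - by apply: ler_sum => k _; rewrite Er ler_wpM2r.
  - by rewrite ler_wpM2l// ler_sum.
apply: le_trans EB; apply: Ex_le; last first.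
- move=> w; rewrite decomposition Tn_abel /B.
  apply: le_trans (ler_normB _ _) _; apply: lerD; last first.
    apply: le_trans (ler_norm_sum _ _ _) _; rewrite mulr_sumr; apply: ler_sum => k _.
    exact: Dlin.
  apply: le_trans (ler_normB _ _) _; rewrite lerD2r.
  apply: le_trans (ler_normD _ _) _; apply: lerD; last first.
    apply: le_trans (ler_norm_sum _ _ _) _; apply: ler_sum => k _.
    by rewrite normrM (ger0_norm (gd k)).
  apply: le_trans (ler_normB _ _) _; rewrite !normrM !normfV.
  by rewrite !(gtr0_norm (g0 _)).
- exact: LB.
- apply: L1_norm; apply: L1D; first apply: L1Z.
    exact: (L1_bsum n (F := De)).
  by apply: (L1_bsum n (F := fun k w => H xs (Xs k w))) => k; exact: LH.
Qed.

End remainders.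

Section Vfun.
Context {R : realType} {d : measure_display} {Om : measurableType d} (P : probability Om R).
Variables (alpha : R) (X : Om -> R).
Hypotheses (alpha01 : 0 < alpha < 1) (LX : L1 P X).
Let a : R := (1 - alpha)^-1.
(** The Rockafellar-Uryasev integrand: its mean in [y] is [Vfun], and [H1] is a subgradient in
    [x]. *)
Definition Gfun (x y : R) : R := x + (1 - alpha)^-1 * posp (y - x).
Let a1 : 1 < a. Proof. exact: a_gt1. Qed.

Lemma posp_lip (x y : R) : `|posp x - posp y| <= `|x - y|.
Proof.
have h1 := ler_norm (x - y); have h2 := ler_norm (y - x); rewrite distrC in h2.
by rewrite ler_norml /posp; case: (leP x 0) => hx; case: (leP y 0) => hy; apply/andP; split; lra.
Qed.

Lemma Gfun_lip x x' y : `|Gfun x y - Gfun x' y| <= (1 + a) * `|x - x'|.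
Proof.
have -> : Gfun x y - Gfun x' y = (x - x') + a * (posp (y - x) - posp (y - x')).
  by rewrite /Gfun -/a; ring.
apply: le_trans (ler_normD _ _) _; rewrite mulrDl mul1r lerD2l normrM gtr0_norm ?(lt_trans _ a1)//.
rewrite ler_wpM2l//; first by rewrite ltW// (lt_trans _ a1).
apply: le_trans (posp_lip _ _) _.
have -> : y - x - (y - x') = x' - x by ring.
by rewrite distrC.
Qed.

Lemma Gfun_measurable : measurable_fun setT (fun z : R * R => Gfun z.1 z.2).
Proof. by rewrite /Gfun; meas. Qed.

Lemma L1_posp x : L1 P (fun w => posp (X w - x)).
Proof.
have mX := L1_meas LX.
apply: (@L1_le _ _ _ _ _ (fun w => `|X w - x|)); first by meas.
  by move=> w; have := posp_lip (X w - x) 0; rewrite subr0 {2}/posp maxxx subr0.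
by apply: L1_norm; apply: L1B => //; exact: L1_cst.
Qed.

Lemma L1_Gfun x : L1 P (fun w => Gfun x (X w)).
Proof. by apply: L1D; [exact: L1_cst|apply: L1Z; exact: L1_posp]. Qed.

Lemma VfunE x : Vfun P alpha X x = Ex P (fun w => Gfun x (X w)).
Proof.
have l := L1_posp x; rewrite /Gfun (ExD (L1_cst _ _) (L1Z _ l)) Ex_cst (ExZ _ l).
by rewrite /Vfun EfineE.
Qed.

Lemma Vfun_lip x x' : `|Vfun P alpha X x - Vfun P alpha X x'| <= (1 + a) * `|x - x'|.
Proof.
rewrite !VfunE -(ExB (L1_Gfun _) (L1_Gfun _)).
rewrite -[leRHS](Ex_cst P); apply: Ex_norm_le.
- by apply: L1B; exact: L1_Gfun.
- exact: L1_cst.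
- by move=> w; exact: Gfun_lip.
Qed.

End Vfun.

(** * The expected-shortfall iterate *)

Section chi.
Context {R : realType} {d : measure_display} {Om : measurableType d} (P : probability Om R).
Variables (alpha : R) (gam : nat -> R) (Xs : nat -> Om -> R) (xi0 : Om -> R) (X : Om -> R).
Hypothesis alpha01 : 0 < alpha < 1.
Hypotheses (mxi0 : measurable_fun setT xi0) (mXs : forall n, measurable_fun setT (Xs n))
  (LX : L1 P X) (lawX : forall n, same_law P (Xs n) X)
  (indX : forall N, indep_family P xi0 Xs N).
Let a : R := (1 - alpha)^-1.
Let g n := gam n.+1.
Let xi n w := (nsa alpha gam Xs xi0 n w).1.
Let chi n w := (nsa alpha gam Xs xi0 n w).2.
Let V := Vfun P alpha X.
Let G := Gfun alpha.
Variables (xs M : R) (q : nat -> R).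
Let De n w := xi n w - xs.
Hypotheses (M0 : 0 <= M) (q0 : forall n, 0 <= q n).
Hypotheses (LDe : forall n, L1 P (fun w => De n w ^+ 2))
  (EDe : forall n, Ex P (fun w => De n w ^+ 2) <= q n).
Hypotheses (Vsq : forall x, 0 <= V x - V xs <= M * (x - xs) ^+ 2).

(** The step [1 / n.+1] turns the recursion into a running mean in which the initial value has
    weight zero. *)
Lemma chi_sum n w : n%:R * chi n w = \sum_(k < n) G (xi k w) (Xs k w).
Proof.
elim: n => [|n IH]; first by rewrite big_ord0 mul0r.
rewrite big_ord_recr/= -IH /chi /= -/(chi n w) -/(xi n w) /H2 /G /Gfun.
have n0 : n.+1%:R != 0 :> R by rewrite pnatr_eq0.
rewrite mulrBr mulrA divff// mul1r -(natr1 n); ring.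
Qed.

Let a1 : 1 < a. Proof. exact: a_gt1. Qed.
Let mX : measurable_fun setT X. Proof. exact: L1_meas LX. Qed.
Let mG := Gfun_measurable alpha.
Let mV : measurable_fun setT V. Proof. exact: lipschitz_measurable (Vfun_lip alpha01 LX). Qed.
Let mGx x : measurable_fun setT (G x).
Proof. by apply: (measurableT_comp mG (g := fun y => (x, y))); apply: measurable_fun_pair. Qed.
Let mxi n : measurable_fun setT (xi n). Proof. exact: (xi_measurable alpha gam mxi0 mXs). Qed.
Let mDe n : measurable_fun setT (De n). Proof. by apply: measurable_funB. Qed.
Let Phi n (z : R * R) := z.1 - g n * H1 alpha z.1 z.2.
Let mPhi n : measurable_fun setT (Phi n).
Proof. by apply: measurable_funB => //; apply: measurable_funM => //; exact: H1_measurable. Qed.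

Let LG k x : L1 P (fun w => G x (Xs k w)).
Proof. exact: (same_law_L1 (mXs k) mX (lawX k) (mGx x) (L1_Gfun alpha LX x)). Qed.

Let EG k x : Ex P (fun w => G x (Xs k w)) = V x.
Proof. by rewrite /V VfunE//; exact: (same_law_Ex (mXs k) mX (lawX k) (mGx x) (L1_Gfun alpha LX x)). Qed.

Let e (z : R * R) := G z.1 z.2 - G xs z.2 - (V z.1 - V xs).
Let me : measurable_fun setT e.
Proof.
apply: measurable_funB; first apply: measurable_funB => //.
  exact: (measurableT_comp (mGx xs)).
by apply: measurable_funB => //; exact: (measurableT_comp mV).
Qed.

Let e_bound z : `|e z| <= 2 * (1 + a) * `|z.1 - xs|.
Proof.
apply: le_trans (ler_normB _ _) _.
have := Gfun_lip alpha01 z.1 xs z.2; have := Vfun_lip alpha01 LX z.1 xs; rewrite -/a -/V -/G; lra.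
Qed.

Let e_sqr_bound z : `|e z ^+ 2| <= (2 * (1 + a)) ^+ 2 * (z.1 - xs) ^+ 2.
Proof.
rewrite normrX -(real_normK (num_real (z.1 - xs))) -exprMn ler_pXn2r ?nnegrE ?normr_ge0//.
by rewrite !mulr_ge0// addr_ge0// ltW// (lt_trans _ a1).
Qed.

Let Le k : L1 P (fun w => e (xi k w, Xs k w) ^+ 2).
Proof.
apply: (@L1_le _ _ _ _ _ (fun w => (2 * (1 + a)) ^+ 2 * De k w ^+ 2)).
- by apply: measurable_funX; apply: (measurableT_comp me); apply: measurable_fun_pair.
- by move=> w; exact: e_sqr_bound.
- exact: L1Z.
Qed.

Let Les k x : L1 P (fun w => e (x, Xs k w) ^+ 2).
Proof.
apply: (@L1_bounded _ _ _ _ _ ((2 * (1 + a)) ^+ 2 * (x - xs) ^+ 2)).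
- by apply: measurable_funX; apply: (measurableT_comp me); apply: measurable_fun_pair.
- by move=> w; exact: e_sqr_bound.
Qed.

Let Ee k x : Ex P (fun w => e (x, Xs k w)) = 0.
Proof.
rewrite /e /= (ExB (L1B (LG k x) (LG k xs)) (L1_cst _ _)) (ExB (LG k x) (LG k xs)) Ex_cst !EG.
by rewrite subrr.
Qed.

(** In contrast to [H1], the integrand [G] is Lipschitz in its first argument, so the variance is of
    the order of the squared distance; subtracting the mean can only lower the second moment. *)
Let Ee2 k x : Ex P (fun w => e (x, Xs k w) ^+ 2) <= (1 + a) ^+ 2 * (x - xs) ^+ 2.
Proof.
have lD := L1B (LG k x) (LG k xs).
have bd w : (G x (Xs k w) - G xs (Xs k w)) ^+ 2 <= (1 + a) ^+ 2 * (x - xs) ^+ 2.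
  rewrite -[leLHS](real_normK (num_real _)) -(real_normK (num_real (x - xs))) -exprMn ler_pXn2r ?nnegrE ?normr_ge0//.
    exact: Gfun_lip.
  by rewrite !mulr_ge0// addr_ge0// ltW// (lt_trans _ a1).
have lF : L1 P (fun w => (G x (Xs k w) - G xs (Xs k w)) ^+ 2).
  apply: (@L1_bounded _ _ _ _ _ ((1 + a) ^+ 2 * (x - xs) ^+ 2)).
    by apply: measurable_funX; apply: measurable_funB; apply: measurableT_comp.
  by move=> w; rewrite ger0_norm ?sqr_ge0//.
set dv := V x - V xs.
have -> : (fun w => e (x, Xs k w) ^+ 2) = (fun w => (G x (Xs k w) - G xs (Xs k w)) ^+ 2 +
    ((- 2 * dv) * (G x (Xs k w) - G xs (Xs k w)) + dv ^+ 2)).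
  by apply/funext => w; rewrite /e /= -/dv; ring.
have lZ := L1Z (- 2 * dv) lD; have lc := L1_cst P (dv ^+ 2).
rewrite (ExD lF (L1D lZ lc)) (ExD lZ lc) (ExZ _ lD) (ExB (LG k x) (LG k xs)) Ex_cst !EG -/dv.
have h : Ex P (fun w => (G x (Xs k w) - G xs (Xs k w)) ^+ 2) <= (1 + a) ^+ 2 * (x - xs) ^+ 2.
  by rewrite -[leRHS](Ex_cst P); apply: Ex_le => //; exact: L1_cst.
apply: le_trans h; rewrite gerDl.
by have := sqr_ge0 dv; nra.
Qed.

Lemma chi_remainder n : Ex P (fun w => `|n%:R * chi n w - n%:R * V xs - \sum_(k < n) (G xs (Xs k w) - V xs)|) <=
  M * \sum_(k < n) q k + Num.sqrt ((1 + a) ^+ 2 * \sum_(k < n) q k).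
Proof.
have mv : measurable_fun setT (fun x : R => (1 + a) ^+ 2 * (x - xs) ^+ 2).
  by apply: measurable_funM => //; apply: measurable_funX; apply: measurable_funB.
have h3 k : L1 P (fun w => (1 + a) ^+ 2 * (xi k w - xs) ^+ 2) by apply: L1Z; exact: LDe.
have [LM EM] := martingale_sqr mxi0 mXs (@measurable_id _ _ setT) mPhi (S := xi)
  (fun=> erefl) (fun _ _ => erefl) (indX n) me mv Le Les Ee Ee2 h3 (leqnn n).
set Mn := (fun w => \sum_(k < n) e (xi k w, Xs k w)) in LM EM.
have mM : measurable_fun setT Mn.
  apply: measurable_sum => k; exact: (measurableT_comp me (measurable_fun_pair (mxi k) (mXs k))).
have qs : 0 <= (1 + a) ^+ 2 * \sum_(k < n) q k by rewrite mulr_ge0 ?sqr_ge0// sumr_ge0.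
have EM1 : Ex P (fun w => `|Mn w|) <= Num.sqrt ((1 + a) ^+ 2 * \sum_(k < n) q k).
  apply: Ex_norm_sqrt; rewrite ?sqrtr_ge0 ?sqr_sqrtr//.
  apply: le_trans EM _; rewrite mulr_sumr; apply: ler_sum => k _.
  by rewrite (ExZ _ (LDe k)) ler_wpM2l ?sqr_ge0.
have LM1 := L1_norm (L1_sqr_le mM LM).
have LS2 : L1 P (fun w => \sum_(k < n) De k w ^+ 2).
  by apply: (@L1_sum _ _ _ P _ _ (fun k : 'I_n => fun w => De k w ^+ 2)).
have ES2 : Ex P (fun w => M * (\sum_(k < n) De k w ^+ 2) + `|Mn w|) <=
    M * \sum_(k < n) q k + Num.sqrt ((1 + a) ^+ 2 * \sum_(k < n) q k).
  rewrite (ExD (L1Z M LS2) LM1) (ExZ _ LS2); apply: lerD => //.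
  by rewrite ler_wpM2l// Ex_sum// ler_sum.
apply: le_trans ES2; apply: Ex_le.
- have -> : (fun w => `|n%:R * chi n w - n%:R * V xs - \sum_(k < n) (G xs (Xs k w) - V xs)|) =
     (fun w => `|\sum_(k < n) (G (xi k w) (Xs k w)) - n%:R * V xs - \sum_(k < n) (G xs (Xs k w) - V xs)|).
    by apply/funext => w; rewrite chi_sum.
  apply: L1_norm; apply: L1B; first apply: L1B; last 1 first.
  + apply: (@L1_sum _ _ _ P _ _ (fun k : 'I_n => fun w => G xs (Xs k w) - V xs)) => k.
    by apply: L1B; [exact: LG|exact: L1_cst].
  + apply: (@L1_sum _ _ _ P _ _ (fun k : 'I_n => fun w => G (xi k w) (Xs k w))) => k.
    have l := L1D (L1D (L1_sqr_le _ (Le k)) (LG k xs)) (L1_cst P (- V xs)).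
    apply: (@L1_le _ _ _ _ _ (fun w => `|G xs (Xs k w)| + (1 + a) * `|De k w|)).
    * exact: (measurableT_comp mG (measurable_fun_pair (mxi k) (mXs k))).
    * move=> w; have := Gfun_lip alpha01 (xi k w) xs (Xs k w) => h.
      rewrite -[G (xi k w) _](subrK (G xs (Xs k w))) addrC (le_trans (ler_normD _ _))// lerD2l.
      exact: h.
    * by apply: L1D; [apply: L1_norm; exact: LG|apply: L1Z; apply: L1_norm; exact: L1_sqr_le].
  + exact: L1_cst.
- exact: (L1D (L1Z M LS2) LM1).
- move=> w.
  have -> : n%:R * chi n w - n%:R * V xs - \sum_(k < n) (G xs (Xs k w) - V xs) =
      \sum_(k < n) (V (xi k w) - V xs) + Mn w.
    rewrite chi_sum /Mn -big_split/= -[n%:R * V xs](_ : \sum_(k < n) V xs = _); last first.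
      by rewrite sumr_const card_ord mulr_natl.
    by rewrite -!sumrB; apply: eq_bigr => k _; rewrite /e /=; ring.
  apply: le_trans (ler_normD _ _) _; rewrite lerD2r.
  apply: le_trans (ler_norm_sum _ _ _) _; rewrite mulr_sumr; apply: ler_sum => k _.
  by have /andP[v0 v1] := Vsq (xi k w); rewrite ger0_norm.
Qed.

End chi.

(** * Smoothness of the mean field *)

Section pdf.
Context {R : realType} {d : measure_display} {Om : measurableType d} (P : probability Om R).
Notation leb := (@lebesgue_measure R).
Variables (alpha : R) (X : Om -> R) (f : R -> R) (M : R).
Hypotheses (alpha01 : 0 < alpha < 1) (LX : L1 P X) (pdfX : is_pdf P X f)
  (f0 : forall x, 0 <= f x) (fM : forall x, f x <= M) (flip : forall x y, `|f x - f y| <= M * `|x - y|).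
Let a : R := (1 - alpha)^-1.
Let D := meanH P alpha X.
Let H := H1 alpha.
Let mX : measurable_fun setT X. Proof. exact: L1_meas LX. Qed.
Let a1 : 1 < a. Proof. exact: a_gt1. Qed.
Let a0 : 0 < a. Proof. by apply: lt_trans a1. Qed.

Lemma lipschitz_pdf_measurable : measurable_fun setT f.
Proof.
apply: continuous_measurable_fun => x; apply/cvgrPdist_le => e e0.
have M1p : 0 < `|M| + 1 by rewrite ltr_wpDl.
have e1 : 0 < e / (`|M| + 1) by rewrite divr_gt0.
near=> y; apply: le_trans (flip x y) _.
apply: (@le_trans _ _ ((`|M| + 1) * `|x - y|)).
  by rewrite ler_wpM2r//; have := ler_norm M; lra.
rewrite mulrC -ler_pdivlMr//.
Unshelve. all: by end_near. Qed.

Let M0 : 0 <= M. Proof. exact: le_trans (f0 0) (fM 0). Qed.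

(** Half-open to match the test [xi <= x] in [H1]: the difference of [H1] at [y] and at [x] is then
    exactly [a * I x y]. *)
Let I (x y : R) w : R := if (x <= X w) && (X w < y) then 1 else 0.

Let mI x y : measurable_fun setT (I x y).
Proof.
apply: measurable_fun_ifT => //; apply: measurable_and; first exact: measurable_fun_ler.
exact: measurable_fun_ltr.
Qed.

Let LI x y : L1 P (I x y).
Proof.
by apply: (@L1_bounded _ _ _ _ _ 1) => // w; rewrite /I; case: ifP => _; rewrite ?normr1 ?normr0.
Qed.

Let EI x y : (Ex P (I x y))%:E = (\int[leb]_(u in `[x, y[) (f u)%:E)%E.
Proof.
rewrite -pdfX; last exact: measurable_itv.
rewrite (ExE (LI x y)) (_ : (fun w => (I x y w)%:E) = EFin \o \1_(X @^-1` `[x, y[)).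
  rewrite integral_indic ?setIT//; first by rewrite -[_ @^-1` _]setTI; apply: mX => //; exact: measurable_itv.
apply/funext => w; rewrite /I /= indicE; case: ifP => h; congr (_%:E).
  by rewrite mem_set//= in_itv.
by rewrite memNset//= in_itv/= h.
Qed.

Let leb_itv x y : x <= y -> leb (`[x, y[ : set R) = (y - x)%:E.
Proof.
rewrite le_eqVlt => /predU1P[->|xy]; rewrite lebesgue_measure_itv /= lte_fin ?ltxx ?subrr//.
by rewrite xy EFinB.
Qed.

Lemma pdf_upper x y B : x <= y -> 0 <= B -> (forall u, x <= u < y -> f u <= B) ->
  Ex P (I x y) <= B * (y - x).
Proof.
move=> xy B0 h; rewrite -lee_fin EI.
have mf := lipschitz_pdf_measurable.
apply: (@le_trans _ _ (\int[leb]_(u in `[x, y[) cst B%:E u)%E).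
  apply: ge0_le_integral; try (by []); try exact: measurable_cst;
    try (by apply/measurable_EFinP; exact: measurable_funTS);
    by move=> u /=; rewrite in_itv /= => hu; rewrite lee_fin; first [exact: f0|exact: h|exact: m0|exact: B0].
by rewrite integral_cst//= leb_itv.
Qed.

Lemma pdf_lower x y m : x <= y -> (forall u, x <= u < y -> m <= f u) ->
  m * (y - x) <= Ex P (I x y).
Proof.
move=> xy h; case: (lerP 0 m) => m0; last first.
  apply: (@le_trans _ _ 0); first by rewrite nmulr_rle0// subr_ge0.
  by apply: Ex_ge0 => w; rewrite /I; case: ifP.
rewrite -lee_fin EI.
have mf := lipschitz_pdf_measurable.
apply: (@le_trans _ _ (\int[leb]_(u in `[x, y[) cst m%:E u)%E).
  by rewrite integral_cst//= leb_itv.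
apply: ge0_le_integral; try (by []); try exact: measurable_cst;
    try (by apply/measurable_EFinP; exact: measurable_funTS);
    by move=> u /=; rewrite in_itv /= => hu; rewrite lee_fin; first [exact: f0|exact: h|exact: m0|exact: B0].
Qed.

Let HI x y w : x <= y -> H y (X w) - H x (X w) = a * I x y w.
Proof.
move=> xy; rewrite /H /H1 /I -/a.
case: (leP x (X w)) => h1; case: (leP y (X w)) => h2 /=; rewrite ?mulr1 ?mulr0; try lra.
Qed.

Let LH x : L1 P (fun w => H x (X w)).
Proof.
apply: (@L1_bounded _ _ _ _ _ a); last by move=> w; exact: H1_bound.
by apply: (measurableT_comp (H1_measurable alpha) (g := fun w => (x, X w))); apply: measurable_fun_pair.
Qed.

Lemma meanH_diff x y : x <= y -> D y - D x = a * Ex P (I x y).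
Proof.
move=> xy; rewrite /D /meanH -(ExB (LH y) (LH x)) -(ExZ _ (LI x y)).
by congr (Ex _); apply/funext => w; rewrite -HI.
Qed.

Lemma meanH_lip x y : `|D x - D y| <= a * M * `|x - y|.
Proof.
wlog xy : x y / y <= x.
  by move=> h; case: (leP y x) => [/h //|/ltW/h]; rewrite distrC (distrC y).
rewrite meanH_diff// (ger0_norm (x := x - y)) ?subr_ge0// ger0_norm -?mulrA ?ler_pM2l//.
  by apply: pdf_upper.
by rewrite mulr_ge0 ?(ltW a0)//; apply: Ex_ge0 => w; rewrite /I; case: ifP.
Qed.

Lemma meanH_var x y : Ex P (fun w => (H x (X w) - H y (X w)) ^+ 2) <= a ^+ 2 * M * `|x - y|.
Proof.
wlog xy : x y / y <= x.
  move=> h; case: (leP y x) => [/h //|/ltW/h]; rewrite (distrC y) => {}h.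
  by rewrite (_ : (fun w => _) = (fun w => (H y (X w) - H x (X w)) ^+ 2))//; apply/funext => w; rewrite -sqrrN opprB.
have -> : (fun w => (H x (X w) - H y (X w)) ^+ 2) = (fun w => a ^+ 2 * I y x w).
  apply/funext => w; rewrite HI// exprMn; congr (_ * _).
  by rewrite /I; case: ifP => _; rewrite ?expr1n ?expr0n.
rewrite (ExZ _ (LI y x)) (ger0_norm (x := x - y)) ?subr_ge0// -mulrA ler_wpM2l ?sqr_ge0//.
exact: pdf_upper.
Qed.

Lemma Gfun_subgrad x y u : Gfun alpha x u - Gfun alpha y u <= (x - y) * H x u.
Proof.
rewrite /Gfun /H /H1 -/a /posp.
have -> : x + a * Num.max (u - x) 0 - (y + a * Num.max (u - y) 0) =
  (x - y) - a * (Num.max (u - y) 0 - Num.max (u - x) 0) by ring.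
rewrite [(x - y) * (1 - _)]mulrBr mulr1 lerD2l lerN2 mulrCA ler_pM2l//.
case: (leP x u) => hx; rewrite ?mulr1 ?mulr0; case: (leP (u - x) 0) => h1; case: (leP (u - y) 0) => h2; lra.
Qed.

(** The mean of a pointwise subgradient inequality; convexity thus gives all that is used of [D] as
    a derivative of [Vfun], without differentiating it. *)
Lemma Vfun_diff x y : Vfun P alpha X x - Vfun P alpha X y <= (x - y) * D x.
Proof.
rewrite !VfunE// -(ExB (L1_Gfun _ LX _) (L1_Gfun _ LX _)) -(ExZ _ (LH x)).
apply: Ex_le; [by apply: L1B; exact: L1_Gfun|exact: (L1Z _ (LH x))|].
by move=> w; exact: Gfun_subgrad.
Qed.

Section minimizer.
Variable xs : R.
Hypothesis hxs : is_minimizer (Vfun P alpha X) xs.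

(* The subgradient inequality gives [D] the sign of [x - xs]; [D] being continuous, it vanishes at [xs]. *)
Lemma meanH_min0 : D xs = 0.
Proof.
have aM0 : 0 <= a * M by rewrite mulr_ge0// ltW.
have s x : 0 <= (x - xs) * D x.
  by apply: le_trans (Vfun_diff x xs); rewrite subr_ge0.
apply/eqP; rewrite -normr_le0; apply/ler_addgt0Pr => e e0; rewrite add0r.
pose t := e / (a * M + 1).
have t0 : 0 < t by rewrite divr_gt0// ltr_wpDl.
have tE : a * M * t <= e by rewrite /t mulrA ler_pdivrMr ?ltr_wpDl//; lra.
have h1 : - (a * M * t) <= D xs.
  have := s (xs + t); rewrite addrAC subrr add0r pmulr_rge0// => h.
  have := meanH_lip (xs + t) xs; rewrite addrAC subrr add0r (gtr0_norm t0) ler_norml => /andP[_]; lra.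
have h2 : D xs <= a * M * t.
  have := s (xs - t); rewrite addrAC subrr add0r nmulr_rge0 ?oppr_lt0// => h.
  have := meanH_lip xs (xs - t); rewrite opprB addrCA subrr addr0 (gtr0_norm t0) ler_norml => /andP[_]; lra.
by rewrite ler_norml; apply/andP; split; lra.
Qed.

(** Between [xs] and [x] the density differs from [f xs] by at most [M] times the length of the
    interval; integration yields the square. *)
Lemma meanH_lin x : `|D x - a * f xs * (x - xs)| <= a * M * (x - xs) ^+ 2.
Proof.
have D0 := meanH_min0.
have Mn : 0 <= M * `|x - xs| by rewrite mulr_ge0.
have key y z : z <= y -> (z = xs \/ y = xs) ->
    `|D y - D z - a * f xs * (y - z)| <= a * M * (y - z) ^+ 2.
  move=> zy hz; rewrite meanH_diff// -mulrA -mulrBr normrM (gtr0_norm a0) -[leRHS]mulrA ler_pM2l//.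
  have fl u : z <= u < y -> f xs - M * (y - z) <= f u <= f xs + M * (y - z).
    move=> /andP[u1 u2]; have := flip u xs.
    have : M * `|u - xs| <= M * (y - z).
      by rewrite ler_wpM2l// ler_norml; case: hz => <-; apply/andP; split; lra.
    by move=> h1 h2; have := le_trans h2 h1; rewrite ler_norml => /andP[]; lra.
  have p1 : Ex P (I z y) <= (f xs + M * (y - z)) * (y - z).
    apply: pdf_upper => //; first by rewrite addr_ge0// mulr_ge0// subr_ge0.
    by move=> u /fl /andP[].
  have p2 : (f xs - M * (y - z)) * (y - z) <= Ex P (I z y).
    by apply: pdf_lower => // u /fl /andP[].
  by rewrite ler_norml; apply/andP; split; lra.
case: (leP xs x) => hx.
  by have := key _ _ hx (or_introl erefl); rewrite D0 subr0.
have := key _ _ (ltW hx) (or_intror erefl); rewrite D0 sub0r -normrN.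
have -> : - (- D x - a * f xs * (xs - x)) = D x - a * f xs * (x - xs) by ring.
by rewrite -sqrrN opprB.
Qed.

(** The subgradient is taken at [x] rather than at [xs]; since [D xs = 0], the Lipschitz bound on
    [D] supplies the second factor [|x - xs|]. *)
Lemma Vfun_sqr x : 0 <= Vfun P alpha X x - Vfun P alpha X xs <= a * M * (x - xs) ^+ 2.
Proof.
rewrite subr_ge0 hxs /=; apply: le_trans (Vfun_diff x xs) _.
apply: le_trans (ler_norm _) _; rewrite normrM.
have := meanH_lip x xs; rewrite meanH_min0 subr0 => h.
apply: le_trans (ler_wpM2l (normr_ge0 _) h) _.
by rewrite mulrCA -expr2 real_normK ?num_real.
Qed.

Variable c : R.
Hypotheses (c0 : 0 <= c) (fc : forall u, `|u - xs| <= 1 -> c <= f u).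

Lemma meanH_mono x y : x <= y -> D x <= D y.
Proof.
move=> xy; rewrite -subr_ge0 meanH_diff// mulr_ge0 ?(ltW a0)//.
by apply: Ex_ge0 => w; rewrite /I; case: ifP.
Qed.

(** The density is at least [c] only within distance 1 of [xs]; farther away, monotonicity of [D]
    keeps the value reached there. *)
Lemma meanH_drift_r x : xs <= x -> a * c * Num.min 1 (x - xs) <= D x.
Proof.
move=> hx; set m := Num.min 1 (x - xs).
have m0 : 0 <= m by rewrite le_min ler01 subr_ge0.
have mx : xs + m <= x by rewrite addrC -lerBrDr ge_min lexx orbT.
have m1 : m <= 1 by rewrite ge_min lexx.
apply: le_trans (meanH_mono mx).
have xm : xs <= xs + m by rewrite lerDl.
have := meanH_diff xm; rewrite meanH_min0 subr0 => ->.
have h : c * (xs + m - xs) <= Ex P (I xs (xs + m)).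
  apply: pdf_lower => // u /andP[u1 u2].
  by apply: fc; rewrite ler_norml; apply/andP; split; lra.
by rewrite -mulrA ler_pM2l//; move: h; rewrite addrAC subrr add0r.
Qed.

Lemma meanH_drift_l x : x <= xs -> a * c * Num.min 1 (xs - x) <= - D x.
Proof.
move=> hx; set m := Num.min 1 (xs - x).
have m0 : 0 <= m by rewrite le_min ler01 subr_ge0.
have mx : x <= xs - m by rewrite lerBrDr addrC -lerBrDr ge_min lexx orbT.
have m1 : m <= 1 by rewrite ge_min lexx.
have := meanH_mono mx; rewrite -lerN2; apply: le_trans.
have xm : xs - m <= xs by rewrite gerBl.
have := meanH_diff xm; rewrite meanH_min0 sub0r => ->.
have h : c * (xs - (xs - m)) <= Ex P (I (xs - m) xs).
  apply: pdf_lower => // u /andP[u1 u2].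
  by apply: fc; rewrite ler_norml; apply/andP; split; lra.
by rewrite -mulrA ler_pM2l//; move: h; rewrite opprB addrCA subrr addr0.
Qed.

End minimizer.
End pdf.

(** * Limits as the bias parameter vanishes *)

Section pdf_Ex.
Context {R : realType} {d : measure_display} {Om : measurableType d} (P : probability Om R).
Notation leb := (@lebesgue_measure R).
Variables (X : Om -> R) (f : R -> R).
Hypotheses (mX : measurable_fun setT X) (pdfX : is_pdf P X f)
  (f0 : forall x, 0 <= f x) (mf : measurable_fun setT f).

Let mX' : measurable_fun setT (X : Om -> measurableTypeR R). Proof. exact: mX. Qed.
Let X_ : {mfun Om >-> measurableTypeR R} := HB.pack (X : Om -> measurableTypeR R)
  (isMeasurableFun.Build _ _ _ _ (X : Om -> measurableTypeR R) mX').
Let mf' : measurable_fun setT (f : measurableTypeR R -> R). Proof. exact: mf. Qed.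
Let nuE (B : set (measurableTypeR R)) : measurable B ->
  distribution P X_ B = (\int[leb]_(x in B) (f x)%:E)%E.
Proof. by move=> mB; rewrite -pdfX. Qed.

Variable h : R -> R.
Hypotheses (mh : measurable_fun setT h) (Lh : L1 P (fun w => h (X w))).
Let mh' : measurable_fun setT (h : measurableTypeR R -> R). Proof. exact: mh. Qed.

Let L1nu : L1 (distribution P X_) h.
Proof. by apply: (integrable_pushforward (phi := X_)) => //; exact/measurable_EFinP. Qed.

Lemma pdf_integrable : leb.-integrable setT (EFin \o (fun x => h x * f x)).
Proof. exact: (density_L1 mf' f0 nuE L1nu). Qed.

Lemma pdf_Ex : Ex P (fun w => h (X w)) = \int[leb]_x (h x * f x).
Proof.
rewrite -(Ex_density mf' f0 nuE L1nu); congr fine.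
have mhE : measurable_fun setT (EFin \o (h : measurableTypeR R -> R)) by exact/measurable_EFinP.
by rewrite integral_distribution.
Qed.

End pdf_Ex.

Lemma tailsq_decr {R : realType} (r s x : R) : r <= s -> tailsq s x <= tailsq r x.
Proof.
move=> rs; rewrite /tailsq; case: ifP => h1; case: ifP => h2 //; first exact: sqr_ge0.
by rewrite (le_trans h2 rs) in h1.
Qed.

Section moments.
Context {R : realType} {d : measure_display} {Om : measurableType d} (P : probability Om R).
Notation leb := (@lebesgue_measure R).
Variables (X : nat -> Om -> R) (Y : Om -> R) (f : nat -> R -> R) (f0 : R -> R) (K0 : nat).
Hypotheses (mX : forall K, (K0 <= K)%N -> measurable_fun setT (X K)) (mY : measurable_fun setT Y)
  (pdfX : forall K, (K0 <= K)%N -> is_pdf P (X K) (f K)) (pdfY : is_pdf P Y f0)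
  (fge0 : forall K, (K0 <= K)%N -> forall x, 0 <= f K x) (f0ge0 : forall x, 0 <= f0 x)
  (mf : forall K, (K0 <= K)%N -> measurable_fun setT (f K)) (mf0 : measurable_fun setT f0)
  (fcvg : forall r e : R, 0 < r -> 0 < e ->
     \forall K \near \oo, forall x, `|x| <= r -> `|f K x - f0 x| <= e).

(** The two expectations differ by at most [2 r' B] times the uniform distance of the densities on
    [[-r', r']]. *)
Lemma bounded_support_cvg (h : R -> R) (B r : R) : measurable_fun setT h ->
  (forall x, `|h x| <= B) -> (forall x, r < `|x| -> h x = 0) ->
  (fun K => Ex P (fun w => h (X K w))) @ \oo --> Ex P (fun w => h (Y w)).
Proof.
move=> mh hB hr.
have B0 : 0 <= B by apply: le_trans (hB 0).
pose r' := Num.max r 1; have r'0 : 0 < r' by rewrite lt_max ltr01 orbT.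
have hr' x : r' < `|x| -> h x = 0 by move=> h1; apply: hr; apply: le_lt_trans h1; rewrite le_max lexx.
apply/cvgrPdist_le => e e0.
have B1 : 0 < 2 * r' * (B + 1) by rewrite mulr_gt0 ?mulr_gt0// ltr_wpDl.
pose e' := e / (2 * r' * (B + 1)); have e'0 : 0 < e' by rewrite divr_gt0.
near=> K.
have kK : (K0 <= K)%N by near: K; exact: nbhs_infty_ge.
have fK : forall x, `|x| <= r' -> `|f K x - f0 x| <= e' by near: K; exact: fcvg.
have LhX : L1 P (fun w => h (X K w)).
  by apply: (@L1_bounded _ _ _ _ _ B) => //; exact: (measurableT_comp mh (mX kK)).
have LhY : L1 P (fun w => h (Y w)).
  by apply: (@L1_bounded _ _ _ _ _ B) => //; exact: (measurableT_comp mh mY).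
rewrite (pdf_Ex (mX kK) (pdfX kK) (fge0 kK) (mf kK) mh LhX) (pdf_Ex mY pdfY f0ge0 mf0 mh LhY).
have iX := pdf_integrable (mX kK) (pdfX kK) (fge0 kK) (mf kK) mh LhX.
have iY := pdf_integrable mY pdfY f0ge0 mf0 mh LhY.
have mh' : measurable_fun setT (h : measurableTypeR R -> R) by exact: mh.
have mfK' : measurable_fun setT (f K : measurableTypeR R -> R) by exact: (mf kK).
have mf0' : measurable_fun setT (f0 : measurableTypeR R -> R) by exact: mf0.
rewrite -RintegralB//.
pose G := (fun x : R => B * e' * \1_(`[- r', r'] : set R) x).
have i1 := integrable_indic_itv (- r') r' true false.
have iG : leb.-integrable setT (EFin \o G) by exact: (integrableZl measurableT (B * e') i1).
have m2 : leb (`[- r', r'] : set R) = (2 * r')%:E.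
  by rewrite lebesgue_measure_itv /= lte_fin ifT ?gtrN// -EFinB; congr (_%:E); ring.
have EG : \int[leb]_x G x = B * e' * (2 * r').
  rewrite RintegralZl//; congr (_ * _); rewrite /Rintegral integral_indic// setIT.
  exact: (congr1 fine m2).
have iD := integrableB measurableT iY iX.
apply: le_trans (le_normr_Rintegral measurableT iD) _.
apply: (@le_trans _ _ (\int[leb]_x G x)); last first.
  rewrite EG (_ : B * e' * (2 * r') = e * (B / (B + 1))); last first.
    by rewrite /e'; field; rewrite !gt_eqF//= ltr_wpDl.
  by rewrite ler_piMr ?(ltW e0)// ler_pdivrMr ?ltr_wpDl// mul1r lerDl.
apply: le_Rintegral => //; first exact: (integrable_norm iD).
move=> x _; rewrite /G indicE; case: (leP `|x| r') => xr.
  rewrite mem_set ?mulr1; last by rewrite /= in_itv /= -ler_norml.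
  by rewrite -mulrBr normrM distrC; apply: ler_pM => //; exact: fK.
by rewrite hr'// !mul0r subrr normr0 mulr_ge0 ?ler0n// mulr_ge0// ltW.
Unshelve. all: by end_near. Qed.

Hypothesis UI : forall e, 0 < e -> exists2 r, 0 <= r & forall K, (K0 <= K)%N ->
  Ex P (fun w => tailsq r (X K w)) <= e.
Hypothesis LX2 : forall K, (K0 <= K)%N -> L1 P (fun w => X K w ^+ 2).

Lemma truncated_L1 (Z : Om -> R) (g : R -> R) (C : R) : measurable_fun setT Z -> measurable_fun setT g ->
  (forall x, 0 <= g x) ->
  (forall n : nat, L1 P (fun w => if `|Z w| <= n%:R then g (Z w) else 0)) ->
  (forall n : nat, Ex P (fun w => if `|Z w| <= n%:R then g (Z w) else 0) <= C) ->
  L1 P (fun w => g (Z w)) /\ Ex P (fun w => g (Z w)) <= C.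
Proof.
move=> mZ mg g0 Lg Eg.
pose u n w := if `|Z w| <= n%:R then g (Z w) else 0.
have mu' n : measurable_fun setT (u n) by exact: L1_meas (Lg n).
have mgZ : measurable_fun setT (fun w => g (Z w)) by exact: (measurableT_comp mg mZ).
have u0 n w : 0 <= u n w by rewrite /u; case: ifP.
have key : (\int[P]_w (g (Z w))%:E <= C%:E)%E.
  have e : (fun w => (g (Z w))%:E) = (fun w => limn (fun n => (u n w)%:E)).
    apply/funext => w; apply/esym/cvg_lim => //; apply: cvg_near_cst; near=> n.
    by rewrite /u ifT//; near: n; exact: nbhs_infty_ger.
  rewrite e monotone_convergence//.
  - apply: lime_le; last first.
      apply: nearW => n; rewrite -(ExE (Lg n)) lee_fin; exact: Eg.
    apply: ereal_nondecreasing_is_cvgn => m n mn.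
    apply: ge0_le_integral => //; try (by move=> w _; rewrite lee_fin); try exact/measurable_EFinP.
    move=> w _; rewrite lee_fin /u; case: ifP => h; last by case: ifP.
    by rewrite ifT// (le_trans h)// ler_nat.
  - by move=> n; exact/measurable_EFinP.
  - by move=> n w _; rewrite lee_fin.
  - move=> w _ m n mn; rewrite lee_fin /u; case: ifP => h; last by case: ifP.
    by rewrite ifT// (le_trans h)// ler_nat.
have L : L1 P (fun w => g (Z w)).
  by apply: L1_ge0_lty => //; apply: le_lt_trans key _; rewrite ltry.
by split => //; rewrite -lee_fin ExE.
Unshelve. all: by end_near. Qed.

Lemma tailsq_ge0 (r u : R) : 0 <= tailsq r u.
Proof. by rewrite /tailsq; case: ifP => _ //; exact: sqr_ge0. Qed.

Lemma tailsq_le (r u : R) : tailsq r u <= u ^+ 2.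
Proof. by rewrite /tailsq; case: ifP => _ //; exact: sqr_ge0. Qed.

Let mtail r : measurable_fun setT (tailsq r : R -> R). Proof. exact: measurable_tailsq. Qed.

Let LtX r K : (K0 <= K)%N -> L1 P (fun w => tailsq r (X K w)).
Proof.
move=> kK; apply: (@L1_le _ _ _ _ _ (fun w => X K w ^+ 2)); last exact: LX2.
  exact: (measurableT_comp (mtail r) (mX kK)).
by move=> w; rewrite ger0_norm ?tailsq_ge0 ?tailsq_le.
Qed.

(** A Fatou argument: the cut-offs of [tailsq r] at [n] have bounded support, so their means
    converge in [K] and keep the bound; monotone convergence then removes the cut-off. Square
    integrability of the limit [Y] is a consequence. *)
Lemma tail_limit r C : 0 <= r -> (forall K, (K0 <= K)%N -> Ex P (fun w => tailsq r (X K w)) <= C) ->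
  L1 P (fun w => tailsq r (Y w)) /\ Ex P (fun w => tailsq r (Y w)) <= C.
Proof.
move=> r0 hC.
pose h (n : nat) (x : R) := if `|x| <= n%:R then tailsq r x else 0.
have mh n : measurable_fun setT (h n).
  by rewrite /h; apply: measurable_fun_ifT => //; apply: measurable_fun_ler => //; exact: normr_measurable.
have hb n x : `|h n x| <= n%:R ^+ 2.
  rewrite /h; case: ifP => hx; last by rewrite normr0 sqr_ge0.
  rewrite ger0_norm ?tailsq_ge0// (le_trans (tailsq_le _ _))//.
  by rewrite -(real_normK (num_real x)) ler_pXn2r ?nnegrE.
have hs n x : n%:R < `|x| -> h n x = 0 by rewrite /h ltNge; case: ifP.
have Lh n Z : measurable_fun setT Z -> L1 P (fun w => h n (Z w)).
  by move=> mZ; apply: (@L1_bounded _ _ _ _ _ (n%:R ^+ 2)) => //; exact: (measurableT_comp (mh n) mZ).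
apply: (truncated_L1 mY (mtail r)) => [x|n|n]; [exact: tailsq_ge0|exact: (Lh n Y mY)|].
have c := bounded_support_cvg (mh n) (hb n) (hs n).
apply: (cvgr_to_le c).
near=> K.
have kK : (K0 <= K)%N by near: K; exact: nbhs_infty_ge.
apply: le_trans (hC _ kK); apply: Ex_le; [exact: (Lh n _ (mX kK))|exact: LtX|].
by move=> w; rewrite /h; case: ifP => // _; exact: tailsq_ge0.
Unshelve. all: by end_near. Qed.

Lemma limit_L2 : L1 P (fun w => Y w ^+ 2).
Proof.
have [r r0 Hr] := UI ltr01.
have [L _] := tail_limit r0 Hr.
apply: (@L1_le _ _ _ _ _ (fun w => r ^+ 2 + tailsq r (Y w))).
- exact: measurable_funX.
- move=> w; rewrite ger0_norm ?sqr_ge0// /tailsq; case: ifP => h; last by rewrite lerDr sqr_ge0.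
  by rewrite addr0 -(real_normK (num_real (Y w))) ler_pXn2r ?nnegrE.
- by apply: L1D => //; exact: L1_cst.
Qed.

Lemma quadratic_cvg (g : R -> R) (B : R) : measurable_fun setT g -> 0 <= B ->
  (forall x, `|g x| <= B * (1 + x ^+ 2)) ->
  (fun K => Ex P (fun w => g (X K w))) @ \oo --> Ex P (fun w => g (Y w)).
Proof.
move=> mg B0 gB; apply/cvgrPdist_le => e e0.
have B1 : 0 < 6 * (B + 1) by rewrite mulr_gt0// ltr_wpDl.
have e1 : 0 < e / (6 * (B + 1)) by rewrite divr_gt0.
have [r r0 Hr] := UI e1.
(* A level of at least 1 gives [1 + x^2 <= 2 x^2] beyond it. *)
pose s := Num.max r 1.
have s1 : 1 <= s by rewrite le_max lexx orbT.
have rs : r <= s by rewrite le_max lexx.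
have Hs K : (K0 <= K)%N -> Ex P (fun w => tailsq s (X K w)) <= e / (6 * (B + 1)).
  by move=> kK; apply: le_trans (Hr _ kK); apply: Ex_le; [exact: LtX|exact: LtX|move=> w; exact: tailsq_decr].
have [LY EY] := tail_limit (le_trans r0 rs) Hs.
pose h (x : R) := if `|x| <= s then g x else 0.
have mh : measurable_fun setT h.
  by rewrite /h; apply: measurable_fun_ifT => //; apply: measurable_fun_ler => //; exact: normr_measurable.
have hb x : `|h x| <= B * (1 + s ^+ 2).
  rewrite /h; case: ifP => hx; last by rewrite normr0 mulr_ge0// addr_ge0// sqr_ge0.
  apply: le_trans (gB x) _; rewrite ler_wpM2l// lerD2l.
  by rewrite -(real_normK (num_real x)) ler_pXn2r ?nnegrE ?(le_trans ler01 s1).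
have hs x : s < `|x| -> h x = 0 by rewrite /h ltNge; case: ifP.
have e3 : 0 < e / 3 by rewrite divr_gt0.
have gh x : `|g x - h x| <= 2 * B * tailsq s x.
  rewrite /h /tailsq; case: ifP => hx; first by rewrite subrr normr0 mulr0.
  rewrite subr0; apply: le_trans (gB x) _; rewrite -mulrA mulrCA ler_wpM2l//.
  move/negbT : hx; rewrite -ltNge => hx.
  have : 1 <= x ^+ 2 by rewrite -(real_normK (num_real x)) -(expr1n _ 2) ler_pXn2r ?nnegrE// ltW// (le_lt_trans s1).
  by lra.
have Lg (Z : Om -> R) : measurable_fun setT Z -> L1 P (fun w => Z w ^+ 2) -> L1 P (fun w => g (Z w)).
  move=> mZ LZ; apply: (@L1_le _ _ _ _ _ (fun w => B * (1 + Z w ^+ 2))) => //.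
    exact: (measurableT_comp mg mZ).
  by apply: L1Z; apply: L1D => //; exact: L1_cst.
have Lh (Z : Om -> R) : measurable_fun setT Z -> L1 P (fun w => h (Z w)).
  by move=> mZ; apply: (@L1_bounded _ _ _ _ _ (B * (1 + s ^+ 2))) => //; exact: (measurableT_comp mh mZ).
have diff (Z : Om -> R) : measurable_fun setT Z -> L1 P (fun w => Z w ^+ 2) -> L1 P (fun w => tailsq s (Z w)) ->
    Ex P (fun w => tailsq s (Z w)) <= e / (6 * (B + 1)) ->
    `|Ex P (fun w => g (Z w)) - Ex P (fun w => h (Z w))| <= e / 3.
  move=> mZ LZ Lt Et; rewrite -(ExB (Lg _ mZ LZ) (Lh _ mZ)).
  apply: (@le_trans _ _ (2 * B * Ex P (fun w => tailsq s (Z w)))).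
    by rewrite -(ExZ _ Lt); apply: Ex_norm_le; [exact: (L1B (Lg _ mZ LZ) (Lh _ mZ))|exact: L1Z|move=> w; exact: gh].
  apply: le_trans (ler_wpM2l _ Et) _; first by rewrite mulr_ge0.
  rewrite (_ : 2 * B * _ = e / 3 * (B / (B + 1))); last by field; rewrite gt_eqF// ltr_wpDl.
  by rewrite ler_piMr ?(ltW e3)// ler_pdivrMr ?ltr_wpDl// mul1r lerDl.
have c := bounded_support_cvg mh hb hs.
near=> K.
have kK : (K0 <= K)%N by near: K; exact: nbhs_infty_ge.
have d1 := diff _ mY limit_L2 LY EY.
have d2 := diff _ (mX kK) (LX2 kK) (LtX s kK) (Hs _ kK).
have d3 : `|Ex P (fun w => h (Y w)) - Ex P (fun w => h (X K w))| <= e / 3.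
  by near: K; move/cvgrPdist_le : c => /(_ _ e3).
have t1 := ler_distD (Ex P (fun w => h (Y w))) (Ex P (fun w => g (Y w))) (Ex P (fun w => g (X K w))).
have t2 := ler_distD (Ex P (fun w => h (X K w))) (Ex P (fun w => h (Y w))) (Ex P (fun w => g (X K w))).
rewrite distrC in d2.
by lra.
Unshelve. all: by end_near. Qed.

End moments.

(** * Uniform integrability of averages over copies *)

Section mean.
Context {R : realType}.

Lemma mean_sqr (K : nat) (b : nat -> R) : (0 < K)%N ->
  (K%:R^-1 * \sum_(k < K) b k) ^+ 2 <= K%:R^-1 * \sum_(k < K) b k ^+ 2.
Proof.
move=> K0; set B := K%:R^-1 * _.
have k0 : 0 < K%:R :> R by rewrite ltr0n.
have SB : \sum_(k < K) b k = K%:R * B by rewrite /B mulVKf// gt_eqF.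
have : 0 <= \sum_(k < K) (b k - B) ^+ 2 by apply: sumr_ge0 => k _; exact: sqr_ge0.
have -> : \sum_(k < K) (b k - B) ^+ 2 = \sum_(k < K) b k ^+ 2 - K%:R * B ^+ 2.
  have e (k : 'I_K) : (b k - B) ^+ 2 = b k ^+ 2 - (2 * B) * b k + B ^+ 2 by ring.
  under eq_bigr do rewrite e.
  rewrite big_split/= sumrB -mulr_sumr SB sumr_const card_ord -[X in _ + X]mulr_natl.
  by ring.
by rewrite subr_ge0 ler_pdivlMl.
Qed.

(** Each [|a k|] is at most [r + b k], where [b k] keeps the modulus beyond [r]. If the mean exceeds
    [2 * r] in modulus, the mean of the [b k] is at least half of it, and Jensen's inequality
    concludes. *)
Lemma tailsq_mean (K : nat) (a : nat -> R) (r : R) : (0 < K)%N -> 0 <= r ->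
  tailsq (2 * r) (K%:R^-1 * \sum_(k < K) a k) <= 4 * (K%:R^-1 * \sum_(k < K) tailsq r (a k)).
Proof.
move=> K0 r0; have k0 : 0 < K%:R :> R by rewrite ltr0n.
pose b k := if `|a k| <= r then 0 else `|a k|.
have b2 k : tailsq r (a k) = b k ^+ 2.
  by rewrite /tailsq /b; case: ifP => _; rewrite ?expr0n// real_normK// num_real.
have ab k : `|a k| <= r + b k by rewrite /b; case: ifP => h; rewrite ?addr0// lerDr.
set A := K%:R^-1 * _; pose B := K%:R^-1 * \sum_(k < K) b k.
have B0 : 0 <= B.
  by rewrite mulr_ge0 ?invr_ge0// sumr_ge0// => k _; rewrite /b; case: ifP.
have AB : `|A| <= r + B.
  rewrite /A normrM gtr0_norm ?invr_gt0// ler_pdivrMl// mulrDr /B mulVKf ?gt_eqF//.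
  apply: le_trans (ler_norm_sum _ _ _) _.
  apply: (@le_trans _ _ (\sum_(k < K) (r + b k))); first by apply: ler_sum => k _.
  by rewrite big_split/= sumr_const card_ord mulr_natl.
have BB := mean_sqr b K0; under eq_bigr do rewrite b2.
rewrite /tailsq; case: (leP `|A| (2 * r)) => h.
  by rewrite mulr_ge0 // (le_trans _ BB)// sqr_ge0.
apply: le_trans (ler_wpM2l (ler0n R 4) BB); rewrite -/B -(real_normK (num_real A)).
have : `|A| <= 2 * B by lra.
by move=> /(lerXn2r 2); rewrite !nnegrE => /(_ (normr_ge0 _)); rewrite exprMn -natrX; apply; rewrite mulr_ge0.
Qed.

Lemma tailsq_powR (r u delta : R) : 0 < r -> 0 <= delta ->
  tailsq r u <= r `^ (- delta) * `|u| `^ (2 + delta).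
Proof.
move=> r0 d0; rewrite /tailsq; case: (leP `|u| r) => h; first by rewrite mulr_ge0 ?powR_ge0.
have u0 : 0 < `|u| by apply: lt_trans h.
rewrite powRD ?(gt_eqF u0) ?implybT// powR_mulrn// real_normK ?num_real// mulrCA -[leLHS]mulr1.
rewrite ler_wpM2l ?sqr_ge0// powRN ler_pdivlMl ?powR_gt0// mulr1.
by apply: ge0_ler_powR => //; rewrite ?nnegrE ltW.
Qed.

End mean.

Section average.
Context {R : realType} {d d1 d2 : measure_display} {Om : measurableType d}
  {T1 : measurableType d1} {T2 : measurableType d2} (P : probability Om R).
Variables (Y : Om -> T1) (Z : Om -> T2) (Zs : nat -> Om -> T2) (K : nat) (phi : T1 * T2 -> R).
Hypotheses (mY : measurable_fun setT Y) (mZ : measurable_fun setT Z) (mphi : measurable_fun setT phi)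
  (mZs : forall k, (k < K)%N -> measurable_fun setT (Zs k))
  (lawZs : forall k, (k < K)%N -> same_law P (Zs k) Z)
  (indYZ : indep2 P Y Z) (indZs : indep_family P Y Zs K) (K0 : (0 < K)%N).
Let X w := K%:R^-1 * \sum_(k < K) phi (Y w, Zs k w).

Lemma indep_family_indep2 k : (k < K)%N -> indep2 P Y (Zs k).
Proof.
move=> kK A B mA mB.
have := indZs mA (B := fun j => if j == k then B else setT).
have -> : \bigcap_(j in [set j | (j < K)%N]) (Zs j @^-1` (if j == k then B else setT)) = Zs k @^-1` B.
  apply/seteqP; split => w /=.
    by move=> /(_ k kK); rewrite eqxx.
  by move=> wB j _; case: eqP => // ->.
rewrite (bigD1 (Ordinal kK))//= eqxx big1; last first.
  move=> i; rewrite -val_eqE /= => /negbTE ->.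
  by rewrite preimage_setT; exact: (congr1 fine (probability_setT P)).
rewrite mulr1 => h.
have mYA : measurable (Y @^-1` A) by rewrite -[_ @^-1` _]setTI; exact: mY.
have mZB : measurable (Zs k @^-1` B) by rewrite -[_ @^-1` _]setTI; exact: (mZs kK).
have {}h := h (fun j => match j == k as b return measurable (if b then B else setT) with
  true => mB | false => measurableT end).
rewrite -[LHS]fineK ?fin_num_measure//; last exact: measurableI.
by rewrite h EFinM !fineK ?fin_num_measure.
Qed.

Lemma copy_law k : (k < K)%N -> same_law P (fun w => (Y w, Zs k w)) (fun w => (Y w, Z w)).
Proof.
move=> kK C mC.
have m1 : measurable_fun setT (fun w => (Y w, Zs k w)).
  by apply: measurable_fun_pair => //; exact: mZs.
have m2 : measurable_fun setT (fun w => (Y w, Z w)) by apply: measurable_fun_pair.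
pose Q1 : {mfun Om >-> (T1 * T2)%type} := HB.pack (fun w => (Y w, Zs k w)) (isMeasurableFun.Build _ _ _ _ _ m1).
pose Q2 : {mfun Om >-> (T1 * T2)%type} := HB.pack (fun w => (Y w, Z w)) (isMeasurableFun.Build _ _ _ _ _ m2).
apply: (@measure_eq_rect _ _ _ _ _ (distribution P Q1) (distribution P Q2)) => //.
  by apply: (@le_lt_trans _ _ 1%E); [exact: probability_le1|exact: ltry].
move=> A B mA mB; rewrite /distribution /pushforward /=.
have := indep_family_indep2 kK mA mB; rewrite (lawZs kK mB) -(indYZ mA mB) => h.
exact: h.
Qed.

Lemma average_measurable : measurable_fun setT X.
Proof.
apply: measurable_funM => //; apply: measurable_sum => k.
by apply: (measurableT_comp mphi); apply: measurable_fun_pair => //; exact: mZs.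
Qed.

Section functional.
Variable g : R -> R.
Hypotheses (mg : measurable_fun setT g) (Lg : L1 P (fun w => g (phi (Y w, Z w)))).

Let mZs' k : (k < K)%N -> measurable_fun setT (fun w => (Y w, Zs k w)).
Proof. by move=> kK; apply: measurable_fun_pair => //; exact: mZs. Qed.
Let mYZ : measurable_fun setT (fun w => (Y w, Z w)). Proof. exact: measurable_fun_pair. Qed.
Let mgphi : measurable_fun setT (g \o phi). Proof. exact: measurableT_comp. Qed.

Lemma copies_L1 : L1 P (fun w => K%:R^-1 * \sum_(k < K) g (phi (Y w, Zs k w))).
Proof.
apply: L1Z; apply: L1_sum => k.
exact: (same_law_L1 (mZs' (ltn_ord k)) mYZ (copy_law (ltn_ord k)) mgphi Lg).
Qed.

Lemma copies_Ex : Ex P (fun w => K%:R^-1 * \sum_(k < K) g (phi (Y w, Zs k w))) =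
  Ex P (fun w => g (phi (Y w, Z w))).
Proof.
have L k : (k < K)%N -> L1 P (fun w => g (phi (Y w, Zs k w))).
  by move=> kK; exact: (same_law_L1 (mZs' kK) mYZ (copy_law kK) mgphi Lg).
rewrite ExZ; last by apply: L1_sum => k; exact: L.
rewrite (@Ex_sum _ _ _ _ _ _ (fun (k : 'I_K) w => g (phi (Y w, Zs k w)))); last by move=> k; exact: L.
under eq_bigr => k _ do rewrite (same_law_Ex (mZs' (ltn_ord k)) mYZ (copy_law (ltn_ord k)) mgphi Lg).
by rewrite sumr_const card_ord -[X in _ * X]mulr_natl mulKf// pnatr_eq0 -lt0n.
Qed.

End functional.

Hypothesis L2 : L1 P (fun w => phi (Y w, Z w) ^+ 2).

Lemma average_L2 : L1 P (fun w => X w ^+ 2).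
Proof.
have mX := average_measurable.
apply: L1_le (copies_L1 (g := fun x => x ^+ 2) _ L2); [by meas| |by meas].
by move=> w; rewrite ger0_norm ?sqr_ge0//; exact: (mean_sqr (fun k => phi (Y w, Zs k w))).
Qed.

(** The right side does not depend on [K]: this is how the moment of a single evaluation of [phi]
    gives uniform integrability over all [h]. *)
Lemma average_tail r : 0 <= r ->
  Ex P (fun w => tailsq (2 * r) (X w)) <= 4 * Ex P (fun w => tailsq r (phi (Y w, Z w))).
Proof.
move=> r0; have mX := average_measurable.
have mt s := @measurable_tailsq R s.
have mYZ : measurable_fun setT (fun w => phi (Y w, Z w)).
  by apply: (measurableT_comp mphi); exact: measurable_fun_pair.
have Lt : L1 P (fun w => tailsq r (phi (Y w, Z w))).
  apply: L1_le L2; first exact: (measurableT_comp (mt r)).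
  by move=> w; rewrite ger0_norm ?tailsq_ge0 ?tailsq_le.
rewrite -(copies_Ex (mt r) Lt) -(ExZ _ (copies_L1 (mt r) Lt)); apply: Ex_le.
- apply: L1_le average_L2; first exact: (measurableT_comp (mt (2 * r))).
  by move=> w; rewrite ger0_norm ?tailsq_ge0 ?tailsq_le.
- exact: (L1Z _ (copies_L1 (mt r) Lt)).
- by move=> w; exact: (tailsq_mean (fun k => phi (Y w, Zs k w))).
Qed.

End average.

Section moment.
Context {R : realType} {d : measure_display} {Om : measurableType d} (P : probability Om R).
Variables (W : Om -> R) (delta : R).
Hypotheses (mW : measurable_fun setT W) (delta0 : 0 < delta)
  (mom : ('E_P[(fun w => `|W w| `^ (2 + delta))%R] < +oo)%E).

Let Lp : L1 P (fun w => `|W w| `^ (2 + delta)).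
Proof.
apply: L1_ge0_lty => [|w|]; last by move: mom; rewrite unlock.
- by apply: (measurableT_comp (measurable_powR _)); exact: (measurableT_comp (@normr_measurable _ setT)).
- exact: powR_ge0.
Qed.

Let Lt r : 0 < r -> L1 P (fun w => tailsq r (W w)).
Proof.
move=> r0; apply: L1_le (L1Z (r `^ (- delta)) Lp).
  exact: (measurableT_comp (measurable_tailsq r)).
by move=> w; rewrite ger0_norm ?tailsq_ge0//; apply: tailsq_powR => //; exact: ltW.
Qed.

Lemma moment_L2 : L1 P (fun w => W w ^+ 2).
Proof.
apply: (@L1_le _ _ _ _ _ (fun w => 1 + tailsq 1 (W w))).
- exact: measurable_funX.
- move=> w; rewrite ger0_norm ?sqr_ge0// /tailsq; case: ifP => h; last by rewrite lerDr.
  by rewrite addr0 -(real_normK (num_real (W w))) expr_le1.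
- by apply: L1D; [exact: L1_cst|exact: Lt].
Qed.

Lemma moment_tail e : 0 < e -> exists2 r, 0 <= r & Ex P (fun w => tailsq r (W w)) <= e.
Proof.
move=> e0; set m := Ex P (fun w => `|W w| `^ (2 + delta)).
have m0 : 0 <= m by apply: Ex_ge0 => w; exact: powR_ge0.
have me : 0 < (m + 1) / e by rewrite divr_gt0// ltr_wpDl.
(* The level for which [r^(-delta) = e / (m + 1)]; adding 1 to the moment [m] keeps the base
   positive. *)
exists (((m + 1) / e) `^ delta^-1); first exact: powR_ge0.
set r := _ `^ _; have r0 : 0 < r by rewrite powR_gt0.
apply: (@le_trans _ _ (r `^ (- delta) * m)).
  rewrite -(ExZ _ Lp); apply: Ex_le; [exact: Lt|exact: (L1Z _ Lp)|].
  by move=> w; apply: tailsq_powR => //; exact: ltW.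
rewrite powRN /r -powRrM mulVf ?gt_eqF// powRr1 ?(ltW me)// invf_div mulrAC ler_pdivrMr ?ltr_wpDl//.
by rewrite ler_pM2l// lerDl.
Qed.

End moment.

(** * Influence functions and the limit covariance *)

Section influence.
Context {R : realType} {d : measure_display} {Om : measurableType d} (P : probability Om R).
Variables (alpha : R) (X : Om -> R) (xs fx : R).
Hypotheses (alpha01 : 0 < alpha < 1) (mX : measurable_fun setT X) (LX2 : L1 P (fun w => X w ^+ 2))
  (D0 : meanH P alpha X xs = 0) (fx0 : 0 < fx).
Let a : R := (1 - alpha)^-1.
Let e1 := Ex P (fun w => posp (X w - xs)).
Let e2 := Ex P (fun w => posp (X w - xs) ^+ 2).
Let LX : L1 P X. Proof. exact: L1_sqr_le. Qed.

(** The combination, with Cramer-Wold weights [u1] and [u2], of the influence functions of VaR and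
    of ES at [x]. *)
Definition influence (alpha fx e xs u1 u2 x : R) : R :=
  - (u1 * ((1 - alpha)^-1 * fx)^-1) * H1 alpha xs x + u2 * (1 - alpha)^-1 * (posp (x - xs) - e).

(** The quadratic form of the limit covariance matrix, [e1] and [e2] being the first two moments of
    the excess. *)
Definition cov_form (alpha fx e1 e2 u1 u2 : R) : R :=
  u1 ^+ 2 * (alpha * (1 - alpha) / fx ^+ 2) + 2 * u1 * u2 * (alpha / (1 - alpha) * e1 / fx)
  + u2 ^+ 2 * ((e2 - e1 ^+ 2) / (1 - alpha) ^+ 2).

Lemma influence_measurable e u1 u2 : measurable_fun setT (influence alpha fx e xs u1 u2).
Proof.
have mH : measurable_fun setT (H1 alpha xs).
  by apply: (measurableT_comp (H1_measurable alpha) (g := fun x => (xs, x))); apply: measurable_fun_pair.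
apply: measurable_funD; first by apply: measurable_funM.
by apply: measurable_funM => //; meas.
Qed.

Let LH : L1 P (fun w => H1 alpha xs (X w)).
Proof.
apply: (@L1_bounded _ _ _ _ _ a); last by move=> w; exact: H1_bound.
by apply: (measurableT_comp (H1_measurable alpha) (g := fun w => (xs, X w))); apply: measurable_fun_pair.
Qed.

Let LS : L1 P (fun w => posp (X w - xs)). Proof. exact: L1_posp. Qed.

Lemma posp_sqr_L1 x : L1 P (fun w => posp (X w - x) ^+ 2).
Proof.
apply: (@L1_le _ _ _ _ _ (fun w => (X w + - x) ^+ 2)).
- by meas.
- move=> w; rewrite ger0_norm ?sqr_ge0// /posp; case: (leP (X w - x) 0) => // _.
  by rewrite expr0n sqr_ge0.
- by apply: L1_sqrD => //; exact: L1_cst.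
Qed.

Lemma influence_mean u1 u2 : Ex P (fun w => influence alpha fx e1 xs u1 u2 (X w)) = 0.
Proof.
have L1' := L1B LS (L1_cst P e1).
rewrite (ExD (L1Z _ LH) (L1Z _ L1')) (ExZ _ LH) (ExZ _ L1') (ExB LS (L1_cst P e1)) Ex_cst.
by rewrite -/e1 subrr mulr0 addr0 -/(meanH P alpha X xs) D0 mulr0.
Qed.

(** As [H1] takes only the values [1] and [1 - a], its square is [(2 - a) * H1 + (a - 1)], and its
    product with the excess is [1 - a] times the excess. The square of the influence is thus linear
    in [H1], the excess and its square, and [H1] has mean zero at [xs]. *)
Lemma influence_sqr u1 u2 :
  L1 P (fun w => influence alpha fx e1 xs u1 u2 (X w) ^+ 2) /\
  Ex P (fun w => influence alpha fx e1 xs u1 u2 (X w) ^+ 2) = cov_form alpha fx e1 e2 u1 u2.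
Proof.
have /andP[al0 al1] := alpha01.
have a1 : 1 - alpha != 0 by rewrite subr_eq0 gt_eqF.
have fx1 : fx != 0 by rewrite gt_eqF.
pose p := (a * fx)^-1.
pose kH := u1 ^+ 2 * p ^+ 2 * (2 - a) + 2 * u1 * u2 * a * p * e1.
pose kS := 2 * u1 * u2 * a * p * (a - 1) - 2 * u2 ^+ 2 * a ^+ 2 * e1.
pose k2 := u2 ^+ 2 * a ^+ 2.
pose k0 := u1 ^+ 2 * p ^+ 2 * (a - 1) + k2 * e1 ^+ 2.
have E : (fun w => influence alpha fx e1 xs u1 u2 (X w) ^+ 2) = (fun w =>
    kH * H1 alpha xs (X w) + kS * posp (X w - xs) + k2 * posp (X w - xs) ^+ 2 + k0).
  apply/funext => w; rewrite /influence /H1 -/a -/p /k0 /kS /kH /k2 /posp.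
  case: (leP xs (X w)) => h; first by ring.
  by rewrite max_r ?mulr0 ?subr0; [ring|lra].
have LS2 := posp_sqr_L1 xs.
have L3 := L1D (L1Z kH LH) (L1Z kS LS).
have L4 := L1D L3 (L1Z k2 LS2).
rewrite E; split; first exact: (L1D L4 (L1_cst P k0)).
rewrite (ExD L4 (L1_cst P k0)) (ExD L3 (L1Z k2 LS2)) (ExD (L1Z kH LH) (L1Z kS LS)).
rewrite (ExZ _ LH) (ExZ _ LS) (ExZ _ LS2) Ex_cst -/e1 -/e2 -/(meanH P alpha X xs) D0.
by rewrite /cov_form /k0 /kS /kH /k2 /p /a; field; apply/andP; split.
Qed.

Lemma influence_bound e u1 u2 c B x : 0 < c -> c <= fx -> `|xs| + `|e| <= B ->
  `|influence alpha fx e xs u1 u2 x| <= (`|u1| / c + `|u2| * a * (B + 1)) * (1 + `|x|).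
Proof.
move=> c0 cf hB.
have a0 : 0 < a by rewrite invr_gt0 subr_gt0; case/andP: alpha01.
have B0 : 0 <= B by apply: le_trans hB; rewrite addr_ge0.
have h1 : `|H1 alpha xs x| <= a by exact: H1_bound.
have h2 : `|posp (x - xs) - e| <= (B + 1) * (1 + `|x|).
  have p1 : `|posp (x - xs)| <= `|x| + `|xs|.
    apply: le_trans (ler_normB x xs).
    by have := posp_lip (x - xs) 0; rewrite subr0 {2}/posp maxxx subr0.
  have p2 := ler_normB (posp (x - xs)) e.
  have : 0 <= B * `|x| by rewrite mulr_ge0.
  have := normr_ge0 xs; have := normr_ge0 e; lra.
rewrite mulrDl; apply: le_trans (ler_normD _ _) _; apply: lerD.
  rewrite normrM normrN normrM normfV normrM (gtr0_norm a0) (gtr0_norm fx0).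
  apply: (@le_trans _ _ (`|u1| / (a * fx) * a)); first by rewrite ler_wpM2l// divr_ge0// mulr_ge0 ?ltW.
  have -> : `|u1| / (a * fx) * a = `|u1| / fx by field; rewrite !gt_eqF.
  apply: (@le_trans _ _ (`|u1| / c)); first by rewrite ler_wpM2l// lef_pV2.
  by rewrite ler_peMr ?divr_ge0 ?(ltW c0)// lerDl.
by rewrite !normrM (gtr0_norm a0) -!mulrA !ler_wpM2l ?(ltW a0).
Qed.

End influence.

(** If [u] exceeds its level then [|x| > s >= 1], whence [1 + |x| <= 2 |x|]. *)
Lemma tailsq_affine {R : realType} (u x C s : R) : 0 <= C -> 1 <= s ->
  `|u| <= C * (1 + `|x|) -> tailsq (C * (1 + s)) u <= 4 * C ^+ 2 * tailsq s x.
Proof.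
move=> C0 s1 h; have t0 : 0 <= tailsq s x := tailsq_ge0 s x.
rewrite {1}/tailsq; case: (leP `|u|) => h1; first by rewrite mulr_ge0// mulr_ge0 ?sqr_ge0.
have xs : s < `|x|.
  rewrite ltNge; apply/negP => xs; move: h1; rewrite ltNge => /negP; apply.
  by apply: le_trans h _; rewrite ler_wpM2l// lerD2l.
rewrite /tailsq ifF; last by apply/negbTE; rewrite -ltNge.
rewrite -(real_normK (num_real u)) -(real_normK (num_real x)).
have -> : 4 * C ^+ 2 * `|x| ^+ 2 = (C * (2 * `|x|)) ^+ 2 by ring.
rewrite ler_pXn2r ?nnegrE ?mulr_ge0//; apply: le_trans h _.
by rewrite ler_wpM2l//; lra.
Qed.

(** * Convergence of the minimizers and of the moments of the excess *)

Section limits.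
Context {R : realType} {d : measure_display} {Om : measurableType d} (P : probability Om R).
Variables (alpha : R) (X : nat -> Om -> R) (Y : Om -> R) (f : nat -> R -> R) (f0 : R -> R) (M : R)
  (xis : nat -> R) (xis0 : R).
Hypotheses (alpha01 : 0 < alpha < 1)
  (mX : forall K, (0 < K)%N -> measurable_fun setT (X K)) (mY : measurable_fun setT Y)
  (LX2 : forall K, (0 < K)%N -> L1 P (fun w => X K w ^+ 2))
  (UI : forall e, 0 < e -> exists2 r, 0 <= r & forall K, (0 < K)%N ->
    Ex P (fun w => tailsq r (X K w)) <= e)
  (pdfX : forall K, (0 < K)%N -> is_pdf P (X K) (f K)) (pdfY : is_pdf P Y f0)
  (fge0 : forall K, (0 < K)%N -> forall x, 0 <= f K x) (f0ge0 : forall x, 0 <= f0 x)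
  (fM : forall K, (0 < K)%N -> forall x, f K x <= M) (f0M : forall x, f0 x <= M)
  (flip : forall K, (0 < K)%N -> forall x y, `|f K x - f K y| <= M * `|x - y|)
  (f0lip : forall x y, `|f0 x - f0 y| <= M * `|x - y|)
  (fcvg : forall r e : R, 0 < r -> 0 < e ->
     \forall K \near \oo, forall x, `|x| <= r -> `|f K x - f0 x| <= e)
  (fpos : forall r, 0 < r -> exists2 c, 0 < c &
     forall K, (0 < K)%N -> forall x, `|x - xis0| < r -> c <= f K x)
  (hmin : forall K, (0 < K)%N -> is_minimizer (Vfun P alpha (X K)) (xis K))
  (hmin0 : is_minimizer (Vfun P alpha Y) xis0).
Let a : R := (1 - alpha)^-1.
Let a0 : 0 < a. Proof. exact: lt_trans (a_gt1 alpha01). Qed.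
Let LX K : (0 < K)%N -> L1 P (X K). Proof. by move=> k; apply: L1_sqr_le; [exact: mX|exact: LX2]. Qed.
Let mf K : (0 < K)%N -> measurable_fun setT (f K).
Proof. by move=> k; exact: (lipschitz_pdf_measurable (flip k)). Qed.
Let mf0 : measurable_fun setT f0. Proof. exact: (lipschitz_pdf_measurable f0lip). Qed.

Lemma quadratic_mean_cvg (g : R -> R) (B : R) : measurable_fun setT g -> 0 <= B ->
  (forall x, `|g x| <= B * (1 + x ^+ 2)) ->
  (fun K => Ex P (fun w => g (X K w))) @ \oo --> Ex P (fun w => g (Y w)).
Proof.
exact: (@quadratic_cvg _ _ _ P X Y f f0 1%N mX mY pdfX pdfY fge0 f0ge0 mf mf0 fcvg UI LX2).
Qed.

Lemma limit_sqr_L1 : L1 P (fun w => Y w ^+ 2).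
Proof. exact: (@limit_L2 _ _ _ P X Y f f0 1%N mX mY pdfX pdfY fge0 f0ge0 mf mf0 fcvg UI LX2). Qed.

Let LY : L1 P Y. Proof. exact: L1_sqr_le mY limit_sqr_L1. Qed.

Lemma limit_meanH0 : meanH P alpha Y xis0 = 0.
Proof. exact: (meanH_min0 alpha01 LY pdfY f0ge0 f0M f0lip hmin0). Qed.

Lemma meanH_cvg : (fun K => meanH P alpha (X K) xis0) @ \oo --> (0 : R).
Proof.
rewrite -limit_meanH0; apply: (@quadratic_mean_cvg _ a); [|exact: ltW|].
  by apply: (measurableT_comp (H1_measurable alpha) (g := fun x => (xis0, x))); apply: measurable_fun_pair.
move=> x; apply: le_trans (H1_bound alpha01 _ _) _.
by rewrite ler_peMr ?(ltW a0)// lerDl sqr_ge0.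
Qed.

(** At the fixed point [xis0] the mean fields tend to zero, while near [xis0] they increase with
    slope at least [a * c], uniformly in [K]; so their zeros [xis K] cannot stay away. Monotonicity
    handles zeros outside the ball where the slope is known. *)
Lemma minimizer_cvg : xis @ \oo --> xis0.
Proof.
apply/cvgrPdist_lt => e e0; pose t := Num.min e 1.
have t0 : 0 < t by rewrite lt_min e0 ltr01.
have t1 : t <= 1 by rewrite ge_min lexx orbT.
have te : t <= e by rewrite ge_min lexx.
have [c c0 Hc] := fpos (ltr0n R 2).
have act : 0 < a * (c * t) by rewrite mulr_gt0 ?mulr_gt0.
near=> K.
have k0 : (0 < K)%N by near: K; exact: nbhs_infty_gt.
have small : `|meanH P alpha (X K) xis0| < a * (c * t).
  by near: K; move/cvgrPdist_lt : meanH_cvg => /(_ _ act); apply: filterS => K; rewrite sub0r normrN.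
have Ds := meanH_min0 alpha01 (LX k0) (pdfX k0) (fge0 k0) (fM k0) (flip k0) (hmin k0).
have mono := meanH_mono alpha01 (LX k0).
have grow x y : x <= y -> `|x - xis0| <= 1 -> `|y - xis0| <= 1 ->
    a * (c * (y - x)) <= meanH P alpha (X K) y - meanH P alpha (X K) x.
  move=> xy; rewrite !ler_norml => /andP[x1 x2] /andP[y1 y2].
  rewrite (meanH_diff alpha01 (LX k0))// ler_pM2l//.
  apply: (pdf_lower (LX k0) (pdfX k0) (flip k0) xy) => u /andP[u1 u2].
  by apply: Hc => //; rewrite ltr_norml; apply/andP; split; lra.
apply: lt_le_trans te; rewrite ltNge; apply/negP => far.
case: (leP (xis0 + t) (xis K)) => h1.
  have := grow xis0 (xis0 + t); rewrite lerDl subrr normr0 addrAC subrr add0r ler01 gtr0_norm// => /(_ (ltW t0) isT t1).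
  by have := mono _ _ h1; rewrite Ds; move: small; rewrite ltr_norml => /andP[]; lra.
have h2 : xis K <= xis0 - t.
  by move: far; rewrite ler_normr => /orP[]; lra.
have := grow (xis0 - t) xis0; rewrite gerBl subrr normr0 opprB addrCA subrr addr0 ler01 addrAC subrr add0r normrN gtr0_norm// => /(_ (ltW t0) t1 isT).
by have := mono _ _ h2; rewrite Ds; move: small; rewrite ltr_norml => /andP[]; lra.
Unshelve. all: by end_near. Qed.

Lemma pdf_minimizer_cvg : (fun K => f K (xis K)) @ \oo --> f0 xis0.
Proof.
have M0 : 0 <= M by apply: le_trans (f0M 0).
apply/cvgrPdist_le => e e0.
have e2 : 0 < e / 2 by rewrite divr_gt0.
have e3 : 0 < e / 2 / (M + 1) by rewrite divr_gt0// ltr_wpDl.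
have r0 : 0 < `|xis0| + 1 by rewrite ltr_wpDl.
near=> K.
have k0 : (0 < K)%N by near: K; exact: nbhs_infty_gt.
have h1 : `|xis0 - xis K| <= e / 2 / (M + 1) by near: K; move/cvgrPdist_le : minimizer_cvg => /(_ _ e3).
have h2 : `|f K xis0 - f0 xis0| <= e / 2.
  have : forall x, `|x| <= `|xis0| + 1 -> `|f K x - f0 x| <= e / 2 by near: K; exact: fcvg.
  by apply; rewrite lerDl.
have h3 := flip k0 xis0 (xis K).
have h4 : M * `|xis0 - xis K| <= e / 2.
  apply: le_trans (ler_wpM2l M0 h1) _.
  by rewrite mulrA ler_pdivrMr ?ltr_wpDl// mulrC ler_wpM2l ?lerDl// ltW.
have := ler_distD (f K xis0) (f0 xis0) (f K (xis K)).
rewrite distrC in h2; lra.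
Unshelve. all: by end_near. Qed.

(** Both the integrand and the law depend on [K]. The Lipschitz bound in the parameter isolates
    [|xis K - xis0|] times a convergent mean, and leaves a fixed integrand. *)
Lemma moving_mean_cvg (g : R -> R -> R) (B : R) : (forall x, measurable_fun setT (g x)) -> 0 <= B ->
  (forall u, `|g xis0 u| <= B * (1 + u ^+ 2)) ->
  (forall x u, `|x - xis0| <= 1 -> `|g x u - g xis0 u| <= `|x - xis0| * (B * (1 + u ^+ 2))) ->
  (fun K => Ex P (fun w => g (xis K) (X K w))) @ \oo --> Ex P (fun w => g xis0 (Y w)).
Proof.
move=> mg B0 gB glip.
have c1 := quadratic_mean_cvg (mg xis0) B0 gB.
pose b K := Ex P (fun w => B * (1 + X K w ^+ 2)).
have c2 : b @ \oo --> Ex P (fun w => B * (1 + Y w ^+ 2)).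
  apply: (@quadratic_mean_cvg (fun x => B * (1 + x ^+ 2)) B) => //; first by meas.
  by move=> x; rewrite ger0_norm// mulr_ge0// addr_ge0// sqr_ge0.
have c3 : (fun K => `|xis K - xis0| * b K) @ \oo --> 0.
  rewrite -[X in _ --> X](mul0r (Ex P (fun w => B * (1 + Y w ^+ 2)))); apply: cvgM => //.
  rewrite -[X in _ --> X](@normr0 R R) -(subrr xis0).
  by apply: (@cvg_norm _ R^o); apply: cvgB; [exact: minimizer_cvg|exact: cvg_cst].
have Lq K : (0 < K)%N -> L1 P (fun w => B * (1 + X K w ^+ 2)).
  by move=> k0; apply: L1Z; apply: L1D; [exact: L1_cst|exact: LX2].
have Lg K : (0 < K)%N -> L1 P (fun w => g xis0 (X K w)).
  by move=> k0; apply: L1_le (Lq K k0) => //; exact: (measurableT_comp (mg xis0) (mX k0)).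
have Lg' K : (0 < K)%N -> `|xis K - xis0| <= 1 -> L1 P (fun w => g (xis K) (X K w)).
  move=> k0 h; apply: L1_le (L1Z 2 (Lq K k0)); first exact: (measurableT_comp (mg (xis K)) (mX k0)).
  move=> w; have := ler_normD (g (xis K) (X K w) - g xis0 (X K w)) (g xis0 (X K w)); rewrite subrK.
  have := glip _ (X K w) h; have := gB (X K w); set q := B * _.
  have q0 : 0 <= q by rewrite mulr_ge0// addr_ge0// sqr_ge0.
  have := ler_wpM2r q0 h; lra.
apply/cvgrPdist_le => e e0.
have e2 : 0 < e / 2 by rewrite divr_gt0.
near=> K.
have k0 : (0 < K)%N by near: K; exact: nbhs_infty_gt.
have near1 : `|xis K - xis0| <= 1.
  by rewrite distrC; near: K; move/cvgrPdist_le : minimizer_cvg => /(_ _ ltr01).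
have h1 : `|Ex P (fun w => g xis0 (Y w)) - Ex P (fun w => g xis0 (X K w))| <= e / 2.
  by near: K; move/cvgrPdist_le : c1 => /(_ _ e2).
have h2 : `|xis K - xis0| * b K <= e / 2.
  apply: le_trans (ler_norm _) _; rewrite -normrN -[- _]sub0r.
  by near: K; move/cvgrPdist_le : c3 => /(_ _ e2).
have h3 : `|Ex P (fun w => g (xis K) (X K w)) - Ex P (fun w => g xis0 (X K w))| <= `|xis K - xis0| * b K.
  rewrite -(ExB (Lg' K k0 near1) (Lg K k0)) /b -(ExZ _ (Lq K k0)); apply: Ex_norm_le.
  - exact: (L1B (Lg' K k0 near1) (Lg K k0)).
  - exact: (L1Z _ (Lq K k0)).
  - by move=> w; exact: glip.
have := ler_distD (Ex P (fun w => g xis0 (X K w))) (Ex P (fun w => g xis0 (Y w))) (Ex P (fun w => g (xis K) (X K w))).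
rewrite distrC in h3; lra.
Unshelve. all: by end_near. Qed.

Let abs_quad (u : R) : 2 * `|u| <= 1 + u ^+ 2.
Proof. by rewrite -(real_normK (num_real u)); have := sqr_ge0 (`|u| - 1); lra. Qed.

Let posp_abs (u x : R) : `|posp (u - x)| <= `|u| + `|x|.
Proof.
apply: le_trans (ler_normB u x).
by have := posp_lip (u - x) 0; rewrite subr0 {2}/posp maxxx subr0.
Qed.

Let posp_diff (u x y : R) : `|posp (u - x) - posp (u - y)| <= `|x - y|.
Proof. by apply: le_trans (posp_lip _ _) _; rewrite distrC (_ : u - y - (u - x) = x - y)//; ring. Qed.

Lemma excess_cvg : (fun K => Ex P (fun w => posp (X K w - xis K))) @ \oo --> Ex P (fun w => posp (Y w - xis0)).
Proof.
apply: (@moving_mean_cvg (fun x u => posp (u - x)) (1 + `|xis0|)).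
- by move=> x; meas.
- by rewrite addr_ge0.
- move=> u; apply: le_trans (posp_abs _ _) _; have := abs_quad u; have := normr_ge0 xis0.
  have := sqr_ge0 u; have := normr_ge0 u; nra.
- move=> x u _; apply: le_trans (posp_diff _ _ _) _; rewrite ler_peMr//.
  have := normr_ge0 xis0; have := sqr_ge0 u; nra.
Qed.

Lemma excess_sqr_cvg :
  (fun K => Ex P (fun w => posp (X K w - xis K) ^+ 2)) @ \oo --> Ex P (fun w => posp (Y w - xis0) ^+ 2).
Proof.
pose B := 2 * (1 + `|xis0|) ^+ 2.
have m0 := normr_ge0 xis0; have m2 := sqr_ge0 `|xis0|.
apply: (@moving_mean_cvg (fun x u => posp (u - x) ^+ 2) B).
- by move=> x; meas.
- by rewrite mulr_ge0// sqr_ge0.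
- move=> u; rewrite ger0_norm ?sqr_ge0// -real_normK ?num_real//.
  apply: (@le_trans _ _ ((`|u| + `|xis0|) ^+ 2)); first by rewrite ler_pXn2r ?nnegrE ?addr_ge0.
  rewrite -(real_normK (num_real u)) /B; have := sqr_ge0 (`|u| - `|xis0|); have := normr_ge0 u.
  have := mulr_ge0 m0 (sqr_ge0 `|u|); have := mulr_ge0 m2 (sqr_ge0 `|u|); nra.
- move=> x u hx; rewrite subr_sqr normrM; apply: ler_pM => //.
  apply: le_trans (ler_normD _ _) _.
  have h1 := posp_abs u x; have h2 := posp_abs u xis0.
  have h3 : `|x| <= 1 + `|xis0| by have := ler_distD 0 x xis0; have := ler_normD (x - xis0) xis0; rewrite subrK; lra.
  have := abs_quad u; rewrite /B; have := sqr_ge0 u.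
  have := mulr_ge0 m0 (sqr_ge0 u); have := mulr_ge0 m2 (sqr_ge0 u); nra.
Qed.

End limits.

(** * The averaged scheme *)

Section initial.
Context {R : realType} {d : measure_display} {Om : measurableType d} (P : probability Om R).

(** The weight of Assumption B vanishes at the origin; the term [expR c] takes over for
    [|x| <= 1]. *)
Lemma lyap_exp_le (l c B x xs : R) : 0 < l <= 1 -> l <= c -> `|xs| <= B ->
  lyap l (x - xs) <= 2 * expR B * (expR c + x ^+ 2 * expR (c * `|x|)).
Proof.
move=> /andP[l0 l1] lc hB.
have c0 : 0 < c by apply: lt_le_trans lc.
have B0 : 0 <= B by apply: le_trans hB.
have y : l * `|x - xs| <= c * `|x| + B.
  apply: le_trans (ler_wpM2l (ltW l0) (ler_normB x xs)) _; rewrite mulrDr; apply: lerD.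
    by rewrite ler_wpM2r.
  by apply: le_trans hB; rewrite ler_piMl.
have h1 : lyap l (x - xs) <= 2 * expR (l * `|x - xs|).
  have := ler_norm (x - xs); have := ler_norm (- (x - xs)); rewrite normrN => n1 n2.
  have e1 : expR (l * (x - xs)) <= expR (l * `|x - xs|) by rewrite ler_expR ler_pM2l.
  have e2 : expR (- (l * (x - xs))) <= expR (l * `|x - xs|) by rewrite ler_expR -mulrN ler_pM2l.
  by rewrite /lyap; lra.
apply: le_trans h1 _; rewrite -mulrA ler_pM2l//.
have : expR (l * `|x - xs|) <= expR B * expR (c * `|x|) by rewrite -expRD ler_expR (addrC B).
move=> h; apply: le_trans h _; rewrite ler_pM2l ?expR_gt0//.
case: (leP `|x| 1) => h.
  apply: (@le_trans _ _ (expR c)); first by rewrite ler_expR ler_piMr// ltW.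
  by rewrite lerDl mulr_ge0 ?sqr_ge0// expR_ge0.
apply: (@le_trans _ _ (x ^+ 2 * expR (c * `|x|))); last by rewrite lerDr expR_ge0.
by rewrite ler_peMl ?expR_ge0// -(real_normK (num_real x)) exprn_ege1// ltW.
Qed.

Lemma lyap_initial (l c B C : R) (W : Om -> R) (xs : R) : measurable_fun setT W ->
  0 < l <= 1 -> l <= c -> `|xs| <= B ->
  ('E_P[(fun w => W w ^+ 2 * expR (c * `|W w|))%R] <= C%:E)%E ->
  L1 P (fun w => lyap l (W w - xs)) /\
  Ex P (fun w => lyap l (W w - xs)) <= 2 * expR B * (expR c + C).
Proof.
move=> mW l01 lc hB; rewrite unlock => hC.
have l0 : 0 < l by case/andP: l01.
have mE : measurable_fun setT (fun w => W w ^+ 2 * expR (c * `|W w|)) by meas.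
have LE : L1 P (fun w => W w ^+ 2 * expR (c * `|W w|)).
  apply: L1_ge0_lty => //; first by move=> w; rewrite mulr_ge0 ?sqr_ge0// expR_ge0.
  by apply: le_lt_trans hC _; rewrite ltry.
have EE : Ex P (fun w => W w ^+ 2 * expR (c * `|W w|)) <= C by rewrite -lee_fin (ExE LE).
have L2 := L1D (L1_cst P (expR c)) LE.
have mL : measurable_fun setT (fun w => lyap l (W w - xs)) by rewrite /lyap; meas.
have LL : L1 P (fun w => lyap l (W w - xs)).
  apply: L1_le (L1Z (2 * expR B) L2) => // w; rewrite ger0_norm ?lyap_ge0//.
  exact: lyap_exp_le.
split => //.
apply: (@le_trans _ _ (2 * expR B * Ex P (fun w => expR c + W w ^+ 2 * expR (c * `|W w|)))).
  by rewrite -(ExZ _ L2); apply: Ex_le => //; [exact: (L1Z _ L2)|move=> w; exact: lyap_exp_le].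
rewrite ler_pM2l ?mulr_gt0 ?expR_gt0//.
by rewrite (ExD (L1_cst P _) LE) Ex_cst lerD2l.
Qed.

End initial.

Lemma invr_natr_cvg0 {R : realType} : (fun K : nat => K%:R^-1 : R) @ \oo --> (0 : R).
Proof.
have := @pwV_cvg0 R 0; rewrite lexx invr_gt0 ltr0n => /(_ isT); apply: cvg_trans.
by apply: near_eq_cvg; apply: nearW => K; rewrite /pw oppr0 powRr0 divr1.
Qed.

(** * Rates of the remainders *)

Section rates.
Context {R : realType} (B gamma1 beta : R).
Hypotheses (B0 : 0 <= B) (gamma10 : 0 < gamma1) (hbeta : 2^-1 < beta < 1).
Let q k := B * pw beta k.
Let g k := gamma1 * pw beta k.
Let s k := Num.sqrt (q k).
Let sE k : s k = Num.sqrt B * pw (beta / 2) k.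
Proof.
rewrite /s /q sqrtrM//; congr (_ * _).
rewrite -[X in pw X k](_ : beta / 2 + beta / 2 = beta); last by field.
by rewrite pwD -expr2 sqrtr_sqr gtr0_norm// pw_gt0.
Qed.

Lemma sum_rate_cvg0 c : (fun K : nat => K%:R^-1 * (c * \sum_(k < K ^ 2) q k)) @ \oo --> (0 : R).
Proof.
have /andP[b1 b2] := hbeta.
have h : (fun K : nat => c * B * (K%:R^-1 * \sum_(k < K ^ 2) pw beta k)) @ \oo --> (0 : R).
  by rewrite -[X in _ --> X](mulr0 (c * B)); apply: cvgM; [exact: cvg_cst|exact: sum_pw_cvg0].
apply: cvg_trans h; apply: near_eq_cvg; apply: nearW => K.
by rewrite -mulr_sumr; ring.
Qed.

Let sqrt_cvg0 (u : nat -> R) : u @ \oo --> (0 : R) -> (fun K => Num.sqrt (u K)) @ \oo --> (0 : R).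
Proof.
by move=> h; rewrite -[X in _ --> X](@sqrtr0 R); apply: (cvg_comp _ _ h); exact: sqrt_continuous.
Qed.

Lemma sqrt_sum_cvg0 c (t : nat -> R) r b : 0 < r -> (forall k, t k = b * pw r k) ->
  (fun K : nat => K%:R^-1 * Num.sqrt (c * \sum_(k < K ^ 2) t k)) @ \oo --> (0 : R).
Proof.
move=> r0 ht.
have h : (fun K : nat => c * b * ((K%:R^-1) ^+ 2 * \sum_(k < K ^ 2) pw r k)) @ \oo --> (0 : R).
  by rewrite -[X in _ --> X](mulr0 (c * b)); apply: cvgM; [exact: cvg_cst|exact: sum_pw_cvg0_sqr].
have {}h := sqrt_cvg0 h.
apply: cvg_trans h; apply: near_eq_cvg; apply: nearW => K.
have -> : c * b * ((K%:R^-1) ^+ 2 * \sum_(k < K ^ 2) pw r k) = (K%:R^-1) ^+ 2 * (c * \sum_(k < K ^ 2) t k).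
  by under [in RHS]eq_bigr do rewrite ht; rewrite -mulr_sumr; ring.
by rewrite sqrtrM ?sqr_ge0// sqrtr_sqr ger0_norm// invr_ge0.
Qed.

Lemma chi_rate_cvg0 c c' : (fun K : nat => K%:R^-1 * (c * \sum_(k < K ^ 2) q k +
  Num.sqrt (c' * \sum_(k < K ^ 2) q k))) @ \oo --> (0 : R).
Proof.
have /andP[b1 b2] := hbeta.
rewrite -[X in _ --> X](addr0 (0 : R)).
under eq_fun do rewrite mulrDr.
apply: cvgD; first exact: sum_rate_cvg0.
by apply: (@sqrt_sum_cvg0 _ _ beta B) => //; apply: lt_trans b1.
Qed.

(** The error contributes the exponent [beta / 2] and the increment of [1 / g] the exponent
    [1 - beta]; the total exceeds one half because [beta < 1]. *)
Let abel_le k : 0 <= s k.+1 * ((g k.+1)^-1 - (g k)^-1) <= Num.sqrt B / gamma1 * pw (1 - beta / 2) k.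
Proof.
have /andP[b1 b2] := hbeta.
have b01 : 0 <= beta <= 1 by apply/andP; split; lra.
have /andP[i1 i2] := pwV_incr k b01.
have s0 : 0 <= Num.sqrt B := sqrtr_ge0 _.
have -> : s k.+1 * ((g k.+1)^-1 - (g k)^-1) =
    Num.sqrt B / gamma1 * (pw (beta / 2) k.+1 * ((pw beta k.+1)^-1 - (pw beta k)^-1)).
  by rewrite sE /g; field; rewrite !gt_eqF// pw_gt0.
have c0 : 0 <= Num.sqrt B / gamma1 by rewrite divr_ge0// ltW.
apply/andP; split; first by rewrite mulr_ge0// mulr_ge0// ltW// pw_gt0.
rewrite ler_wpM2l// (_ : 1 - beta / 2 = beta / 2 + (1 - beta)); last by field.
rewrite pwD; apply: ler_pM => //; first by rewrite ltW// pw_gt0.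
by apply: pw_dec; lra.
Qed.

Lemma xi_rate_cvg0 c : (fun K : nat => K%:R^-1 * (s 0 / g 0 + s (K ^ 2) / g (K ^ 2) +
  \sum_(k < K ^ 2) s k.+1 * ((g k.+1)^-1 - (g k)^-1) + Num.sqrt (c * \sum_(k < K ^ 2) s k)
  + c * \sum_(k < K ^ 2) q k)) @ \oo --> (0 : R).
Proof.
have /andP[b1 b2] := hbeta.
have i0 := @invr_natr_cvg0 R.
have t1 : (fun K : nat => K%:R^-1 * (s 0 / g 0)) @ \oo --> (0 : R).
  by rewrite -[X in _ --> X](mul0r (s 0 / g 0)); apply: cvgM => //; exact: cvg_cst.
have t2 : (fun K : nat => K%:R^-1 * (s (K ^ 2) / g (K ^ 2))) @ \oo --> (0 : R).
  have h : (fun K : nat => Num.sqrt B / gamma1 * (K%:R^-1 / pw (beta / 2) (K ^ 2))) @ \oo --> (0 : R).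
    rewrite -[X in _ --> X](mulr0 (Num.sqrt B / gamma1)); apply: cvgM; first exact: cvg_cst.
    by apply: pwV_cvg0; apply/andP; split; lra.
  apply: cvg_trans h; apply: near_eq_cvg; apply: nearW => K.
  have pE : pw beta (K ^ 2) = pw (beta / 2) (K ^ 2) * pw (beta / 2) (K ^ 2).
    by rewrite -pwD; congr (pw _ _); field.
  rewrite sE /g pE mulrCA; congr (_ * _).
  by field; rewrite !gt_eqF// pw_gt0.
have t3 : (fun K : nat => K%:R^-1 * \sum_(k < K ^ 2) s k.+1 * ((g k.+1)^-1 - (g k)^-1)) @ \oo --> (0 : R).
  have h : (fun K : nat => Num.sqrt B / gamma1 * (K%:R^-1 * \sum_(k < K ^ 2) pw (1 - beta / 2) k)) @ \oo --> (0 : R).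
    rewrite -[X in _ --> X](mulr0 (Num.sqrt B / gamma1)); apply: cvgM; first exact: cvg_cst.
    by apply: sum_pw_cvg0; lra.
  apply: (squeeze_cvgr _ (cvg_cst 0) h); apply: nearW => K.
  apply/andP; split.
    by rewrite mulr_ge0 ?invr_ge0// sumr_ge0// => k _; case/andP: (abel_le k).
  rewrite mulrCA ler_wpM2l ?invr_ge0// mulr_sumr; apply: ler_sum => k _.
  by case/andP: (abel_le k).
have t4 : (fun K : nat => K%:R^-1 * Num.sqrt (c * \sum_(k < K ^ 2) s k)) @ \oo --> (0 : R).
  by apply: (@sqrt_sum_cvg0 c s (beta / 2) (Num.sqrt B)); [lra|exact: sE].
have t5 := cvgD (cvgD (cvgD (cvgD t1 t2) t3) t4) (sum_rate_cvg0 c); rewrite !addr0 in t5.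
by under eq_fun do rewrite !mulrDr; exact: t5.
Qed.

Lemma last_rate_cvg0 : (fun K : nat => K%:R^-1 * s (K ^ 2)) @ \oo --> (0 : R).
Proof.
have /andP[b1 b2] := hbeta.
have i0 := @invr_natr_cvg0 R.
have h : (fun K : nat => Num.sqrt B * K%:R^-1) @ \oo --> (0 : R).
  by rewrite -[X in _ --> X](mulr0 (Num.sqrt B)); apply: cvgM => //; exact: cvg_cst.
apply: (squeeze_cvgr _ (cvg_cst 0) h); apply: nearW => K.
have b0 : 0 <= beta / 2 by lra.
apply/andP; split; first by rewrite mulr_ge0 ?invr_ge0// sqrtr_ge0.
by rewrite sE mulrCA ler_wpM2l ?sqrtr_ge0// ler_piMr ?invr_ge0// pw_le1.
Qed.

End rates.

(** * Errors at a fixed bias level *)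

Section level.
Context {R : realType} {d : measure_display} {Om : measurableType d} (P : probability Om R).
Variables (alpha : R) (gam : nat -> R) (Xs : nat -> Om -> R) (xi0 : Om -> R) (X : Om -> R).
Hypothesis alpha01 : 0 < alpha < 1.
Hypotheses (mxi0 : measurable_fun setT xi0) (mXs : forall n, measurable_fun setT (Xs n))
  (mX : measurable_fun setT X) (LX2 : L1 P (fun w => X w ^+ 2)) (lawX : forall n, same_law P (Xs n) X)
  (indX : forall N, indep_family P xi0 Xs N).
Hypotheses (g0 : forall n, 0 < gam n.+1) (gdec : forall n, gam n.+2 <= gam n.+1).
Variables (xs fx M L : R) (q : nat -> R) (K : nat).
Let a : R := (1 - alpha)^-1.
Let n := (K ^ 2)%N.
Let De k w := (nsa alpha gam Xs xi0 k w).1 - xs.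
Let s k := Num.sqrt (q k).
Let e1 := Ex P (fun w => posp (X w - xs)).
Let e2 := Ex P (fun w => posp (X w - xs) ^+ 2).
Hypotheses (K0 : (0 < K)%N) (fx0 : 0 < fx) (M0 : 0 <= M) (q0 : forall k, 0 <= q k).
Hypotheses (LDe : forall k, L1 P (fun w => ((nsa alpha gam Xs xi0 k w).1 - xs) ^+ 2))
  (EDe : forall k, Ex P (fun w => ((nsa alpha gam Xs xi0 k w).1 - xs) ^+ 2) <= q k).
Hypotheses (Dxs : meanH P alpha X xs = 0)
  (Dlin : forall x, `|meanH P alpha X x - (1 - alpha)^-1 * fx * (x - xs)| <= M * (x - xs) ^+ 2)
  (Dlip : forall x y, `|meanH P alpha X x - meanH P alpha X y| <= L * `|x - y|)
  (Hvar : forall x, Ex P (fun w => (H1 alpha x (X w) - H1 alpha xs (X w)) ^+ 2) <= M * `|x - xs|)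
  (Vsq : forall x, 0 <= Vfun P alpha X x - Vfun P alpha X xs <= M * (x - xs) ^+ 2).

Definition influence_mean_sum (u1 u2 : R) w : R :=
  K%:R^-1 * \sum_(k < n) influence alpha fx e1 xs u1 u2 (Xs k w).

Definition xi_error w : R := K%:R * (xibar alpha gam Xs xi0 n w - xs).
Definition chi_error w : R := K%:R * ((nsa alpha gam Xs xi0 n w).2 - Vfun P alpha X xs).

Let k0 : 0 < K%:R :> R. Proof. by rewrite ltr0n. Qed.
Let a0 : 0 < a. Proof. exact: lt_trans (a_gt1 alpha01). Qed.
Let LX : L1 P X. Proof. exact: L1_sqr_le. Qed.
Let mxi k : measurable_fun setT (fun w => (nsa alpha gam Xs xi0 k w).1).
Proof. exact: (xi_measurable alpha gam mxi0 mXs). Qed.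
Let mDe k : measurable_fun setT (De k). Proof. by apply: measurable_funB. Qed.
Let L1De k : L1 P (De k). Proof. by apply: L1_sqr_le => //; exact: LDe. Qed.
Let mH x : measurable_fun setT (H1 alpha x).
Proof.
by apply: (measurableT_comp (H1_measurable alpha) (g := fun y => (x, y))); apply: measurable_fun_pair.
Qed.
Let LH k : L1 P (fun w => H1 alpha xs (Xs k w)).
Proof.
apply: (@L1_bounded _ _ _ _ _ a); last by move=> w; exact: H1_bound.
exact: (measurableT_comp (mH xs)).
Qed.
Let mGx x : measurable_fun setT (Gfun alpha x).
Proof.
by apply: (measurableT_comp (Gfun_measurable alpha) (g := fun y => (x, y))); apply: measurable_fun_pair.
Qed.
Let LG k : L1 P (fun w => Gfun alpha xs (Xs k w)).
Proof. exact: (same_law_L1 (mXs k) mX (lawX k) (mGx xs) (L1_Gfun alpha LX xs)). Qed.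

Let Ex_De k : Ex P (fun w => `|De k w|) <= s k.
Proof.
by apply: Ex_norm_sqrt; [exact: sqrtr_ge0| |exact: LDe|rewrite sqr_sqrtr//; exact: EDe].
Qed.

(** The average runs over the ranks [1] to [n], the remainder estimates over [0] to [n - 1]; the two
    end terms make up the difference. *)
Lemma xibar_sum w : xi_error w = K%:R^-1 * (\sum_(k < n) De k w + (De n w - De 0 w)).
Proof.
have tel m : \sum_(k < m) (nsa alpha gam Xs xi0 k.+1 w).1 =
    \sum_(k < m) De k w + (De m w - De 0 w) + m%:R * xs.
  elim: m => [|m IH]; first by rewrite !big_ord0 subrr mul0r !addr0.
  by rewrite !big_ord_recr IH /De -natr1 /=; ring.
rewrite /xi_error /xibar big_add1 /= big_mkord tel /n natrX.
by field; rewrite gt_eqF.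
Qed.

Let influence_sumE w u1 u2 : influence_mean_sum u1 u2 w =
  u1 * - ((a * fx)^-1 * (K%:R^-1 * \sum_(k < n) H1 alpha xs (Xs k w))) +
  u2 * (K%:R^-1 * \sum_(k < n) (Gfun alpha xs (Xs k w) - Vfun P alpha X xs)).
Proof.
have VE : Vfun P alpha X xs = xs + a * e1 by rewrite /Vfun EfineE.
have E (k : 'I_n) : influence alpha fx e1 xs u1 u2 (Xs k w) =
    - (u1 * (a * fx)^-1) * H1 alpha xs (Xs k w) + u2 * (Gfun alpha xs (Xs k w) - Vfun P alpha X xs).
  by rewrite /influence /Gfun VE -/a; ring.
rewrite /influence_mean_sum; under eq_bigr do rewrite E.
by rewrite big_split/= -!mulr_sumr; ring.
Qed.

Lemma influence_sum_lin w u1 u2 :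
  influence_mean_sum u1 u2 w = u1 * influence_mean_sum 1 0 w + u2 * influence_mean_sum 0 1 w.
Proof. by rewrite !influence_sumE; ring. Qed.

Lemma xi_error_L1 : L1 P xi_error.
Proof.
have LS : L1 P (fun w => \sum_(k < n) De k w) by apply: L1_sum => k; exact: L1De.
have Lw := L1Z K%:R^-1 (L1D LS (L1B (L1De n) (L1De 0))).
by apply: eq_integrable Lw => // w _ /=; rewrite xibar_sum.
Qed.

Lemma chi_error_L1 : L1 P chi_error.
Proof.
have LGk (k : 'I_n) : L1 P (fun w => Gfun alpha (nsa alpha gam Xs xi0 k w).1 (Xs k w)).
  apply: (@L1_le _ _ _ _ _ (fun w => (1 + a) * `|De k w| + `|Gfun alpha xs (Xs k w)|)).
  - exact: (measurableT_comp (Gfun_measurable alpha) (measurable_fun_pair (mxi k) (mXs k))).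
  - move=> w; have := Gfun_lip alpha01 (nsa alpha gam Xs xi0 k w).1 xs (Xs k w); rewrite -/(De k w) -/a.
    have := ler_normD (Gfun alpha (nsa alpha gam Xs xi0 k w).1 (Xs k w) - Gfun alpha xs (Xs k w)) (Gfun alpha xs (Xs k w)).
    by rewrite subrK; lra.
  - by apply: L1D; [apply: L1Z; apply: L1_norm|apply: L1_norm].
have Lw := L1Z K%:R (L1B (L1Z n%:R^-1 (L1_sum (index_enum _) LGk)) (L1_cst P (Vfun P alpha X xs))).
apply: eq_integrable Lw => // w _ /=.
rewrite /chi_error -(chi_sum alpha gam Xs xi0 n w) mulKf// pnatr_eq0 -lt0n expn_gt0.
by rewrite K0.
Qed.

Lemma influence_sum_sqr u1 u2 : L1 P (fun w => influence_mean_sum u1 u2 w ^+ 2) /\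
  Ex P (fun w => influence_mean_sum u1 u2 w ^+ 2) <= cov_form alpha fx e1 e2 u1 u2.
Proof.
pose U := influence alpha fx e1 xs u1 u2.
have mU : measurable_fun setT U by exact: influence_measurable.
have [LU EU2] := influence_sqr alpha01 mX LX2 Dxs fx0 u1 u2.
have EU := influence_mean fx alpha01 mX LX2 Dxs u1 u2.
have mU2 : measurable_fun setT (fun x => U x ^+ 2) by exact: measurable_funX.
have LUk k : L1 P (fun w => U (Xs k w) ^+ 2) by exact: (same_law_L1 (mXs k) mX (lawX k) mU2 LU).
have mUX : measurable_fun setT (fun w => U (X w)) by exact: measurableT_comp.
have EUk k : Ex P (fun w => U (Xs k w)) = 0.
  by rewrite (same_law_Ex (mXs k) mX (lawX k) mU)//; exact: (L1_sqr_le mUX LU).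
have EU2k k : Ex P (fun w => U (Xs k w) ^+ 2) <= cov_form alpha fx e1 e2 u1 u2.
  by rewrite (same_law_Ex (mXs k) mX (lawX k) mU2 LU) -EU2.
(* A sum of independent centered variables is treated as a martingale whose state stays at [xi0]. *)
have [LM EM] := martingale_sqr mxi0 mXs (@measurable_id _ _ setT) (Phi := fun k (z : R * R) => z.1)
  (fun k => measurable_fst) (S := fun k w => xi0 w) (fun w => erefl) (fun k w => erefl) (indX n)
  (e := fun z : R * R => U z.2) (v := fun _ => cov_form alpha fx e1 e2 u1 u2)
  (measurableT_comp mU measurable_snd) (measurable_cst _) LUk (fun k _ => LUk k) (fun k _ => EUk k)
  (fun k _ => EU2k k) (fun k => L1_cst P _) (leqnn n).
have kn : (K%:R^-1) ^+ 2 * n%:R = 1 :> R by rewrite /n natrX exprVn mulVf// expf_neq0 ?gt_eqF.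
split; first exact: L1_sqrZ.
rewrite /influence_mean_sum; under [X in Ex P X]eq_fun do rewrite exprMn.
rewrite (ExZ _ LM); apply: le_trans (ler_wpM2l (sqr_ge0 _) EM) _.
under eq_bigr do rewrite Ex_cst.
by rewrite sumr_const card_ord -[X in _ * X]mulr_natl mulrA kn mul1r.
Qed.

Lemma influence_sum_measurable u1 u2 : measurable_fun setT (influence_mean_sum u1 u2).
Proof.
apply: measurable_funM => //; apply: measurable_sum => k.
exact: (measurableT_comp (influence_measurable _ _ _ _ _ _) (mXs k)).
Qed.

Let LW u1 u2 : L1 P (influence_mean_sum u1 u2).
Proof. by apply: L1_sqr_le; [exact: influence_sum_measurable|case: (influence_sum_sqr u1 u2)]. Qed.

Lemma xi_error_approx : Ex P (fun w => `|xi_error w - influence_mean_sum 1 0 w|) <=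
  (a * fx)^-1 * (K%:R^-1 * (s 0 / gam 1 + s n / gam n.+1 +
    \sum_(k < n) s k.+1 * ((gam k.+2)^-1 - (gam k.+1)^-1) + Num.sqrt (M * \sum_(k < n) s k)
    + M * \sum_(k < n) q k)) + K%:R^-1 * (s n + s 0).
Proof.
have h := xi_remainder alpha01 mxi0 mXs mX lawX indX g0 gdec M0 q0 LDe EDe Dxs Dlin Dlip Hvar n.
have b0 : 0 < a * fx by rewrite mulr_gt0.
pose R1 w := a * fx * (\sum_(k < n) De k w) + \sum_(k < n) H1 alpha xs (Xs k w).
have LR1 : L1 P R1 by apply: L1D; [apply: L1Z|]; apply: L1_sum => k; [exact: L1De|exact: LH].
have LnR1 := L1_norm LR1.
have Ln := L1_norm (L1De n); have L0 := L1_norm (L1De 0).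
have L3 := L1D (L1Z ((a * fx)^-1 * K%:R^-1) LnR1) (L1Z K%:R^-1 (L1D Ln L0)).
apply: (@le_trans _ _ (Ex P (fun w => (a * fx)^-1 * K%:R^-1 * `|R1 w| + K%:R^-1 * (`|De n w| + `|De 0 w|)))).
  apply: Ex_le => //; first by apply: L1_norm; exact: (L1B xi_error_L1 (LW 1 0)).
  move=> w; have -> : xi_error w - influence_mean_sum 1 0 w =
      (a * fx)^-1 * K%:R^-1 * R1 w + K%:R^-1 * (De n w - De 0 w).
    rewrite xibar_sum influence_sumE /R1; set SD := \sum_(k < n) De k w; set SH := \sum_(k < n) _.
    by field; rewrite !gt_eqF.
  apply: le_trans (ler_normD _ _) _; apply: lerD.
    by rewrite normrM gtr0_norm// mulr_gt0// invr_gt0.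
  by rewrite normrM gtr0_norm ?invr_gt0// ler_wpM2l ?invr_ge0 ?(ltW k0)//; exact: ler_normB.
rewrite (ExD (L1Z _ LnR1) (L1Z _ (L1D Ln L0))) (ExZ _ LnR1) (ExZ _ (L1D Ln L0)) (ExD Ln L0).
rewrite -mulrA; apply: lerD; rewrite ?ler_pM2l ?invr_gt0//.
by apply: lerD; exact: Ex_De.
Qed.

Lemma chi_error_approx : Ex P (fun w => `|chi_error w - influence_mean_sum 0 1 w|) <=
  K%:R^-1 * (M * \sum_(k < n) q k + Num.sqrt ((1 + a) ^+ 2 * \sum_(k < n) q k)).
Proof.
have h := chi_remainder alpha01 mxi0 mXs LX lawX indX M0 q0 LDe EDe Vsq n.
set R2 := (fun w => `|n%:R * _ - _ - _|) in h.
have E : (fun w => `|chi_error w - influence_mean_sum 0 1 w|) = (fun w => K%:R^-1 * R2 w).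
  apply/funext => w; rewrite influence_sumE mul0r add0r mul1r /R2 /chi_error.
  rewrite -[K%:R^-1 in RHS]gtr0_norm ?invr_gt0// -normrM; congr `|_|.
  rewrite /n natrX; set SG := \sum_(k < _) _.
  by field; rewrite gt_eqF.
have LR : L1 P R2.
  have Ln := L1_norm (L1B chi_error_L1 (LW 0 1)); rewrite E in Ln; have Lw := L1Z K%:R Ln.
  by apply: eq_integrable Lw => // w _ /=; rewrite mulVKf// gt_eqF.
by rewrite E (ExZ _ LR) ler_pM2l ?invr_gt0.
Qed.

End level.

Lemma cos_lipschitz {R : realType} (x y : R) : `|cos x - cos y| <= `|x - y|.
Proof.
wlog xy : x y / x <= y.
  by move=> h; case: (leP x y) => [/h //|/ltW/h]; rewrite distrC (distrC y).
have [z _ e] := MVT_segment xy (fun z _ => is_derive_cos z)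
  (continuous_subspaceT (@continuous_cos R)).
rewrite distrC e normrM normrN (distrC x) ler_piMl//.
by rewrite ler_norml sin_geN1 sin_le1.
Qed.

(** * The central limit theorem for the scheme *)

Section nsa_clt.
Context {R : realType} {d : measure_display} {Om : measurableType d} (P : probability Om R).
Variables (alpha gamma1 beta : R) (Xs : nat -> nat -> Om -> R) (xi0 X : nat -> Om -> R)
  (f : nat -> R -> R) (xis : nat -> R) (M c B l A0 fl e1 e2 : R) (K0 : nat)
  (mu : probability (R * R)%type R).
Let gam (n : nat) : R := gamma1 * n%:R `^ (- beta).
Let e1K K := Ex P (fun w => posp (X K w - xis K)).
Let e2K K := Ex P (fun w => posp (X K w - xis K) ^+ 2).
Hypotheses (alpha01 : 0 < alpha < 1) (gamma10 : 0 < gamma1) (hbeta : 2^-1 < beta < 1)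
  (K00 : (0 < K0)%N)
  (mxi0 : forall K, (K0 <= K)%N -> measurable_fun setT (xi0 K))
  (mXs : forall K, (K0 <= K)%N -> forall n, measurable_fun setT (Xs K n))
  (mX : forall K, (K0 <= K)%N -> measurable_fun setT (X K))
  (LX2 : forall K, (K0 <= K)%N -> L1 P (fun w => X K w ^+ 2))
  (lawX : forall K, (K0 <= K)%N -> forall n, same_law P (Xs K n) (X K))
  (indX : forall K, (K0 <= K)%N -> forall N, indep_family P (xi0 K) (Xs K) N)
  (pdfX : forall K, (K0 <= K)%N -> is_pdf P (X K) (f K))
  (fge0 : forall K, (K0 <= K)%N -> forall x, 0 <= f K x)
  (fM : forall K, (K0 <= K)%N -> forall x, f K x <= M)
  (flip : forall K, (K0 <= K)%N -> forall x y, `|f K x - f K y| <= M * `|x - y|)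
  (hmin : forall K, (K0 <= K)%N -> is_minimizer (Vfun P alpha (X K)) (xis K))
  (c0 : 0 < c) (fc : forall K, (K0 <= K)%N -> forall u, `|u - xis K| <= 1 -> c <= f K u)
  (hB : forall K, (K0 <= K)%N -> `|xis K| + `|e1K K| <= B)
  (l01 : 0 < l <= 1) (lg : l * gamma1 * (1 - alpha)^-1 <= 2^-1)
  (Linit : forall K, (K0 <= K)%N -> L1 P (fun w => lyap l (xi0 K w - xis K)))
  (Einit : forall K, (K0 <= K)%N -> Ex P (fun w => lyap l (xi0 K w - xis K)) <= A0)
  (UI : forall e, 0 < e -> exists2 r, 0 <= r & forall K, (K0 <= K)%N ->
    Ex P (fun w => tailsq r (X K w)) <= e)
  (fl0 : 0 < fl) (fcvg : (fun K => f K (xis K)) @ \oo --> fl)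
  (e1cvg : e1K @ \oo --> e1) (e2cvg : e2K @ \oo --> e2)
  (muE : forall u v t, Ex mu (fun p => cos (u * p.1 + v * p.2 + t)) =
    cos t * expR (- (cov_form alpha fl e1 e2 u v / 2))).

Let a : R := (1 - alpha)^-1.
Let a0 : 0 < a. Proof. exact: lt_trans (a_gt1 alpha01). Qed.
Let a1 : 1 < a. Proof. exact: a_gt1. Qed.
Let fx K : R := f K (xis K).
Let fx0 K : (K0 <= K)%N -> c <= fx K.
Proof. by move=> k; apply: fc => //; rewrite subrr normr0. Qed.
Let fxp K : (K0 <= K)%N -> 0 < fx K. Proof. by move=> /fx0; apply: lt_le_trans. Qed.
Let Kp K : (K0 <= K)%N -> (0 < K)%N. Proof. exact: leq_trans. Qed.
Let LX K : (K0 <= K)%N -> L1 P (X K). Proof. by move=> k; apply: L1_sqr_le; [exact: mX|exact: LX2]. Qed.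
Let Dxs K : (K0 <= K)%N -> meanH P alpha (X K) (xis K) = 0.
Proof. by move=> k; exact: (meanH_min0 alpha01 (LX k) (pdfX k) (fge0 k) (fM k) (flip k) (hmin k)). Qed.

Let W K u v := influence_mean_sum P alpha (Xs K) (X K) (xis K) (fx K) K u v.
Let V1 K := xi_error alpha gam (Xs K) (xi0 K) (xis K) K.
Let V2 K := chi_error P alpha gam (Xs K) (xi0 K) (X K) (xis K) K.

(** The bounds at a fixed level depend on [K] only through the horizon [K^2], the normalization and
    the density [fx K], which tends to [fl > 0]. *)
Let errors_approx : exists r : nat -> R, r @ \oo --> (0 : R) /\ forall K, (K0 <= K)%N ->
  [/\ L1 P (V1 K), L1 P (V2 K), Ex P (fun w => `|V1 K w - W K 1 0 w|) <= r K &
      Ex P (fun w => `|V2 K w - W K 0 1 w|) <= r K].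
Proof.
have /andP[b1 b2] := hbeta.
have b0 : 0 < beta by lra.
have b01 : 0 <= beta < 1 by rewrite (ltW b0).
have ac0 : 0 < a * c by rewrite mulr_gt0.
have [A A00 HA] := SA_sqr_bound P A0 alpha01 gamma10 b01 ac0 l01 lg b0.
have AL K : (K0 <= K)%N -> forall n, L1 P (fun w => ((nsa alpha gam (Xs K) (xi0 K) n w).1 - xis K) ^+ 2) /\
    Ex P (fun w => ((nsa alpha gam (Xs K) (xi0 K) n w).1 - xis K) ^+ 2) <= A * (gamma1 * pw beta n).
  move=> k; apply: (HA (Xs K) (xi0 K) (X K) (xis K)); [exact: mxi0|exact: mXs|exact: mX|exact: lawX|
    exact: indX| | |exact: Linit|exact: Einit].
    exact: (meanH_drift_r alpha01 (LX k) (pdfX k) (fge0 k) (fM k) (flip k) (hmin k) (fc k)).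
  exact: (meanH_drift_l alpha01 (LX k) (pdfX k) (fge0 k) (fM k) (flip k) (hmin k) (fc k)).
pose q k := A * gamma1 * pw beta k.
have q0 k : 0 <= q k by rewrite !mulr_ge0 ?(ltW gamma10)// ltW// pw_gt0.
have LDe K (k : (K0 <= K)%N) n := proj1 (AL K k n).
have EDe K (k : (K0 <= K)%N) n : Ex P (fun w => ((nsa alpha gam (Xs K) (xi0 K) n w).1 - xis K) ^+ 2) <= q n.
  by rewrite /q -mulrA; exact: (proj2 (AL K k n)).
have g0 n : 0 < gam n.+1 by rewrite mulr_gt0//; exact: (pw_gt0 beta n).
have gdec n : gam n.+2 <= gam n.+1.
  by rewrite ler_pM2l//; exact: (pw_dec n (ltW b0)).
have B0 : 0 <= A * gamma1 by rewrite mulr_ge0// ltW.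
have M0 : 0 <= M by apply: le_trans (fM (leqnn K0) 0); exact: fge0.
have M2 : 0 <= a ^+ 2 * M by rewrite mulr_ge0// sqr_ge0.
(* As [a > 1], the single constant [a ^+ 2 * M] serves for the linearization, the variance and the
   quadratic bound. *)
have aM : a * M <= a ^+ 2 * M by rewrite ler_wpM2r// ler_eXnr// ltW.
pose r1 K := (a * fx K)^-1 * (K%:R^-1 * (Num.sqrt (q 0) / gam 1 + Num.sqrt (q (K ^ 2)%N) / gam (K ^ 2).+1 +
    \sum_(k < K ^ 2) Num.sqrt (q k.+1) * ((gam k.+2)^-1 - (gam k.+1)^-1)
    + Num.sqrt (a ^+ 2 * M * \sum_(k < K ^ 2) Num.sqrt (q k))
    + a ^+ 2 * M * \sum_(k < K ^ 2) q k)) + K%:R^-1 * (Num.sqrt (q (K ^ 2)%N) + Num.sqrt (q 0)).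
pose r2 K := K%:R^-1 * (a ^+ 2 * M * \sum_(k < K ^ 2) q k + Num.sqrt ((1 + a) ^+ 2 * \sum_(k < K ^ 2) q k)).
have r1c : r1 @ \oo --> (0 : R).
  have t1 : (fun K => (a * fx K)^-1) @ \oo --> (a * fl)^-1.
    by apply: cvgV; [rewrite mulf_neq0 ?gt_eqF|apply: cvgM => //; exact: cvg_cst].
  have t2 := xi_rate_cvg0 B0 gamma10 hbeta (a ^+ 2 * M).
  have t3 := last_rate_cvg0 B0 hbeta.
  have t4 : (fun K : nat => K%:R^-1 * Num.sqrt (q 0)) @ \oo --> (0 : R).
    rewrite -[X in _ --> X](mul0r (Num.sqrt (q 0))); apply: cvgM; [exact: invr_natr_cvg0|exact: cvg_cst].
  have t5 := cvgD (cvgM t1 t2) (cvgD t3 t4); rewrite mulr0 !addr0 in t5.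
  by rewrite /r1; under eq_fun do rewrite [_ * (Num.sqrt (q (_ ^ 2)%N) + _)]mulrDr; exact: t5.
have r2c : r2 @ \oo --> (0 : R) by exact: (chi_rate_cvg0 (A * gamma1) hbeta (a ^+ 2 * M) ((1 + a) ^+ 2)).
exists (fun K => `|r1 K| + `|r2 K|); split.
  rewrite -[X in _ --> X]addr0 -(@normr0 R R).
  by apply: cvgD; apply: (@cvg_norm _ R^o).
move=> K k; split.
- exact: (xi_error_L1 (mxi0 k) (mXs k) (Kp k) (LDe K k)).
- exact: (chi_error_L1 alpha01 (mxi0 k) (mXs k) (mX k) (LX2 k) (lawX k) (Kp k) (LDe K k)).
- apply: (@le_trans _ _ (r1 K)); last by apply: le_trans (ler_norm _) _; rewrite lerDl.
  apply: (xi_error_approx alpha01 (mxi0 k) (mXs k) (mX k) (LX2 k) (lawX k) (indX k) g0 gdec (Kp k) (fxp k)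
    M2 q0 (LDe K k) (EDe K k) (Dxs k)) => [x|x y|x].
  + apply: le_trans (meanH_lin alpha01 (LX k) (pdfX k) (fge0 k) (fM k) (flip k) (hmin k) x) _.
    by rewrite ler_wpM2r ?sqr_ge0.
  + exact: (meanH_lip alpha01 (LX k) (pdfX k) (fge0 k) (fM k) (flip k) x y).
  + exact: (meanH_var alpha (LX k) (pdfX k) (fge0 k) (fM k) (flip k) x (xis K)).
- apply: (@le_trans _ _ (r2 K)); last by apply: le_trans (ler_norm _) _; rewrite lerDr.
  apply: (chi_error_approx alpha01 (mxi0 k) (mXs k) (mX k) (LX2 k) (lawX k) (indX k) (Kp k) (fxp k)
    M2 q0 (LDe K k) (EDe K k) (Dxs k)) => x.
  have /andP[h1 h2] := Vfun_sqr alpha01 (LX k) (pdfX k) (fge0 k) (fM k) (flip k) (hmin k) x.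
  by rewrite h1 (le_trans h2)// ler_wpM2r ?sqr_ge0.
Qed.

Let sig2_cvg u v : (fun K => cov_form alpha (fx K) (e1K K) (e2K K) u v) @ \oo --> cov_form alpha fl e1 e2 u v.
Proof.
have cc (k : R) : (fun _ : nat => k) @ \oo --> k by exact: cvg_cst.
have i : (fun K => (fx K)^-1) @ \oo --> fl^-1 by apply: cvgV => //; rewrite gt_eqF.
have i2 : (fun K => (fx K ^+ 2)^-1) @ \oo --> (fl ^+ 2)^-1.
  apply: cvgV; first by rewrite expf_neq0// gt_eqF.
  by rewrite expr2; under eq_fun do rewrite expr2; exact: cvgM.
have s1 : (fun K => e1K K ^+ 2) @ \oo --> e1 ^+ 2.
  by rewrite expr2; under eq_fun do rewrite expr2; exact: cvgM.
have cM (x y : nat -> R) (p q : R) : x @ \oo --> p -> y @ \oo --> q -> (fun K => x K * y K) @ \oo --> p * q.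
  by move=> hx hy; exact: cvgM.
have cD (x y : nat -> R) (p q : R) : x @ \oo --> p -> y @ \oo --> q -> (fun K => x K + y K) @ \oo --> p + q.
  by move=> hx hy; exact: cvgD.
have cB (x y : nat -> R) (p q : R) : x @ \oo --> p -> y @ \oo --> q -> (fun K => x K - y K) @ \oo --> p - q.
  by move=> hx hy; exact: cvgB.
have t1 := cM _ _ _ _ (cc (u ^+ 2)) (cM _ _ _ _ (cc (alpha * (1 - alpha))) i2).
have t2 := cM _ _ _ _ (cc (2 * u * v)) (cM _ _ _ _ (cM _ _ _ _ (cc (alpha / (1 - alpha))) e1cvg) i).
have t3 := cM _ _ _ _ (cc (v ^+ 2)) (cM _ _ _ _ (cB _ _ _ _ e2cvg s1) (cc ((1 - alpha) ^+ 2)^-1)).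
exact: (cD _ _ _ _ (cD _ _ _ _ t1 t2) t3).
Qed.

Let lind u v e : 0 < e -> exists2 r, 0 <= r & forall K, (K0 <= K)%N ->
  Ex P (fun w => tailsq r (influence alpha (fx K) (e1K K) (xis K) u v (X K w))) <= e.
Proof.
move=> e0.
have B0 : 0 <= B by apply: le_trans (hB (leqnn K0)); rewrite addr_ge0.
pose C := `|u| / c + `|v| * a * (B + 1).
have C0 : 0 <= C by rewrite addr_ge0 ?divr_ge0 ?(ltW c0)// mulr_ge0 ?addr_ge0// mulr_ge0// ltW.
have C1 : 0 < 4 * C ^+ 2 + 1 by rewrite ltr_wpDl// mulr_ge0// sqr_ge0.
have e1' : 0 < e / (4 * C ^+ 2 + 1) by rewrite divr_gt0.
have [r r0 Hr] := UI e1'.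
pose s := Num.max r 1.
have s1 : 1 <= s by rewrite le_max lexx orbT.
have rs : r <= s by rewrite le_max lexx.
exists (C * (1 + s)); first by rewrite mulr_ge0// addr_ge0// (le_trans ler01).
move=> K k.
have mt t := @measurable_tailsq R t.
have Lt t : L1 P (fun w => tailsq t (X K w)).
  apply: L1_le (LX2 k); first exact: (measurableT_comp (mt t) (mX k)).
  by move=> w; rewrite ger0_norm ?tailsq_ge0 ?tailsq_le.
have mU := influence_measurable alpha (xis K) (fx K) (e1K K) u v.
have [LU _] := influence_sqr alpha01 (mX k) (LX2 k) (Dxs k) (fxp k) u v.
apply: (@le_trans _ _ (4 * C ^+ 2 * Ex P (fun w => tailsq r (X K w)))).
  rewrite -(ExZ _ (Lt r)); apply: Ex_le => [||w]; [|exact: (L1Z _ (Lt r))|].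
    apply: L1_le LU; first exact: (measurableT_comp (mt _) (measurableT_comp mU (mX k))).
    by move=> w; rewrite ger0_norm ?tailsq_ge0 ?tailsq_le.
  apply: (@le_trans _ _ (4 * C ^+ 2 * tailsq s (X K w))).
    have hb := influence_bound alpha01 (fxp k) u v (X K w) c0 (fx0 k) (hB k).
    exact: (tailsq_affine C0 s1 hb).
  by rewrite ler_wpM2l ?mulr_ge0 ?sqr_ge0// tailsq_decr.
apply: le_trans (ler_wpM2l _ (Hr _ k)) _; first by rewrite mulr_ge0// sqr_ge0.
by rewrite mulrA ler_pdivrMr// mulrC ler_wpM2l ?(ltW e0)// lerDl.
Qed.

Let clt u v t : (fun K => Ex P (fun w => cos (W K u v w + t))) @ \oo -->
  cos t * expR (- (cov_form alpha fl e1 e2 u v / 2)).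
Proof.
apply: (@triangular_clt _ _ _ _ _ P xi0 Xs X (fun K => influence alpha (fx K) (e1K K) (xis K) u v)
  (fun K => cov_form alpha (fx K) (e1K K) (e2K K) u v) _ K0) => // [K k|K k|K k|K k|].
- exact: influence_measurable.
- by case: (influence_sqr alpha01 (mX k) (LX2 k) (Dxs k) (fxp k) u v).
- exact: (influence_mean (fx K) alpha01 (mX k) (LX2 k) (Dxs k) u v).
- by case: (influence_sqr alpha01 (mX k) (LX2 k) (Dxs k) (fxp k) u v).
- exact: lind.
Qed.

(** Cosine is 1-Lipschitz, so closeness in [L^1] transfers the limit of the characteristic functions
    from the normalized sums to the errors; the variances of the sums provide the uniform first
    moments. *)
Theorem nsa_clt : cvg_law P (fun K w => (V1 K w, V2 K w)) mu.
Proof.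
have [r [rc Hr]] := errors_approx.
have Wsq K (k : (K0 <= K)%N) u v := influence_sum_sqr alpha01 (mxi0 k) (mXs k) (mX k) (LX2 k)
  (lawX k) (indX k) (Kp k) (fxp k) (Dxs k) u v.
have LW K u v (k : (K0 <= K)%N) : L1 P (W K u v).
  apply: L1_sqr_le (proj1 (Wsq K k u v)).
  exact: (influence_sum_measurable P alpha (X K) (mXs k)).
(* The 3 adds the bound 1 on [r K], the 1 in [|x| <= 1 + x^2], and the bound 1 on the excess of a
   variance over the modulus of its limit. *)
pose C := `|cov_form alpha fl e1 e2 1 0| + `|cov_form alpha fl e1 e2 0 1| + 3.
have bnd u v : \forall K \near \oo, cov_form alpha (fx K) (e1K K) (e2K K) u v <= `|cov_form alpha fl e1 e2 u v| + 1.
  move/cvgrPdist_le : (@sig2_cvg u v) => /(_ _ ltr01); apply: filterS => K.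
  by rewrite distrC ler_norml => /andP[_]; have := ler_norm (cov_form alpha fl e1 e2 u v); lra.
have rb : \forall K \near \oo, r K <= 1.
  move/cvgrPdist_le : rc => /(_ _ ltr01); apply: filterS => K.
  by rewrite sub0r normrN; apply: le_trans; exact: ler_norm.
have [K1 [K01 HK1]] : exists K1, (K0 <= K1)%N /\ forall K, (K1 <= K)%N ->
    [/\ r K <= 1, cov_form alpha (fx K) (e1K K) (e2K K) 1 0 <= `|cov_form alpha fl e1 e2 1 0| + 1 &
     cov_form alpha (fx K) (e1K K) (e2K K) 0 1 <= `|cov_form alpha fl e1 e2 0 1| + 1].
  have [N1 _ H1] := rb; have [N2 _ H2] := bnd 1 0; have [N3 _ H3] := bnd 0 1.
  exists (maxn K0 (maxn N1 (maxn N2 N3))); split; first exact: leq_maxl.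
  move=> K; rewrite !geq_max => /and4P[_ n1 n2 n3].
  by split; [exact: H1|exact: H2|exact: H3].
have {}Hr K (k : (K1 <= K)%N) := Hr K (leq_trans K01 k).
have EW K u v (k : (K1 <= K)%N) : Ex P (fun w => `|W K u v w|) <= 1 + cov_form alpha (fx K) (e1K K) (e2K K) u v.
  have [L E] := Wsq K (leq_trans K01 k) u v.
  have L1' := L1D (L1_cst P 1) L.
  apply: (@le_trans _ _ (Ex P (fun w => 1 + W K u v w ^+ 2))).
    apply: Ex_le => //; first exact: L1_norm (LW K u v (leq_trans K01 k)).
    by move=> w; rewrite -(real_normK (num_real (W K u v w))); have := sqr_ge0 (`|W K u v w| - 1); nra.
  by rewrite (ExD (L1_cst P 1) L) Ex_cst lerD2l.
have tight (V : Om -> R) K u v : (K1 <= K)%N -> L1 P V -> Ex P (fun w => `|V w - W K u v w|) <= r K ->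
    r K <= 1 -> cov_form alpha (fx K) (e1K K) (e2K K) u v <= C - 2 -> Ex P (fun w => `|V w|) <= C.
  move=> k LV h1 h2 h3; have LWk := LW K u v (leq_trans K01 k).
  have LD := L1_norm (L1B LV LWk); have LN := L1_norm LWk.
  apply: (@le_trans _ _ (Ex P (fun w => `|V w - W K u v w| + `|W K u v w|))).
    apply: Ex_le; [exact: L1_norm|exact: (L1D LD LN)|].
    by move=> w; have := ler_normD (V w - W K u v w) (W K u v w); rewrite subrK.
  by rewrite (ExD LD LN); have := EW K u v k; lra.
apply: (@char_cvg_law _ _ _ P _ mu K1 C) => [K k|K k|K k|K k|K k|u v t].
- have [L L' _ _] := Hr K k.
  exact: (measurable_fun_pair (L1_meas L) (L1_meas L')).
- by have [] := Hr K k.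
- by have [] := Hr K k.
- have [L _ h _] := Hr K k; have [h1 h2 _] := HK1 K k.
  by apply: (tight (V1 K) K 1 0) => //; rewrite /C; have := normr_ge0 (cov_form alpha fl e1 e2 0 1); lra.
- have [_ L _ h] := Hr K k; have [h1 _ h2] := HK1 K k.
  by apply: (tight (V2 K) K 0 1) => //; rewrite /C; have := normr_ge0 (cov_form alpha fl e1 e2 1 0); lra.
rewrite muE; have c1 := @clt u v t.
have rc' : (fun K => (`|u| + `|v|) * r K) @ \oo --> (0 : R).
  by rewrite -[X in _ --> X](mulr0 (`|u| + `|v|)); apply: cvgM => //; exact: cvg_cst.
apply/cvgrPdist_le => e e0.
have e2' : 0 < e / 2 by rewrite divr_gt0.
near=> K.
have k : (K1 <= K)%N by near: K; exact: nbhs_infty_ge.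
have h1 : `|cos t * expR (- (cov_form alpha fl e1 e2 u v / 2)) - Ex P (fun w => cos (W K u v w + t))| <= e / 2.
  by near: K; move/cvgrPdist_le : c1 => /(_ _ e2').
have h2 : (`|u| + `|v|) * r K <= e / 2.
  apply: le_trans (ler_norm _) _; rewrite -normrN -[- _]sub0r.
  by near: K; move/cvgrPdist_le : rc' => /(_ _ e2').
have [L L' a1' a2'] := Hr K k.
have k' := leq_trans K01 k.
have LD1 := L1_norm (L1B L (LW K 1 0 k')); have LD2 := L1_norm (L1B L' (LW K 0 1 k')).
have mcos (Z : Om -> R) : L1 P Z -> L1 P (fun w => cos (Z w + t)).
  move=> LZ; apply: (@L1_bounded _ _ _ _ _ 1) => [|w]; last exact: cos_max.
  by have := L1_meas LZ => ?; meas.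
have LV := L1D (L1Z u L) (L1Z v L').
have h3 : `|Ex P (fun w => cos (u * V1 K w + v * V2 K w + t)) - Ex P (fun w => cos (W K u v w + t))| <= (`|u| + `|v|) * r K.
  rewrite -(ExB (mcos _ LV) (mcos _ (LW K u v k'))).
  apply: (@le_trans _ _ (Ex P (fun w => `|u| * `|V1 K w - W K 1 0 w| + `|v| * `|V2 K w - W K 0 1 w|))).
    apply: Ex_norm_le; [exact: (L1B (mcos _ LV) (mcos _ (LW K u v k')))|exact: (L1D (L1Z _ LD1) (L1Z _ LD2))|].
    move=> w; apply: le_trans (cos_lipschitz _ _) _.
    rewrite /W (influence_sum_lin _ _ _ _ _ _ _ _ u v) -/(W K 1 0 w) -/(W K 0 1 w).
    have -> : u * V1 K w + v * V2 K w + t - (u * W K 1 0 w + v * W K 0 1 w + t) =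
      u * (V1 K w - W K 1 0 w) + v * (V2 K w - W K 0 1 w) by ring.
    by apply: le_trans (ler_normD _ _) _; rewrite !normrM.
  rewrite (ExD (L1Z _ LD1) (L1Z _ LD2)) (ExZ _ LD1) (ExZ _ LD2) mulrDl.
  by apply: lerD; rewrite ler_wpM2l.
have := ler_distD (Ex P (fun w => cos (W K u v w + t))) (cos t * expR (- (cov_form alpha fl e1 e2 u v / 2)))
  (Ex P (fun w => cos (u * V1 K w + v * V2 K w + t))).
rewrite distrC in h3; lra.
Unshelve. all: by end_near. Qed.

End nsa_clt.

Lemma gauss2_cos {R : realType} (s11 s12 s22 : R) (mu : probability (R * R)%type R) (u v t : R) :
  is_gauss2 s11 s12 s22 mu ->
  Ex mu (fun p => cos (u * p.1 + v * p.2 + t)) =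
  cos t * expR (- ((u ^+ 2 * s11 + 2 * u * v * s12 + v ^+ 2 * s22) / 2)).
Proof.
move=> /(_ u v)[hc hs].
have mp : measurable_fun setT (fun p : R * R => u * p.1 + v * p.2) by meas.
have Lc : L1 mu (fun p => cos (u * p.1 + v * p.2)).
  by apply: (@L1_bounded _ _ _ _ _ 1) => [|p]; [meas|exact: cos_max].
have Ls : L1 mu (fun p => sin (u * p.1 + v * p.2)).
  by apply: (@L1_bounded _ _ _ _ _ 1) => [|p]; [meas|exact: sin_max].
have -> : (fun p : R * R => cos (u * p.1 + v * p.2 + t)) =
    (fun p => cos t * cos (u * p.1 + v * p.2) - sin t * sin (u * p.1 + v * p.2)).
  by apply/funext => p; rewrite cosD mulrC (mulrC (sin _)).
rewrite (ExB (L1Z _ Lc) (L1Z _ Ls)) (ExZ _ Lc) (ExZ _ Ls).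
have -> : Ex mu (fun p => sin (u * p.1 + v * p.2)) = 0 by exact: (congr1 fine hs).
have -> : Ex mu (fun p => cos (u * p.1 + v * p.2)) = _ := congr1 fine hc.
by rewrite /= mulr0 subr0 mulNr.
Qed.

Lemma fine_variance {R : realType} {d : measure_display} {Om : measurableType d} (P : probability Om R)
  (S : Om -> R) : measurable_fun setT S -> L1 P (fun w => S w ^+ 2) ->
  fine ('V_P[S])%E = Ex P (fun w => S w ^+ 2) - Ex P S ^+ 2.
Proof.
move=> mS L2; have LS := L1_sqr_le mS L2.
have -> : fine ('V_P[S])%E = Ex P (fun w => S w ^+ 2 + (- 2 * Ex P S) * S w + Ex P S ^+ 2).
  rewrite /variance unlock EfineE; congr (Ex P _); apply/funext => w /=.
  by rewrite fctE /= EfineE /cst; ring.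
rewrite (ExD (L1D L2 (L1Z _ LS)) (L1_cst P _)) (ExD L2 (L1Z _ LS)) (ExZ _ LS) Ex_cst.
by ring.
Qed.

(** The form is a second moment, hence nonnegative; at [(- s12, s11)] it equals [s11] times the
    determinant. *)
Lemma cov_form_psd {R : realType} {d : measure_display} {Om : measurableType d} (P : probability Om R)
  (alpha : R) (X : Om -> R) (xs fx : R) : 0 < alpha < 1 -> measurable_fun setT X ->
  L1 P (fun w => X w ^+ 2) -> meanH P alpha X xs = 0 -> 0 < fx ->
  (alpha / (1 - alpha) * Ex P (fun w => posp (X w - xs)) / fx) ^+ 2 <=
  alpha * (1 - alpha) / fx ^+ 2 *
  ((Ex P (fun w => posp (X w - xs) ^+ 2) - Ex P (fun w => posp (X w - xs)) ^+ 2) / (1 - alpha) ^+ 2).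
Proof.
move=> a01 mX L2 D0 fx0.
set e1 := Ex P (fun w => posp (X w - xs)); set e2 := Ex P (fun w => posp (X w - xs) ^+ 2).
set s11 := _ / fx ^+ 2; set s12 := _ / fx; set s22 := _ / _ ^+ 2.
have s110 : 0 < s11.
  by case/andP: a01 => a0 a1; rewrite divr_gt0 ?exprn_gt0// mulr_gt0// subr_gt0.
have [_ E] := influence_sqr a01 mX L2 D0 fx0 (- s12) s11.
have : 0 <= s11 * (s11 * s22 - s12 ^+ 2).
  have -> : s11 * (s11 * s22 - s12 ^+ 2) = cov_form alpha fx e1 e2 (- s12) s11.
    by rewrite /cov_form -/s11 -/s12 -/s22; ring.
  by rewrite -E; apply: Ex_ge0 => w; exact: sqr_ge0.
by rewrite pmulr_rge0// subr_ge0.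
Qed.

Theorem mainTheorem3
  (R : realType) (dO : measure_display) (Omega : measurableType dO)
  (P : probability Omega R)
  (alpha : R) (halpha : 0 < alpha < 1)
  (d q : nat)
  (Y : Omega -> @Rvec R d) (Z : Omega -> @Rvec R q)
  (phi : (@Rvec R d * @Rvec R q)%type -> R)
  (mY : measurable_fun setT Y) (mZ : measurable_fun setT Z)
  (mphi : measurable_fun setT phi)
  (indYZ : indep2 P Y Z)
  (phiL1 : P.-integrable setT (EFin \o (fun w => phi (Y w, Z w))))
  (delta : R) (hdelta : 0 < delta)
  (phi_mom : ('E_P[(fun w => `|phi (Y w, Z w)| `^ (2 + delta))%R] < +oo)%E)
  (* X_0 = E[phi(Y,Z) | Y] *)
  (X0 : Omega -> R) (hX0 : cond_exp_of P Y (fun w => phi (Y w, Z w)) X0)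
  (* for h = 1/K : Zs K k, k < K, are i.i.d. copies of Z independent of Y *)
  (Zs : nat -> nat -> Omega -> @Rvec R q)
  (hZs : forall K, (0 < K)%N ->
     (forall k, (k < K)%N -> measurable_fun setT (Zs K k) /\ same_law P (Zs K k) Z)
     /\ indep_family P Y (Zs K) K)
  (* Xs K n (n >= 0) is X_h^{(n+1)}: i.i.d. copies of X_h, and xi0 K = xi^h_0 independent of them *)
  (Xs : nat -> nat -> Omega -> R) (xi0 : nat -> Omega -> R)
  (hXs : forall K, (0 < K)%N ->
     (forall n, measurable_fun setT (Xs K n) /\
        same_law P (Xs K n) (fun w => (K%:R)^-1 * \sum_(k < K) phi (Y w, Zs K k w)))
     /\ measurable_fun setT (xi0 K)
     /\ (forall N, indep_family P (xi0 K) (Xs K) N))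
  (* pdfs of X_h (h = 1/K) and of X_0 *)
  (f : nat -> R -> R) (f0 : R -> R)
  (hf : forall K, (0 < K)%N ->
     is_pdf P (fun w => (K%:R)^-1 * \sum_(k < K) phi (Y w, Zs K k w)) (f K))
  (hf0 : is_pdf P X0 f0)
  (* minimizers of V_h and V_0 *)
  (xis : nat -> R) (xis0 : R)
  (hxis : forall K, (0 < K)%N ->
     is_minimizer (Vfun P alpha (fun w => (K%:R)^-1 * \sum_(k < K) phi (Y w, Zs K k w))) (xis K))
  (hxis0 : is_minimizer (Vfun P alpha X0) xis0)
  (* Assumption A (i) *)
  (hAi : exists (v : R -> R) (w : R -> nat -> R),
     (forall K, (0 < K)%N -> forall xi,
        cdf_of P (fun w => (K%:R)^-1 * \sum_(k < K) phi (Y w, Zs K k w)) xi - cdf_of P X0 xi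
        = v xi * (K%:R)^-1 + w xi K * (K%:R)^-1)
     /\ (forall m, is_minimizer (Vfun P alpha X0) m ->
          lebesgue_measure.-integrable `[m, +oo[ (EFin \o v)
          /\ (fun K => w m K) @ \oo --> 0
          /\ (fun K => \int[lebesgue_measure]_(x in `[m, +oo[) (w x K)%:E)%E @ \oo --> 0%E))
  (* Assumption A (ii) *)
  (hAii_cont : (forall K, (0 < K)%N -> continuous (f K)) /\ continuous f0)
  (hAii_cvg : forall r e : R, 0 < r -> 0 < e ->
     \forall K \near \oo, forall x, `|x| <= r -> `|f K x - f0 x| <= e)
  (* Assumption A (iii) *)
  (hAiii : forall r : R, 0 < r -> exists c : R, 0 < c /\
     (forall K, (0 < K)%N -> forall x, `|x - xis0| < r -> c <= f K x)
     /\ (forall x, `|x - xis0| < r -> c <= f0 x))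
  (* Assumption A (iv) *)
  (hAiv : exists M : R,
     (forall K, (0 < K)%N -> forall x y, `|f K x| <= M /\ `|f K x - f K y| <= M * `|x - y|)
     /\ (forall x y, `|f0 x| <= M /\ `|f0 x - f0 y| <= M * `|x - y|))
  (* Assumption B *)
  (hB : exists C : R, forall K, (0 < K)%N ->
     ('E_P[(fun w => xi0 K w ^+ 2 *
        expR (4 / (1 - alpha) * Num.max 1 (alpha / (1 - alpha))
              * sup [set r | exists K' x, (0 < K')%N /\ r = `|f K' x|] * `|xi0 K w|))%R]
      <= C%:E)%E)
  (* step sequence *)
  (gamma1 beta : R) (hgamma1 : 0 < gamma1) (hbeta : 1 / 2 < beta < 1) :
  let gamma := fun n : nat => gamma1 * (n%:R) `^ (- beta) in
  exists mu : probability (R * R)%type R,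
    is_gauss2
      (alpha * (1 - alpha) / f0 xis0 ^+ 2)
      (alpha / (1 - alpha) * fine ('E_P[fun w => posp (X0 w - xis0)]) / f0 xis0)
      (fine ('V_P[fun w => posp (X0 w - xis0)]) / (1 - alpha) ^+ 2)
      mu
    /\ cvg_law P
         (fun K w =>
            let XK := fun w' => (K%:R)^-1 * \sum_(k < K) phi (Y w', Zs K k w') in
            (K%:R * (xibar alpha gamma (Xs K) (xi0 K) (K ^ 2) w - xis K),
             K%:R * ((nsa alpha gamma (Xs K) (xi0 K) (K ^ 2) w).2
                     - Vfun P alpha XK (xis K))))
         mu.
Proof.
have ha := halpha.
move=> gamma.
have [/andP[al0 al1] /andP[be0 be1]] := (halpha, hbeta).
have bet : 2^-1 < beta < 1 by rewrite -[2^-1]div1r be0.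
have a0 : 0 < (1 - alpha)^-1 by rewrite invr_gt0 subr_gt0.
pose X K (w : Omega) := K%:R^-1 * \sum_(k < K) phi (Y w, Zs K k w).
have mZs K (k : (0 < K)%N) i (iK : (i < K)%N) : measurable_fun setT (Zs K i) := proj1 (proj1 (hZs K k) i iK).
have lawZs K (k : (0 < K)%N) i (iK : (i < K)%N) : same_law P (Zs K i) Z := proj2 (proj1 (hZs K k) i iK).
have indZs K (k : (0 < K)%N) := proj2 (hZs K k).
have mphiYZ : measurable_fun setT (fun w => phi (Y w, Z w)).
  by apply: (measurableT_comp mphi); exact: measurable_fun_pair.
have L2phi := moment_L2 mphiYZ hdelta phi_mom.
have mX K (k : (0 < K)%N) : measurable_fun setT (X K) := average_measurable mY mphi (mZs K k).
have LX2 K (k : (0 < K)%N) : L1 P (fun w => X K w ^+ 2) :=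
  average_L2 mY mZ mphi (mZs K k) (lawZs K k) indYZ (indZs K k) k L2phi.
have UI e : 0 < e -> exists2 r, 0 <= r & forall K, (0 < K)%N -> Ex P (fun w => tailsq r (X K w)) <= e.
  move=> e0; have e4 : 0 < e / 4 by rewrite divr_gt0.
  have [r r0 Hr] := moment_tail mphiYZ hdelta phi_mom e4.
  exists (2 * r) => [|K k]; first by rewrite mulr_ge0.
  apply: le_trans (average_tail mY mZ mphi (mZs K k) (lawZs K k) indYZ (indZs K k) k L2phi r0) _.
  by rewrite mulrC -ler_pdivlMr.
have [_ [LX0 _]] := hX0.
have mX0 : measurable_fun setT X0 := L1_meas LX0.
have [M [hM hM0]] := hAiv.
(* A ball around [xis0] wide enough to contain [x] turns the local lower bounds into positivity at
   every point. *)
have fpos x : (forall K, (0 < K)%N -> 0 < f K x) /\ 0 < f0 x.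
  have r0 : 0 < `|x - xis0| + 1 by rewrite ltr_wpDl.
  have [c [c0 [Hc Hc0]]] := hAiii _ r0.
  by split=> [K k|]; apply: lt_le_trans c0 _; [apply: Hc|apply: Hc0] => //; rewrite ltrDl.
have fge0 K (k : (0 < K)%N) x : 0 <= f K x := ltW (proj1 (fpos x) K k).
have f0ge0 x : 0 <= f0 x := ltW (proj2 (fpos x)).
have fM K (k : (0 < K)%N) x : f K x <= M := le_trans (ler_norm _) (proj1 (hM K k x x)).
have f0M x : f0 x <= M := le_trans (ler_norm _) (proj1 (hM0 x x)).
have flip K (k : (0 < K)%N) x y : `|f K x - f K y| <= M * `|x - y| := proj2 (hM K k x y).
have f0lip x y : `|f0 x - f0 y| <= M * `|x - y| := proj2 (hM0 x y).
have fpos' r : 0 < r -> exists2 c, 0 < c & forall K, (0 < K)%N -> forall x, `|x - xis0| < r -> c <= f K x.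
  by move=> r0; have [c [c0 [Hc _]]] := hAiii r r0; exists c.
have cxi := minimizer_cvg ha mX mX0 LX2 UI hf hf0 fge0 f0ge0 fM f0M flip f0lip hAii_cvg fpos' hxis hxis0.
have cf := pdf_minimizer_cvg ha mX mX0 LX2 UI hf hf0 fge0 f0ge0 fM f0M flip f0lip hAii_cvg fpos' hxis hxis0.
have c1 := excess_cvg ha mX mX0 LX2 UI hf hf0 fge0 f0ge0 fM f0M flip f0lip hAii_cvg fpos' hxis hxis0.
have c2 := excess_sqr_cvg ha mX mX0 LX2 UI hf hf0 fge0 f0ge0 fM f0M flip f0lip hAii_cvg fpos' hxis hxis0.
have L20 := limit_sqr_L1 mX mX0 LX2 UI hf hf0 fge0 f0ge0 flip f0lip hAii_cvg.
have D0 := limit_meanH0 ha mX mX0 LX2 UI hf hf0 fge0 f0ge0 f0M flip f0lip hAii_cvg hxis0.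
have fl0 := proj2 (fpos xis0).
have s110 : 0 < alpha * (1 - alpha) / f0 xis0 ^+ 2.
  by rewrite divr_gt0 ?exprn_gt0// mulr_gt0// subr_gt0.
have [mu hmu] := gauss2_exists s110 (cov_form_psd ha mX0 L20 D0 fl0).
exists mu; split.
  rewrite EfineE fine_variance; [exact: hmu|by meas|exact: posp_sqr_L1].
set e1 := Ex P (fun w => posp (X0 w - xis0)) in c1 hmu.
set e2 := Ex P (fun w => posp (X0 w - xis0) ^+ 2) in c2 hmu.
(* From rank [N] on the minimizers and the mean excesses are within 1 of their limits, which makes
   the constants below uniform in [K]. *)
have [N [N0 HN]] : exists N, (0 < N)%N /\ forall K, (N <= K)%N ->
    `|xis0 - xis K| <= 1 /\ `|e1 - Ex P (fun w => posp (X K w - xis K))| <= 1.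
  have /cvgrPdist_le/(_ _ ltr01)[N1 _ H1] := cxi.
  have /cvgrPdist_le/(_ _ ltr01)[N2 _ H2] := c1.
  exists (maxn 1 (maxn N1 N2)); split; first exact: leq_maxl.
  by move=> K; rewrite !geq_max => /and3P[_ n1 n2]; split; [exact: H1|exact: H2].
have Np K : (N <= K)%N -> (0 < K)%N := leq_trans N0.
have xisB K : (N <= K)%N -> `|xis K| <= `|xis0| + 1.
  by move=> /HN[h _]; have := ler_distD xis0 0 (xis K); rewrite !sub0r !normrN; lra.
(* A point within 1 of [xis K] is within 2 of [xis0], strictly inside this ball. *)
have [c [c0 [Hc _]]] := hAiii 3 (ltr0n R 3).
pose S := [set r | exists K' x, (0 < K')%N /\ r = `|f K' x|].
(* The bound [M] makes [sup] a true supremum rather than its default value; positivity of the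
   exponent in Assumption B allows [l > 0]. *)
have supS : 0 < sup S.
  apply: (@lt_le_trans _ _ (f 1 xis0)); first exact: (proj1 (fpos xis0)).
  apply: ub_le_sup; last by exists 1%N, xis0; split => //; rewrite ger0_norm ?fge0.
  by exists M => _ [K [x [k ->]]]; case: (hM K k x x).
pose cB := 4 / (1 - alpha) * Num.max 1 (alpha / (1 - alpha)) * sup S.
have cB0 : 0 < cB by rewrite mulr_gt0// mulr_gt0 ?lt_max ?ltr01// mulr_gt0.
(* The three constraints on the Lyapunov exponent: [l <= 1] for [lyap_drift], [l <= cB] for an
   initial moment controlled by Assumption B, and the last for
   [l * gamma1 / (1 - alpha) <= 2^-1]. *)
pose l := Num.min 1 (Num.min cB ((1 - alpha) / (2 * gamma1))).
have l01 : 0 < l <= 1.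
  rewrite /l ge_min lexx !lt_min ltr01 cB0 andbT /=.
  by rewrite divr_gt0 ?mulr_gt0// subr_gt0.
have lc : l <= cB by rewrite /l ge_min [X in _ || X]ge_min lexx orbT.
have lg : l * gamma1 * (1 - alpha)^-1 <= 2^-1.
  have h : l <= (1 - alpha) / (2 * gamma1) by rewrite /l ge_min [X in _ || X]ge_min lexx !orbT.
  have al : 0 < 1 - alpha by rewrite subr_gt0.
  apply: (@le_trans _ _ ((1 - alpha) / (2 * gamma1) * gamma1 * (1 - alpha)^-1)).
    by rewrite !ler_pM2r.
  by rewrite le_eqVlt; apply/orP; left; apply/eqP; field; rewrite !gt_eqF.
have [C HC] := hB.
have init K (n : (N <= K)%N) :=
  lyap_initial (proj1 (proj2 (hXs K (Np K n)))) l01 lc (xisB K n) (HC K (Np K n)).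
have main : cvg_law P (fun K w => (xi_error alpha gamma (Xs K) (xi0 K) (xis K) K w,
    chi_error P alpha gamma (Xs K) (xi0 K) (X K) (xis K) K w)) mu; last exact: main.
apply: (@nsa_clt _ _ _ P alpha gamma1 beta Xs xi0 X f xis M c (`|xis0| + 1 + (`|e1| + 1)) l
  (2 * expR (`|xis0| + 1) * (expR cB + C)) (f0 xis0) e1 e2 N mu) => //.
- by move=> K /Np/hXs[_ []].
- by move=> K /Np/hXs[h _] n; case: (h n).
- by move=> K /Np; exact: mX.
- by move=> K /Np; exact: LX2.
- by move=> K /Np/hXs[h _] n; case: (h n).
- by move=> K /Np/hXs[_ []].
- by move=> K /Np; exact: hf.
- by move=> K /Np; exact: fge0.
- by move=> K /Np; exact: fM.
- by move=> K /Np; exact: flip.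
- by move=> K /Np; exact: hxis.
- move=> K n u hu; apply: Hc; first exact: Np.
  have [h _] := HN K n; have := ler_distD (xis K) u xis0; rewrite (distrC (xis K)); lra.
- move=> K n; apply: lerD; first exact: xisB.
  have [_ h] := HN K n; have := ler_distD e1 0 (Ex P (fun w => posp (X K w - xis K))).
  by rewrite !sub0r !normrN; lra.
- by move=> K n; case: (init K n).
- by move=> K n; case: (init K n).
- by move=> e e0; have [r r0 Hr] := UI e e0; exists r => // K /Np; exact: Hr.
- by move=> u v t; rewrite (gauss2_cos _ _ _ hmu).
Qed.
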